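(* Let $M$ be a (finite-dimensional) $\mathbb{F}[G]$-module. For $1\le t\le p$ let $\ell_t$ be the multiplicity of $V_t$ as a composition factor of $M$. Let $\mathrm{Res}^G_B(M)\cong\bigoplus_{a=0}^{p-2}\bigoplus_{b=1}^{p}U_{a,b}^{\oplus n_{a,b}}$ with multiplicities $n_{a,b}\in\mathbb{N}$. Let $c_{a,b,t}$ be the multiplicity of $V_t$ as a composition factor of $V_{a,b}$. Then $$M\cong\bigoplus_{a=0}^{p-2}\bigoplus_{b=1}^{p-1}V_{a,b}^{\oplus n_{a,b}}\oplus\bigoplus_{i=1}^{p}P_{V_i}^{\oplus n_i},$$ where, setting $$\alpha_t=\begin{cases}\ell_t-\sum_{a=0}^{p-2}\sum_{b=1}^{p-1}n_{a,b}\,c_{a,b,t}&\text{if }1\le t\le p-1,\\ \ell_p&\text{if }t=p,\end{cases}$$ one has $n_p=\alpha_p$ and, for $1\le i\le p-1$ (all sums being over $1\le j\le \frac{p-1}{2}$ of the indicated parity), $$n_i=\begin{cases}\sum_{j\text{ odd}}\Gamma_{i,j}\alpha_j+\sum_{j\text{ even}}\Gamma_{i,j}\alpha_{p-j}&\text{if } i\in[1,\frac{p-1}{2}]\text{ odd},\\ \sum_{j\text{ odd}}\Gamma_{p-i,j}\alpha_j+\sum_{j\text{ even}}\Gamma_{p-i,j}\alpha_{p-j}&\text{if } i\in[\frac{p+1}{2},p-1]\text{ odd},\\ \sum_{j\text{ odd}}\Gamma_{i,j}\alpha_{p-j}+\sum_{j\text{ even}}\Gamma_{i,j}\alpha_{j}&\text{if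 } i\in[1,\frac{p-1}{2}]\text{ even},\\ \sum_{j\text{ odd}}\Gamma_{p-i,j}\alpha_{p-j}+\sum_{j\text{ even}}\Gamma_{p-i,j}\alpha_{j}&\text{if } i\in[\frac{p+1}{2},p-1]\text{ even}.\end{cases}$$
   Context: Let $p$ be an odd prime, $\mathbb{F}$ an algebraically closed field of characteristic $p$, $G=SL_2(\mathbb{F}_p)$ and $B\le G$ the subgroup of upper triangular matrices. All modules are finite-dimensional right modules. Let $\zeta$ be a generator of $\mathbb{F}_p^\times$, $g=\begin{pmatrix}1&1\\0&1\end{pmatrix}$ and $\lambda=\begin{pmatrix}\zeta&0\\0&\zeta^{-1}\end{pmatrix}$, so $B=\langle g,\lambda\rangle$. For $a\in\mathbb{Z}$, $S_a$ is the one-dimensional $\mathbb{F}[B]$-module on which $g$ acts trivially and $\lambda$ acts as $\zeta^a$. For $1\le b\le p$, $U_{a,b}$ is the (unique up to isomorphism) uniserial $\mathbb{F}[B]$-module of dimension $b$ whose composition factors, from the socle upwards, are $S_a,S_{a+2},S_{a+4},\dots$. The $U_{a,b}$ with $0\le a\le p-2$, $1\le b\le p$ are all the indecomposable $\mathbb{F}[B]$-modules; $U_{a,b}$ is projective iff $b=p$. For $1\le t\le p$, $V_t\subset\mathbb{F}[x,y]$ is the space of homogeneous polynomials of degree $t-1$ with right action $x^iy^j\cdot\begin{pmatrix}\alpha&\beta\\\gamma&\delta\end{pmatrix}=(\alpha x+\beta y)^i(\gamma x+\delta y)^j$; these are the simple $\mathbb{F}[G]$-modules. $P_{V_t}$ is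 the projective cover of $V_t$. For $0\le a\le p-2$, $1\le b\le p-1$, $V_{a,b}$ is the Green correspondent of $U_{a,b}$: the unique (up to isomorphism) non-projective indecomposable $\mathbb{F}[G]$-module whose restriction to $B$ is isomorphic to $U_{a,b}\oplus(\text{projective})$. For $1\le i,j\le\frac{p-1}{2}$, $$\Gamma_{i,j}=\begin{cases}(-1)^{i+j}\left(i-\frac{2ij}{p}\right)&\text{if } i\le j,\\(-1)^{i+j}\left(j-\frac{2ij}{p}\right)&\text{if } i>j.\end{cases}$$ *)

(* Defs.v *)
From HB Require Import structures.
From mathcomp Require Import all_boot all_order all_algebra all_fingroup.
From mathcomp Require Import mxrepresentation character.
From mathcomp Require Import mpoly.

Set Implicit Arguments.
Unset Strict Implicit.
Unset Printing Implicit Defensive.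

Import GroupScope GRing.Theory.
Local Open Scope ring_scope.

(* A finite-dimensional right F[G]-module is a value of type                  *)
(* representation F G: the elements of G act on row vectors by right          *)
(* multiplication.  Isomorphism is mx_rsim and direct sum is dadd_grepr.      *)

Section Modules.

Variables (F : fieldType) (gT : finGroupType) (G : {group gT}).
Implicit Types (W X Y P : representation F G).

Definition is_hom W X (f : 'M[F]_(rdegree W, rdegree X)) : Prop :=
  forall x, x \in G -> W x *m f = f *m X x.

Definition projective P : Prop :=
  forall X Y (e : 'M_(rdegree X, rdegree Y)) (h : 'M_(rdegree P, rdegree Y)),
    is_hom e -> row_full e -> is_hom h ->
  exists k : 'M_(rdegree P, rdegree X), is_hom k /\ k *m e = h.

Definition indecomposable W : Prop :=
  (0 < rdegree W)%N /\
  forall X Y, mx_rsim W (dadd_grepr X Y) -> rdegree X = 0%N \/ rdegree Y = 0%N.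

(* P with an essential epimorphism onto W: no proper submodule of P together  *)
(* with the kernel spans P.                                                   *)
Definition is_projective_cover P W : Prop :=
  projective P /\
  exists e : 'M_(rdegree P, rdegree W),
    [/\ is_hom e, row_full e &
        forall N : 'M_(rdegree P), mxmodule P N ->
          row_full (N + kermx e)%MS -> row_full N].

(* The submodules of W are linearly ordered by inclusion. *)
Definition uniserial W : Prop :=
  forall N N' : 'M_(rdegree W), mxmodule W N -> mxmodule W N' ->
    (N <= N')%MS || (N' <= N)%MS.

(* X occurs k times among the factors of a composition series of W (of any,   *)
(* by mx_JordanHolder).                                                       *)
Definition comp_mult W X (k : nat) : Prop :=
  exists (Ns : seq 'M_(rdegree W)) (compN : mx_composition_series W Ns),
    (last 0 Ns :=: 1%:M)%MS /\
    exists I : {set 'I_(size Ns)},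
      (forall i : 'I_(size Ns), i \in I <-> mx_rsim (series_repr i compN) X) /\
      #|I| = k.

Definition res_grepr (H : {group gT}) (sHG : H \subset G) W :
  representation F H := Representation (subg_repr W sHG).

End Modules.

Section SL2.

Variable p : nat.

Definition SL2_set : {set {'GL_2['F_p]}} := [set x | \det (GLval x) == 1].

Fact SL2_group_set : group_set SL2_set.
Proof.
apply/group_setP; split=> [|x y]; rewrite !inE /= ?det1 //.
by move=> /eqP dx /eqP dy; rewrite det_mulmx dx dy mulr1.
Qed.

Definition SL2 : {group {'GL_2['F_p]}} := Group SL2_group_set.

Definition borel_set : {set {'GL_2['F_p]}} :=
  [set x in SL2 | GLval x 1 0 == 0].

Fact borel_group_set : group_set borel_set.
Proof.
apply/group_setP; split=> [|x y].
  by rewrite inE group1 /= mxE.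
move=> /setIdP[Gx /eqP x10] /setIdP[Gy /eqP y10].
apply/setIdP; split; first exact: groupM.
by rewrite GL_MxE mxE big_ord_recl big_ord1 /= x10 mul0r add0r
  (_ : lift _ _ = 1) ?y10 ?mulr0 //; apply: val_inj.
Qed.

Definition borel : {group {'GL_2['F_p]}} := Group borel_group_set.

Lemma borel_sub : borel \subset SL2.
Proof. by apply/subsetP=> x /setIdP[]. Qed.

End SL2.

(* The embedding of the prime field; a ring morphism once p is the            *)
(* characteristic of F.                                                       *)
Definition Fp_emb (F : fieldType) (p : nat) (x : 'F_p) : F := (nat_of_ord x)%:R.

Section FpEmb.

Variables (F : fieldType) (p : nat) (charF : p \in [pchar F]).
Local Notation emb := (@Fp_emb F p).

Fact natr_modp m : (m %% (Zp_trunc (pdiv p)).+2)%:R = m%:R :> F.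
Proof.
rewrite (Fp_cast (pcharf_prime charF)).
by rewrite [in RHS](divn_eq m p) natrD natrM (pcharf0 charF) mulr0 add0r.
Qed.

Lemma Fp_emb0 : emb 0 = 0. Proof. by []. Qed.
Lemma Fp_emb1 : emb 1 = 1. Proof. by []. Qed.

Lemma Fp_embD x y : emb (x + y) = emb x + emb y.
Proof. by rewrite /Fp_emb /= natr_modp natrD. Qed.

Lemma Fp_embM x y : emb (x * y) = emb x * emb y.
Proof. by rewrite /Fp_emb /= natr_modp natrM. Qed.

End FpEmb.

Section Modular.

Variables (F : fieldType) (p : nat) (charF : p \in [pchar F]).
Local Notation emb := (@Fp_emb F p).
Local Notation GL2 := {'GL_2['F_p]}.

Fact borel_mul00 (x y : GL2) : y \in borel p ->
  GLval (x * y)%g 0 0 = GLval x 0 0 * GLval y 0 0.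
Proof.
case/setIdP=> _ /eqP y10; rewrite GL_MxE mxE big_ord_recl big_ord1 /=.
by rewrite (_ : lift _ _ = 1) ?y10 ?mulr0 ?addr0 //; apply: val_inj.
Qed.

Fact S_mx_repr (a : int) :
  mx_repr (borel p) (fun x : GL2 => (emb (GLval x 0 0) ^ a)%:M : 'M[F]_1).
Proof.
split=> [|x y _ By]; first by rewrite GL_1E mxE eqxx Fp_emb1 exp1rz.
by rewrite borel_mul00 // (Fp_embM charF) expfzMl scalar_mxM.
Qed.

(* S_a in closed form: g = [1, 1; 0, 1] acts as 1 and                         *)
(* lambda = [zeta, 0; 0, zeta^-1] as zeta ^ a.                                *)
Definition S_mod (a : int) : representation F (borel p) :=
  Representation (MxRepresentation (S_mx_repr a)).

(* Composition series are increasing, so the i-th factor is counted from the  *)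
(* socle upwards.                                                             *)
Definition is_U (a b : nat) (W : representation F (borel p)) : Prop :=
  [/\ rdegree W = b, uniserial W &
      exists (Ns : seq 'M_(rdegree W)) (compN : mx_composition_series W Ns),
        [/\ (last 0 Ns :=: 1%:M)%MS, size Ns = b &
            forall i, (i < b)%N ->
              mx_rsim (series_repr i compN) (S_mod (a + i.*2)%N%:Z)]].

Definition is_green_correspondent (U : representation F (borel p))
    (V : representation F (SL2 p)) : Prop :=
  [/\ ~ projective V, indecomposable V &
      exists Q : representation F (borel p),
        projective Q /\ mx_rsim (res_grepr (borel_sub p) V) (dadd_grepr U Q)].

(* The images of 'X_0 (for x) and 'X_1 (for y) under a group element. *)
Definition V_subst (x : GL2) : 2.-tuple {mpoly F[2]} :=
  [tuple emb (GLval x k 0) *: 'X_0 + emb (GLval x k 1) *: 'X_1 | k < 2].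

(* The exponent of x^i y^(t-1-i). *)
Definition V_mnm (t i : nat) : 'X_{1..2} :=
  (U_(0%R) *+ i + U_(1%R) *+ (t.-1 - i))%MM.

(* The action on homogeneous polynomials of degree t - 1, in the basis of     *)
(* the monomials x^i y^(t-1-i), 0 <= i < t.                                   *)
Definition V_mx (t : nat) (x : GL2) : 'M[F]_t :=
  \matrix_(i < t, j < t) ('X_[V_mnm t i] \mPo V_subst x)@_(V_mnm t j).

Fact V_mnm0 t i : V_mnm t i 0 = i.
Proof. by rewrite mnmDE !mulmnE !mnm1E /= mul1n mul0n addn0. Qed.

Fact V_mnm1 t i : V_mnm t i 1 = (t.-1 - i)%N.
Proof. by rewrite mnmDE !mulmnE !mnm1E /= mul0n mul1n. Qed.

Fact V_mnm_inj t (i j : nat) : (V_mnm t i == V_mnm t j) = (i == j).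
Proof.
apply/eqP/eqP=> [/(congr1 (fun m : 'X_{1..2} => m 0))|-> //].
by rewrite !V_mnm0.
Qed.

Fact ord2P (k : 'I_2) : k = 0 \/ k = 1.
Proof. by case: k => [[|[|k]] // lt]; [left|right]; apply: val_inj. Qed.

Fact V_homog_mnm t m : mdeg m = t.-1 -> V_mnm t (m 0) = m.
Proof.
move=> dm; apply/mnmP=> k; case: (ord2P k) => ->; rewrite ?V_mnm0 ?V_mnm1 // -dm.
rewrite mdegE big_ord_recl big_ord1 (_ : lift _ _ = 1) ?addKn //.
exact: val_inj.
Qed.

Fact V_homog_expand t (q : {mpoly F[2]}) : q \is t.-homog ->
  q = \sum_(i < t.+1) q@_(V_mnm t.+1 i) *: 'X_[V_mnm t.+1 i].
Proof.
move=> hq; apply/mpolyP=> m; rewrite raddf_sum /=.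
under eq_bigr => i _ do rewrite mcoeffZ mcoeffX.
have [dm|dm] := eqVneq (mdeg m) t; last first.
  rewrite (dhomog_nemf_coeff hq dm) big1 // => i _.
  have [e|_] := eqVneq; last by rewrite mulr0.
  by rewrite e (dhomog_nemf_coeff hq dm) mul0r.
have em := @V_homog_mnm t.+1 m dm.
have lt : (m 0%R < t.+1)%N.
  by rewrite ltnS -dm mdegE big_ord_recl leq_addr.
rewrite (bigD1 (Ordinal lt)) //= em eqxx mulr1 big1 ?addr0 // => i ne_i.
have [e|_] := eqVneq; last by rewrite mulr0.
by move: ne_i; rewrite -val_eqE /= -e V_mnm0 eqxx.
Qed.

Fact V_comp_homog t (i : 'I_t.+1) x :
  'X_[V_mnm t.+1 i] \mPo V_subst x \is t.-homog.
Proof.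
have h k : tnth (V_subst x) k \is 1.-homog.
  by rewrite tnth_mktuple rpredD // dhomogZ // dhomogX /= mdeg1.
rewrite comp_mpolyX big_ord_recl big_ord1 /= (_ : lift _ _ = 1); last exact: val_inj.
rewrite V_mnm0 V_mnm1 /=.
have := dhomogM (dhomogMn i (h 0)) (dhomogMn (t - i) (h 1)).
by rewrite !mul1n subnKC // -ltnS.
Qed.

Fact V_substM x y (q : {mpoly F[2]}) :
  (q \mPo V_subst x) \mPo V_subst y = q \mPo V_subst (x * y)%g.
Proof.
have E z : q \mPo V_subst z
    = \sum_(m <- msupp q) q@_m *: ('X_[m] \mPo V_subst z).
  rewrite {1}[q]mpolyE (raddf_sum (comp_mpoly (V_subst z))).
  by apply: eq_bigr => m _; rewrite /= comp_mpolyZ.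
rewrite !E (raddf_sum (comp_mpoly (V_subst y))); apply: eq_bigr => m _.
rewrite /= comp_mpolyZ !comp_mpolyX rmorph_prod /=; congr (_ *: _).
apply: eq_bigr => k _; rewrite rmorphXn /= !tnth_mktuple; congr (_ ^+ _).
rewrite comp_mpolyD !comp_mpolyZ !comp_mpolyXU -!tnth_nth /=.
rewrite !tnth_mktuple.
have M l : emb ((GLval x * GLval y) k l)
    = emb (GLval x k 0) * emb (GLval y 0 l)
      + emb (GLval x k 1) * emb (GLval y 1 l).
  rewrite -[GLval x * GLval y]/(GLval x *m GLval y) mxE big_ord_recl big_ord1.
  rewrite (_ : lift _ _ = 1); last exact: val_inj.
  by rewrite (Fp_embD charF) !(Fp_embM charF).
rewrite !M !scalerDr !scalerDl !scalerA.
by rewrite addrACA.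
Qed.

Lemma V_mxE t (i : 'I_t) x :
  'X_[V_mnm t i] \mPo V_subst x = \sum_(j < t) V_mx t x i j *: 'X_[V_mnm t j].
Proof.
case: t i => [[]//|t] i; rewrite {1}(V_homog_expand (V_comp_homog i x)).
by apply: eq_bigr => j _; rewrite mxE.
Qed.

Fact V_mx_repr t : mx_repr (SL2 p) (V_mx t).
Proof.
case: t => [|t]; first by split=> [|x y _ _]; apply/matrixP=> -[].
split=> [|x y _ _]; apply/matrixP=> i j; rewrite !mxE.
  have -> : V_subst 1%g = [tuple 'X_k | k < 2].
    apply: eq_from_tnth=> k; rewrite !tnth_mktuple GL_1E !mxE.
    by case: (ord2P k) => ->; rewrite /= Fp_emb0 Fp_emb1 scale0r scale1r ?addr0 ?add0r.
  by rewrite comp_mpoly_id mcoeffX V_mnm_inj.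
rewrite -V_substM V_mxE (raddf_sum (comp_mpoly (V_subst y))) raddf_sum /=.
by apply: eq_bigr=> k _; rewrite [V_mx _ y _ _]mxE comp_mpolyZ mcoeffZ.
Qed.

Definition V_mod (t : nat) : representation F (SL2 p) :=
  Representation (MxRepresentation (V_mx_repr t)).

End Modular.

Definition Gamma (p i j : nat) : rat :=
  if (i <= j)%N then (-1) ^+ (i + j)%N * (i%:R - 2 * i%:R * j%:R / p%:R)
  else (-1) ^+ (i + j)%N * (j%:R - 2 * i%:R * j%:R / p%:R).

(* For p odd, p./2 is (p-1)/2. *)
Definition n_proj (p : nat) (alpha : nat -> rat) (i : nat) : rat :=
  if odd i then
    if (i <= p./2)%N then
      \sum_(1 <= j < p./2.+1 | odd j) Gamma p i j * alpha j
      + \sum_(1 <= j < p./2.+1 | ~~ odd j) Gamma p i j * alpha (p - j)%N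
    else
      \sum_(1 <= j < p./2.+1 | odd j) Gamma p (p - i) j * alpha j
      + \sum_(1 <= j < p./2.+1 | ~~ odd j) Gamma p (p - i) j * alpha (p - j)%N
  else
    if (i <= p./2)%N then
      \sum_(1 <= j < p./2.+1 | odd j) Gamma p i j * alpha (p - j)%N
      + \sum_(1 <= j < p./2.+1 | ~~ odd j) Gamma p i j * alpha j
    else
      \sum_(1 <= j < p./2.+1 | odd j) Gamma p (p - i) j * alpha (p - j)%N
      + \sum_(1 <= j < p./2.+1 | ~~ odd j) Gamma p (p - i) j * alpha j.

(* Main.v *)
Require Import Defs.
From HB Require Import structures.
From mathcomp Require Import all_boot all_order all_algebra all_fingroup.
From mathcomp Require Import cyclic pgroup mxrepresentation character.
From mathcomp Require Import mpoly ring zify.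

(** Write G = SL_2(p), B for the Borel subgroup and U for its subgroup of order
    p.  The argument has two halves: M is split into the Green correspondents
    and a projective module Q, and the multiplicities of the P_i in Q are read
    off from the composition factors of Q.

    Splitting.  For modules W and X, the conjugates of a linear map f sum to
    the homomorphism [gtrace G f], and W is projective exactly when the identity
    of W is such a trace (Higman, [higman_proj] and [proj_higman]).  Two modules
    are stably isomorphic when there are homomorphisms both ways whose two
    composites are the identity plus a trace.  The given restriction of M, and
    the restriction of the sum X of the V_{a,b}, are both stably isomorphic to
    the sum of the U_{a,b} with b < p, because the U_{a,p} are projective
    ([uniserial_higman]).  Since two distinct conjugates of U meet trivially, the
    trace from B to G of a B-homomorphism f restricts to f plus a trace from the
    trivial group ([rtr_borelE]), so relative traces turn a stable isomorphism
    over B into one over G ([stab_borel]): this is the Green correspondence in the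
    form of an equivalence of stable categories.  To pass from stable isomorphism
    to isomorphism, note that an indecomposable nonprojective module has no
    invertible trace among its endomorphisms, so the identity plus a trace is
    invertible on X (Fitting's lemma, [tr_unit_indec], and Gaussian elimination,
    [tr_unit_dadd]), whence X is a direct summand of M with a projective
    complement Q ([stab_split]).

    Counting.  All multiplicities are dimensions of spaces of homomorphisms: V_t
    occurs dim Hom(P_t, W) times in a composition series of W
    ([comp_mult_hdim]), and P_i occurs dim Hom(Q, V_i) times in Q.  Both are
    additive on direct sums, so alpha_t = dim Hom(P_t, Q), and what is needed is
    the Cartan matrix, in the form
    [dim Hom(P_t, Q) = 2 m_t + m_(p-1-t) + m_(p+1-t)] with
    [m_i = dim Hom(Q, V_i)], without the last term if t = 1 ([cartan]).  It comes
    from tensoring with the natural module V_2, which is self-dual and keeps projectivity.  The exact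
    sequences V_(t-1) -> V_t (x) V_2 -> V_(t+1) and V_2 -> V_(p+1) -> V_(p-1)
    express the two families of dimensions of Q (x) V_2 through those of Q, and
    V_p is projective, which gives the start dim Hom(P_p, Q) = m_p of a downward
    recursion on t that holds for all projective Q at once.

    That a projective Q is a sum of the P_i needs a nonzero Q to have some V_t
    as a quotient ([killed0]).  If it had none, neither would Q (x) V_2 and its
    iterates, so none of these would have the trivial module as a quotient; then
    the sum over g in G of f(g) Q(g) vanishes for every polynomial f in the
    entries of g, in particular for the indicator function of 1.

    Finally each of the two linkage classes of nonprojective V_t, those of V_1
    and of V_(p-1), is a path with (p-1)/2 vertices on which the Cartan matrix
    acts as a second difference up to signs, and Gamma is the corresponding
    Green function ([Gamma_solve], [n_proj_solve]). *)

Set Implicit Arguments.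
Unset Strict Implicit.
Unset Printing Implicit Defensive.

Import GroupScope GRing.Theory.
Local Open Scope ring_scope.

(** * Homomorphisms, direct sums and traces *)

Section HomAlgebra.

Variables (F : fieldType) (gT : finGroupType) (G : {group gT}).
Implicit Types (W X Y Z P Q : representation F G).

Lemma hom_id W : @is_hom F gT G W W 1%:M.
Proof. by move=> x _; rewrite mulmx1 mul1mx. Qed.

Lemma hom0 W X : @is_hom F gT G W X 0.
Proof. by move=> x _; rewrite mulmx0 mul0mx. Qed.

Lemma homM W X Y (f : 'M_(rdegree W, rdegree X)) (g : 'M_(_, rdegree Y)) :
  is_hom f -> is_hom g -> is_hom (f *m g).
Proof. by move=> hf hg x Gx; rewrite mulmxA hf // -!mulmxA hg. Qed.

Lemma homD W X (f g : 'M_(rdegree W, rdegree X)) :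
  is_hom f -> is_hom g -> is_hom (f + g).
Proof. by move=> hf hg x Gx; rewrite mulmxDr mulmxDl hf ?hg. Qed.

Lemma homZ W X a (f : 'M_(rdegree W, rdegree X)) :
  is_hom f -> is_hom (a *: f).
Proof. by move=> hf x Gx; rewrite -scalemxAr -scalemxAl hf. Qed.

Lemma homN W X (f : 'M_(rdegree W, rdegree X)) : is_hom f -> is_hom (- f).
Proof. by move=> hf; rewrite -scaleN1r; apply: homZ. Qed.

Lemma homB W X (f g : 'M_(rdegree W, rdegree X)) :
  is_hom f -> is_hom g -> is_hom (f - g).
Proof. by move=> hf hg; apply: homD => //; apply: homN. Qed.

Lemma hom_inv W (f : 'M_(rdegree W)) :
  @is_hom F gT G W W f -> f \in unitmx -> @is_hom F gT G W W (invmx f).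
Proof.
move=> hf uf x Gx; apply: (canRL (mulKmx uf)).
by rewrite mulmxA -hf // mulmxK.
Qed.

Lemma hom_row_mx W X Y (f : 'M_(rdegree W, rdegree X)) (g : 'M_(_, rdegree Y)) :
  is_hom f -> is_hom g -> @is_hom F gT G W (dadd_grepr X Y) (row_mx f g).
Proof.
move=> hf hg x Gx /=.
by rewrite mul_mx_row mul_row_block !mulmx0 addr0 add0r hf ?hg.
Qed.

Lemma hom_col_mx W X Y (f : 'M_(rdegree X, rdegree W)) (g : 'M_(rdegree Y, _)) :
  is_hom f -> is_hom g -> @is_hom F gT G (dadd_grepr X Y) W (col_mx f g).
Proof.
move=> hf hg x Gx /=.
by rewrite mul_block_col mul_col_mx !mul0mx addr0 add0r hf ?hg.
Qed.

(** The set [A] is a parameter, and need not be the whole group, so that traces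
    over a subgroup can be taken without restricting the modules. *)
Definition gtrace (A : {set gT}) W X (f : 'M_(rdegree W, rdegree X)) :=
  \sum_(x in A) W x^-1%g *m f *m X x.

Lemma tr_hom W X f : is_hom (@gtrace G W X f).
Proof.
move=> y Gy; rewrite mulmx_sumr mulmx_suml (reindex_inj (mulIg y)) /=.
rewrite (eq_bigl (mem G)) => [|x]; last by rewrite /= groupMr.
apply: eq_bigr => x Gx.
by rewrite invMg !repr_mxM ?groupV // !mulmxA -repr_mxM ?groupV // mulgV repr_mx1 mul1mx.
Qed.

(** Traces form an ideal of the category of modules. *)
Lemma hom_trl (A : {set gT}) W X Y (f : 'M_(rdegree W, rdegree X))
    (g : 'M_(_, rdegree Y)) : A \subset G -> is_hom f ->
  f *m gtrace A g = gtrace A (f *m g).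
Proof.
move=> /subsetP sAG hf; rewrite mulmx_sumr; apply: eq_bigr => x /sAG Gx.
by rewrite !mulmxA hf ?groupV.
Qed.

Lemma hom_trr (A : {set gT}) W X Y (f : 'M_(rdegree W, rdegree X))
    (g : 'M_(_, rdegree Y)) : A \subset G -> is_hom g ->
  gtrace A f *m g = gtrace A (f *m g).
Proof.
move=> /subsetP sAG hg; rewrite mulmx_suml; apply: eq_bigr => x /sAG Gx.
by rewrite -!mulmxA hg.
Qed.

Lemma trD (A : {set gT}) W X (f g : 'M_(rdegree W, rdegree X)) :
  gtrace A (f + g) = gtrace A f + gtrace A g.
Proof. by rewrite -big_split; apply: eq_bigr => x _; rewrite mulmxDr mulmxDl. Qed.

Lemma trZ (A : {set gT}) W X a (f : 'M_(rdegree W, rdegree X)) :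
  gtrace A (a *: f) = a *: gtrace A f.
Proof.
by rewrite scaler_sumr; apply: eq_bigr => x _; rewrite -scalemxAr -scalemxAl.
Qed.

Lemma trN (A : {set gT}) W X (f : 'M_(rdegree W, rdegree X)) :
  gtrace A (- f) = - gtrace A f.
Proof. by rewrite -scaleN1r trZ scaleN1r. Qed.

Lemma tr0 (A : {set gT}) W X : gtrace A (0 : 'M_(rdegree W, rdegree X)) = 0.
Proof. by rewrite /gtrace big1 // => x _; rewrite mulmx0 mul0mx. Qed.

Lemma rsimP W X : mx_rsim W X <->
  exists (f : 'M_(rdegree W, rdegree X)) (g : 'M_(rdegree X, rdegree W)),
    [/\ is_hom f, is_hom g, f *m g = 1%:M & g *m f = 1%:M].
Proof.
case: W X => [n W] [m X]; split=> [[B /= e]|[f [g [/= hf hg fg gf]]]].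
  case: m / e in X B *; rewrite row_free_unit => uB hB.
  exists B, (invmx B); split; rewrite ?mulVmx ?mulmxV //.
  move=> x Gx /=; apply: (canRL (mulKmx uB)).
  by rewrite mulmxA -hB // mulmxK.
have nm : n = m.
  apply/eqP; rewrite eqn_leq; apply/andP; split.
    by have := mulmx1_min fg.
  by have := mulmx1_min gf.
by exists f => //=; apply/row_freeP; exists g.
Qed.

(** Equality of degrees makes a one-sided inverse enough. *)
Lemma rsim_of_section W X (f : 'M_(rdegree W, rdegree X))
    (g : 'M_(rdegree X, rdegree W)) :
  rdegree W = rdegree X -> is_hom f -> g *m f = 1%:M -> mx_rsim W X.
Proof.
move=> e hf gf; exists f => //; rewrite /row_free eqn_leq rank_leq_row.
by apply: (@leq_trans (rdegree X)); rewrite ?e // -{1}(mxrank1 F (rdegree X)) -gf mxrankM_maxr.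
Qed.

Lemma rsim_dadd W W' X X' : mx_rsim W W' -> mx_rsim X X' ->
  mx_rsim (dadd_grepr W X) (dadd_grepr W' X').
Proof.
move=> /rsimP[f [g [hf hg fg gf]]] /rsimP[f' [g' [hf' hg' fg' gf']]].
apply/rsimP; exists (block_mx f 0 0 f'), (block_mx g 0 0 g'); split.
- by apply: hom_col_mx; apply: hom_row_mx => //; apply: hom0.
- by apply: hom_col_mx; apply: hom_row_mx => //; apply: hom0.
- by rewrite mulmx_block !mul0mx !mulmx0 !addr0 add0r fg fg' -scalar_mx_block.
- by rewrite mulmx_block !mul0mx !mulmx0 !addr0 add0r gf gf' -scalar_mx_block.
Qed.

Lemma rsim_daddC W X : mx_rsim (dadd_grepr W X) (dadd_grepr X W).
Proof.
apply/rsimP; exists (block_mx 0 1%:M 1%:M 0), (block_mx 0 1%:M 1%:M 0); split.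
- by apply: hom_col_mx; apply: hom_row_mx; (apply: hom0 || apply: hom_id).
- by apply: hom_col_mx; apply: hom_row_mx; (apply: hom0 || apply: hom_id).
- by rewrite mulmx_block !mul0mx !mulmx0 !mulmx1 !addr0 !add0r -scalar_mx_block.
- by rewrite mulmx_block !mul0mx !mulmx0 !mulmx1 !addr0 !add0r -scalar_mx_block.
Qed.

Lemma rsim_daddA W X Y :
  mx_rsim (dadd_grepr W (dadd_grepr X Y)) (dadd_grepr (dadd_grepr W X) Y).
Proof.
pose i1 : 'M[F]_(rdegree W, (rdegree W + rdegree X) + rdegree Y) :=
  row_mx (row_mx 1%:M 0) 0.
pose i2 : 'M[F]_(rdegree X, (rdegree W + rdegree X) + rdegree Y) :=
  row_mx (row_mx 0 1%:M) 0.
pose i3 : 'M[F]_(rdegree Y, (rdegree W + rdegree X) + rdegree Y) :=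
  row_mx 0 1%:M.
pose p1 : 'M[F]_((rdegree W + rdegree X) + rdegree Y, rdegree W) :=
  col_mx (col_mx 1%:M 0) 0.
pose p2 : 'M[F]_((rdegree W + rdegree X) + rdegree Y, rdegree X) :=
  col_mx (col_mx 0 1%:M) 0.
pose p3 : 'M[F]_((rdegree W + rdegree X) + rdegree Y, rdegree Y) :=
  col_mx 0 1%:M.
apply: (@rsim_of_section (dadd_grepr W (dadd_grepr X Y))
  (dadd_grepr (dadd_grepr W X) Y) (col_mx i1 (col_mx i2 i3))
  (row_mx p1 (row_mx p2 p3))) => [|| /=].
- by rewrite /= addnA.
- apply: hom_col_mx; last apply: hom_col_mx; do ?[apply: hom_row_mx];
    by [apply: hom0 | apply: hom_id].
rewrite !mul_row_col !mul_mx_row !mul_col_mx.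
rewrite ?mul1mx ?mul0mx ?mulmx0 !col_mx0.
rewrite !add_row_mx ?addr0 ?add0r.
rewrite !scalar_mx_block !block_mxEh.
congr row_mx; rewrite add_row_mx addr0 add0r.
by rewrite -[X in _ = col_mx _ X]row_mx0 -block_mxEv block_mxEh.
Qed.

Lemma rsim_dadd0 W : mx_rsim (dadd_grepr grepr0 W) W.
Proof.
apply: (@rsim_of_section (dadd_grepr grepr0 W) W (col_mx 0 1%:M)
  (row_mx 0 1%:M)) => //.
- by apply: hom_col_mx; [apply: hom0 | apply: hom_id].
- by rewrite mul_row_col mul0mx add0r mul1mx.
Qed.

End HomAlgebra.

(** * Higman's criterion for projectivity *)

Section Higman.

Variables (F : fieldType) (gT : finGroupType) (G : {group gT}).
Implicit Types (W X Y Z P Q : representation F G).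

(** The identity is a trace from the trivial group.  This form of projectivity
    is self-dual and passes to tensor products and overgroups by computation. *)
Definition higman W := exists phi : 'M_(rdegree W), @gtrace F gT G G W W phi = 1%:M.

(** Average a linear lift of [h], precomposed with [phi]. *)
Lemma higman_proj W : higman W -> projective W.
Proof.
case=> phi trphi X Y e h he /row_fullP[e' e'e] hh.
exists (gtrace G (phi *m h *m e')); split; first exact: tr_hom.
by rewrite hom_trr // -[_ *m e]mulmxA e'e mulmx1 -hom_trr // trphi mul1mx.
Qed.

(** The dual of [higman_proj]: a Higman module is also injective. *)
Lemma higman_inj W X (f : 'M_(rdegree W, rdegree X)) :
  higman W -> is_hom f -> row_free f ->
  exists r : 'M_(rdegree X, rdegree W), is_hom r /\ f *m r = 1%:M.
Proof.
case=> phi trphi hf /row_freeP[f' ff']; exists (gtrace G (f' *m phi)).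
by split; [exact: tr_hom | rewrite hom_trl // mulmxA ff' mul1mx].
Qed.

Lemma higman_retract W X (i : 'M_(rdegree W, rdegree X))
    (r : 'M_(rdegree X, rdegree W)) :
  is_hom i -> is_hom r -> i *m r = 1%:M -> higman X -> higman W.
Proof.
move=> hi hr ir [phi trphi]; exists (i *m phi *m r).
by rewrite -hom_trr // -hom_trl // trphi mulmx1.
Qed.

Lemma higman_rsim W X : mx_rsim W X -> higman X -> higman W.
Proof. by move=> /rsimP[f [g [hf hg fg _]]]; apply: higman_retract hf hg fg. Qed.

Lemma higman0 : higman grepr0.
Proof. by exists 0; rewrite /gtrace; apply/matrixP=> -[]. Qed.

Lemma higman_dadd W X : higman W -> higman X -> higman (dadd_grepr W X).
Proof.
move=> [a ta] [b tb].
have hp1 := hom_col_mx (hom_id W) (hom0 X W).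
have hp2 := hom_col_mx (hom0 W X) (hom_id X).
have hi1 := hom_row_mx (hom_id W) (hom0 W X).
have hi2 := hom_row_mx (hom0 X W) (hom_id X).
exists (col_mx 1%:M 0 *m a *m row_mx 1%:M 0 + col_mx 0 1%:M *m b *m row_mx 0 1%:M).
rewrite trD -(hom_trr _ (subxx G) hi1) -(hom_trr _ (subxx G) hi2).
rewrite -(hom_trl _ (subxx G) hp1) -(hom_trl _ (subxx G) hp2) ta tb.
rewrite !mulmx1 !mul_col_row !mul0mx !mulmx0 !mulmx1.
by rewrite add_block_mx !addr0 !add0r -scalar_mx_block.
Qed.

(** Take for [phi] the projection onto the line of the basis vector 1: its
    conjugates are the projections onto the lines of all basis vectors. *)
Lemma higman_regular : higman (Representation (regular_repr F G)).
Proof.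
set gi := gring_index G.
exists ((delta_mx (gi 1%g) 0 : 'cV_#|G|) *m (delta_mx 0 (gi 1%g) : 'rV_#|G|)).
rewrite /gtrace /=; transitivity (\sum_(x in G) delta_mx (gi x) (gi x) : 'M[F]_#|G|).
  apply: eq_bigr => x Gx; rewrite !mulmxA -mulmxA.
  rewrite -[delta_mx 0 _ *m _]rowE rowK gring_indexK // mul1g.
  rewrite -colE (_ : col _ _ = delta_mx (gi x) 0) ?mul_delta_mx //.
  apply/colP=> i; rewrite !mxE eqxx andbT eq_sym; congr (nat_of_bool _)%:R.
  apply/eqP/eqP=> [/(congr1 (fun i => enum_val i * x)%g)|->].
    rewrite !gring_indexK ?groupM ?groupV ?enum_valP // mulgKV mul1g => <-.
    by rewrite /gi gring_valK.
  by rewrite gring_indexK // mulgV.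
rewrite (reindex_onto (@enum_val _ (mem G)) gi) /=; last first.
  by move=> x Gx; rewrite gring_indexK.
rewrite (eq_bigl xpredT) => [|i]; last by rewrite enum_valP /gi gring_valK eqxx.
apply/matrixP=> i j; rewrite summxE mxE (bigD1 i) //= big1 => [|k ki].
  by rewrite mxE /gi gring_valK eqxx addr0 eq_sym.
by rewrite mxE /gi gring_valK eq_sym (negPf ki).
Qed.

(** The regular module is free on the basis vector 1. *)
Lemma regular_hom_onto W (v : 'rV_(rdegree W)) :
  exists e : 'M_(#|G|, rdegree W),
    @is_hom F gT G (Representation (regular_repr F G)) W e /\ (v <= e)%MS.
Proof.
exists (\matrix_i (v *m W (enum_val i))); split; last first.
  have := row_sub (gring_index G 1%g) (\matrix_i (v *m W (enum_val i))).
  by rewrite rowK gring_indexK // repr_mx1 mulmx1.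
move=> x Gx; apply/row_matrixP=> i /=; rewrite !row_mul !rowK -rowE rowK.
by rewrite gring_indexK ?groupM ?enum_valP // repr_mxM ?enum_valP // mulmxA.
Qed.

Lemma higman_cover W k (A : 'M_(k, rdegree W)) :
  exists2 X, higman X & exists2 e : 'M_(rdegree X, rdegree W),
    is_hom e & (A <= e)%MS.
Proof.
elim: k A => [|k IHk] A.
  exists grepr0; first exact: higman0.
  by exists 0; [apply: hom0 | rewrite flatmx0 sub0mx].
rewrite -(@vsubmxK _ 1 k _ A); set v := usubmx _; set A' := dsubmx _.
have [X pX [e he sAe]] := IHk A'; have [e1 [he1 sve]] := regular_hom_onto v.
exists (dadd_grepr (Representation (regular_repr F G)) X).
  by apply: higman_dadd pX; apply: higman_regular.
exists (col_mx e1 e); first exact: hom_col_mx.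
change (is_true (@submx F (1 + k) _ _ (col_mx v A') (col_mx e1 e))).
by rewrite col_mx_sub -!addsmxE (submx_trans sve) ?addsmxSl ?(submx_trans sAe) ?addsmxSr.
Qed.

(** A projective module is a direct summand of a finite sum of regular modules,
    and the criterion passes to summands. *)
Lemma proj_higman W : projective W -> higman W.
Proof.
move=> projW; have [X hX [e he]] := higman_cover (1%:M : 'M_(rdegree W)).
rewrite sub1mx => full_e.
have [k [hk ke]] := projW _ _ _ _ he full_e (hom_id W).
exact: higman_retract hk he ke hX.
Qed.

Definition rtrace (H : {set gT}) W X (f : 'M_(rdegree W, rdegree X)) :=
  \sum_(C in rcosets H G) W (repr C)^-1%g *m f *m X (repr C).

Section Relative.

Variable (H : {group gT}).
Hypothesis sHG : H \subset G.

Definition hom_on W X (f : 'M_(rdegree W, rdegree X)) :=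
  forall x, x \in H -> W x *m f = f *m X x.

Lemma conj_coset W X (f : 'M_(rdegree W, rdegree X)) x y : hom_on f ->
  x \in G -> y \in (H :* x)%g ->
  W y^-1%g *m f *m X y = W x^-1%g *m f *m X x.
Proof.
move=> hf Gx /rcosetP[h Hh ->]; have Gh := subsetP sHG h Hh.
rewrite invMg !repr_mxM ?groupV // -!mulmxA [f *m (_ *m _)]mulmxA -hf // !mulmxA.
by rewrite -[_ *m W h]mulmxA -repr_mxM ?groupV // mulVg repr_mx1 mulmx1.
Qed.

Lemma repr_rcosets C : C \in rcosets H G -> repr C \in G /\ C = (H :* repr C)%g.
Proof.
case/rcosetsP=> x Gx ->; have Hr := mem_repr_rcoset H x.
split; last by rewrite rcoset_repr.
by case/rcosetP: Hr => h Hh ->; rewrite groupM // (subsetP sHG).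
Qed.

Lemma rtr_coset W X (f : 'M_(rdegree W, rdegree X)) x : hom_on f -> x \in G ->
  W (repr (H :* x))^-1%g *m f *m X (repr (H :* x)%g) = W x^-1%g *m f *m X x.
Proof. by move=> hf Gx; apply: conj_coset => //; apply: mem_repr_rcoset. Qed.

(** The summands depend only on the cosets, and right translation permutes them. *)
Lemma rtr_hom W X (f : 'M_(rdegree W, rdegree X)) :
  hom_on f -> is_hom (rtrace H f).
Proof.
move=> hf y Gy; rewrite mulmx_sumr mulmx_suml.
rewrite (reindex_inj (can_inj (rcosetK y))) /=.
apply: eq_big => [C|C].
  apply/rcosetsP/rcosetsP=> -[x Gx e].
    exists (x * y^-1)%g; first by rewrite groupM ?groupV.
    by rewrite rcosetM -e rcosetK.
  by exists (x * y)%g; rewrite ?groupM // rcosetM -e.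
move=> CG; case/rcosetsP: (CG) => x Gx ex.
have Gx' : (x * y^-1)%g \in G by rewrite groupM ?groupV.
have -> : C = (H :* (x * y^-1))%g by rewrite rcosetM -ex rcosetK.
rewrite -rcosetM mulgKV !rtr_coset // invMg invgK.
by rewrite -!mulmxA -repr_mxM // mulgKV !mulmxA -repr_mxM ?groupV.
Qed.

Lemma rtr_trr W X Y (f : 'M_(rdegree W, rdegree X)) (g : 'M_(_, rdegree Y)) :
  is_hom g -> rtrace H f *m g = rtrace H (f *m g).
Proof.
move=> hg; rewrite mulmx_suml; apply: eq_bigr => C /repr_rcosets[Gr _].
by rewrite -!mulmxA hg.
Qed.

(** Transitivity of the trace: G is the union of the right cosets of H. *)
Lemma rtr_tr W X (f : 'M_(rdegree W, rdegree X)) : rtrace H (gtrace H f) = gtrace G f.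
Proof.
rewrite [RHS](set_partition_big _ (rcosets_partition sHG)) /=.
apply: eq_bigr => C CG; have [Gr eC] := repr_rcosets CG.
rewrite [in RHS]eC mulmx_sumr mulmx_suml.
rewrite [RHS](reindex_inj (mulIg (repr C))) /=; apply: eq_big => x.
  by rewrite mem_rcoset mulgK.
move=> Hx; have Gx := subsetP sHG x Hx.
by rewrite invMg !repr_mxM ?groupV // !mulmxA.
Qed.

Lemma rtrD W X (f g : 'M_(rdegree W, rdegree X)) :
  rtrace H (f + g) = rtrace H f + rtrace H g.
Proof. by rewrite -big_split; apply: eq_bigr => x _; rewrite mulmxDr mulmxDl. Qed.

Lemma rtr_const W X (f : 'M_(rdegree W, rdegree X)) : is_hom f ->
  rtrace H f = #|G : H|%:R *: f.
Proof.
move=> hf; rewrite scaler_nat -sumr_const; apply: eq_bigr => C /repr_rcosets[Gr _].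
by rewrite hf ?groupV // -mulmxA -repr_mxM ?groupV // mulVg repr_mx1 mulmx1.
Qed.

(** Modules that are projective on restriction to a subgroup of index prime to
    the characteristic are projective. *)
Lemma higman_index W (phi : 'M_(rdegree W)) : #|G : H|%:R != 0 :> F ->
  gtrace H phi = 1%:M -> higman W.
Proof.
move=> nz trphi; exists (#|G : H|%:R^-1 *: phi).
by rewrite trZ -rtr_tr trphi rtr_const ?scalerA ?mulVf ?scale1r //; apply: hom_id.
Qed.

End Relative.

End Higman.

(** * Stable isomorphism and removal of projective summands *)

Section Stable.

Variables (F : fieldType) (gT : finGroupType) (G : {group gT}).
Implicit Types (W X Y Z P Q V M : representation F G).

(** Isomorphism in the stable module category, where the maps that factor
    through projective modules, that is the traces, are set to 0. *)
Definition stable_iso W X :=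
  exists (f : 'M_(rdegree W, rdegree X)) (g : 'M_(rdegree X, rdegree W)) a b,
    [/\ is_hom f, is_hom g, f *m g = 1%:M + @gtrace F gT G G W W a
      & g *m f = 1%:M + @gtrace F gT G G X X b].

Lemma rsim_stab W X : mx_rsim W X -> stable_iso W X.
Proof.
move=> /rsimP[f [g [hf hg fg gf]]]; exists f, g, 0, 0.
by split; rewrite // tr0 addr0.
Qed.

Lemma stab_sym W X : stable_iso W X -> stable_iso X W.
Proof. by case=> f [g [a [b [hf hg fg gf]]]]; exists g, f, b, a. Qed.

Lemma stab_trans W X Y : stable_iso W X -> stable_iso X Y -> stable_iso W Y.
Proof.
move=> [f1 [g1 [a1 [b1 [hf1 hg1 fg1 gf1]]]]] [f2 [g2 [a2 [b2 [hf2 hg2 fg2 gf2]]]]].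
exists (f1 *m f2), (g2 *m g1), (a1 + f1 *m a2 *m g1), (b2 + g2 *m b1 *m f2).
split; try exact: homM.
  rewrite mulmxA -[f1 *m f2 *m _]mulmxA fg2 mulmxDr mulmx1 mulmxDl fg1 trD addrA.
  by congr (_ + _); rewrite hom_trl // hom_trr.
rewrite mulmxA -[g2 *m g1 *m _]mulmxA gf1 mulmxDr mulmx1 mulmxDl gf2 trD addrA.
by congr (_ + _); rewrite hom_trl // hom_trr.
Qed.

Lemma tr_block W X a b :
  @gtrace F gT G G (dadd_grepr W X) (dadd_grepr W X) (block_mx a 0 0 b)
    = block_mx (gtrace G a) 0 0 (gtrace G b).
Proof.
rewrite /gtrace /= [LHS](eq_bigr (fun x => block_mx (W x^-1%g *m a *m W x) 0 0
  (X x^-1%g *m b *m X x))) => [|x _].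
  by elim/big_rec3: _ => [|x A B C _ ->];
    rewrite ?block_mx0 // add_block_mx !addr0.
by rewrite !mulmx_block !(mulmx0, mul0mx, addr0, add0r).
Qed.

Lemma stab_dadd W W' X X' : stable_iso W W' -> stable_iso X X' ->
  stable_iso (dadd_grepr W X) (dadd_grepr W' X').
Proof.
move=> [f1 [g1 [a1 [b1 [hf1 hg1 fg1 gf1]]]]] [f2 [g2 [a2 [b2 [hf2 hg2 fg2 gf2]]]]].
exists (block_mx f1 0 0 f2), (block_mx g1 0 0 g2).
exists (block_mx a1 0 0 a2), (block_mx b1 0 0 b2); split.
- by apply: hom_col_mx; apply: hom_row_mx => //; apply: hom0.
- by apply: hom_col_mx; apply: hom_row_mx => //; apply: hom0.
- rewrite tr_block mulmx_block !(mulmx0, mul0mx, addr0, add0r).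
  by rewrite scalar_mx_block add_block_mx !addr0 fg1 fg2.
- rewrite tr_block mulmx_block !(mulmx0, mul0mx, addr0, add0r).
  by rewrite scalar_mx_block add_block_mx !addr0 gf1 gf2.
Qed.

Lemma higman_stab0 Q : higman Q -> stable_iso Q grepr0.
Proof.
case=> phi trphi; exists 0, 0, (- phi), 0; split; try exact: hom0.
  by rewrite mul0mx trN trphi subrr.
by apply/matrixP=> -[].
Qed.

Lemma stab_big (I : eqType) (r : seq I) (A B : I -> representation F G) :
  (forall i, i \in r -> stable_iso (A i) (B i)) ->
  stable_iso (\big[dadd_grepr/grepr0]_(i <- r) A i)
       (\big[dadd_grepr/grepr0]_(i <- r) B i).
Proof.
move=> stAB; rewrite big_seq [X in stable_iso _ X]big_seq.
apply: (big_ind2 stable_iso) stAB => [|W W' X X' sW sX].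
  exact/rsim_stab/mx_rsim_refl.
exact: stab_dadd.
Qed.

Lemma rsim_big_cat (I : Type) (r s : seq I) (A : I -> representation F G) :
  mx_rsim (\big[dadd_grepr/grepr0]_(i <- r ++ s) A i)
    (dadd_grepr (\big[dadd_grepr/grepr0]_(i <- r) A i)
                (\big[dadd_grepr/grepr0]_(i <- s) A i)).
Proof.
elim: r => [|i r IHr] /=; first by rewrite big_nil; apply/mx_rsim_sym/rsim_dadd0.
rewrite !big_cons; apply: mx_rsim_trans (rsim_daddA _ _ _).
exact: rsim_dadd (mx_rsim_refl _) IHr.
Qed.

Lemma higman_big (I : Type) (r : seq I) (A : I -> representation F G) :
  (forall i, higman (A i)) -> higman (\big[dadd_grepr/grepr0]_(i <- r) A i).
Proof.
move=> hA; elim/big_ind: _ => // [|W X]; first exact: higman0.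
exact: higman_dadd.
Qed.

(** The complement is the kernel of the retraction, with projection [1 - r i]. *)
Lemma retract_split W X (i : 'M_(rdegree X, rdegree W))
    (r : 'M_(rdegree W, rdegree X)) :
  is_hom i -> is_hom r -> i *m r = 1%:M ->
  exists Q (j : 'M_(rdegree Q, rdegree W)) (pi : 'M_(rdegree W, rdegree Q)),
    [/\ is_hom j, is_hom pi, j *m pi = 1%:M, j *m r = 0
      & mx_rsim W (dadd_grepr X Q)].
Proof.
move=> hi hr ir; set K := kermx r.
have modK : mxmodule W K.
  apply/mxmoduleP=> x Gx; apply/sub_kermxP.
  by rewrite -mulmxA hr // mulmxA mulmx_ker mul0mx.
pose e := 1%:M - r *m i.
have he : @is_hom F gT G W W e by apply: homB; [apply: hom_id | apply: homM].
have sek : (e <= K)%MS.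
  by apply/sub_kermxP; rewrite mulmxBl mul1mx -mulmxA ir mulmx1 subrr.
pose Q := Representation (submod_repr modK).
pose j : 'M_(rdegree Q, rdegree W) := val_submod 1%:M.
pose pi : 'M_(rdegree W, rdegree Q) := in_submod K e.
have jr : j *m r = 0.
  by apply/sub_kermxP; rewrite /j val_submod1.
have hj : is_hom j.
  by move=> x Gx; rewrite -val_submodE -val_submodJ // mul1mx.
have pij : pi *m j = e by rewrite -val_submodE in_submodK.
have hpi : is_hom pi.
  by move=> x Gx; rewrite /pi /= -in_submodJ // -he // in_submodE mulmxA -in_submodE.
have je : j *m e = j by rewrite mulmxBr mulmx1 mulmxA jr mul0mx subr0.
have ie : i *m e = 0 by rewrite mulmxBr mulmx1 mulmxA ir mul1mx subrr.
have jpi : j *m pi = 1%:M.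
  by rewrite /pi in_submodE mulmxA je -in_submodE val_submodK.
have ipi : i *m pi = 0 by rewrite /pi in_submodE mulmxA ie mul0mx.
exists Q, j, pi; split=> //; apply/rsimP.
exists (row_mx r pi), (col_mx i j); split.
- exact: hom_row_mx.
- exact: hom_col_mx.
- by rewrite mul_row_col pij addrC subrK.
- by rewrite mul_col_row ir ipi jr jpi -scalar_mx_block.
Qed.

(** This says that the traces lie in the Jacobson radical of the endomorphism
    ring, equivalently that the module has no nonzero projective summand. *)
Definition tr_unit X :=
  forall phi : 'M_(rdegree X), 1%:M + @gtrace F gT G G X X phi \in unitmx.

Lemma tr_unit0 : tr_unit grepr0.
Proof. by move=> phi; rewrite /gtrace unitmxE det_mx00 unitr1. Qed.

Lemma row_unitP n (A : 'M[F]_n) :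
  (forall v : 'rV_n, v *m A = 0 -> v = 0) -> A \in unitmx.
Proof. by move=> injA; rewrite -row_free_unit; apply/inj_row_free. Qed.

(** Gaussian elimination for two by two blocks: the upper left block is
    invertible by the hypothesis on [X], and the Schur complement is again the
    identity plus a trace because traces form an ideal. *)
Lemma tr_unit_dadd X Y : tr_unit X -> tr_unit Y -> tr_unit (dadd_grepr X Y).
Proof.
move=> uX uY phi.
have hp1 := hom_col_mx (hom_id X) (hom0 Y X).
have hp2 := hom_col_mx (hom0 X Y) (hom_id Y).
have hi1 := hom_row_mx (hom_id X) (hom0 X Y).
have hi2 := hom_row_mx (hom0 Y X) (hom_id Y).
set i1 := row_mx _ _ in hi1; set i2 := row_mx _ _ in hi2.
set p1 := col_mx _ _ in hp1; set p2 := col_mx _ _ in hp2.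
pose t := gtrace G phi.
have blk W1 W2 (a : 'M_(rdegree W1, rdegree (dadd_grepr X Y)))
    (b : 'M_(rdegree (dadd_grepr X Y), rdegree W2)) :
  is_hom a -> is_hom b -> a *m t *m b = gtrace G (a *m phi *m b).
  move=> ha hb.
  by rewrite hom_trl // hom_trr.
have p1i1 : p1 *m i1 + p2 *m i2 = 1%:M.
  by rewrite !mul_col_row !(mul0mx, mulmx0, mulmx1) add_block_mx !addr0 !add0r -scalar_mx_block.
set A := 1%:M + i1 *m t *m p1.
have uA : A \in unitmx by rewrite /A blk.
have hA : @is_hom F gT G X X A.
  by rewrite /A blk //; apply: homD; [apply: hom_id | apply: tr_hom].
(* The Schur complement of A. *)
set B := 1%:M + i2 *m t *m p2 - i2 *m t *m p1 *m invmx A *m (i1 *m t *m p2).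
have uB : B \in unitmx.
  rewrite /B -addrA (blk _ _ i2 p1) // (blk _ _ i1 p2) // (blk _ _ i2 p2) //.
  rewrite hom_trr; [|by []|exact: hom_inv].
  by rewrite hom_trr // -?trN -?trD; [apply: uY | apply: tr_hom].
apply: row_unitP => v.
have ev : v = v *m p1 *m i1 + v *m p2 *m i2.
  by rewrite -!mulmxA -mulmxDr p1i1 mulmx1.
set x := v *m p1 in ev; set y := v *m p2 in ev.
have i1p1 : i1 *m p1 = 1%:M by rewrite mul_row_col mul1mx mul0mx addr0.
have i2p2 : i2 *m p2 = 1%:M by rewrite mul_row_col mul1mx mul0mx add0r.
have i1p2 : i1 *m p2 = 0 by rewrite mul_row_col mul1mx mul0mx addr0.
have i2p1 : i2 *m p1 = 0 by rewrite mul_row_col mul1mx mul0mx add0r.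
rewrite mulmxDr mulmx1 -/t => vt.
have e1 : x *m A + y *m (i2 *m t *m p1) = 0.
  rewrite /A mulmxDr mulmx1 -addrA !mulmxA -!mulmxDl -ev.
  by rewrite vt mul0mx.
have e2 : x *m (i1 *m t *m p2) + y *m (1%:M + i2 *m t *m p2) = 0.
  rewrite mulmxDr mulmx1 addrCA !mulmxA -!mulmxDl -ev.
  by rewrite vt mul0mx.
have ex : x = - (y *m (i2 *m t *m p1) *m invmx A).
  by rewrite -mulNmx -(addr0_eq e1) opprK mulmxK.
have y0 : y = 0.
  apply: (can_inj (mulmxK uB)); rewrite mul0mx /B mulmxBr addrC -e2 ex.
  by rewrite mulNmx !mulmxA.
by rewrite ev ex y0 !mul0mx oppr0 mul0mx addr0.
Qed.

Lemma tr_unit_big (I : eqType) (r : seq I) (A : I -> representation F G) :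
  (forall i, i \in r -> tr_unit (A i)) ->
  tr_unit (\big[dadd_grepr/grepr0]_(i <- r) A i).
Proof.
move=> uA; rewrite big_seq; elim/big_ind: _ => // [|W X].
  exact: tr_unit0.
exact: tr_unit_dadd.
Qed.

Lemma rsim_submods W (A B : 'M_(rdegree W)) (modA : mxmodule W A)
    (modB : mxmodule W B) : (A + B :=: 1%:M)%MS -> (A :&: B = 0)%MS ->
  mx_rsim W (dadd_grepr (Representation (submod_repr modA))
                        (Representation (submod_repr modB))).
Proof.
move=> sAB dAB; apply: mx_rsim_trans (mx_rsim_sym (rsim_submod1 (mxmodule1 W) (eqmx_refl _))) _.
have dx : mxdirect (A + B) by apply/mxdirect_addsP.
exact: (mx_rsim_dadd (rU := Representation (submod_repr modA))
  (rV := Representation (submod_repr modB)) _ sAB dx (mx_rsim_refl _) (mx_rsim_refl _)).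
Qed.

(** Fitting's lemma for [eta], the identity plus the given trace: as V is
    indecomposable, [eta] is invertible or nilpotent.  In the second case the
    trace itself is invertible, and composing it with its inverse writes the
    identity as a trace. *)
Lemma tr_unit_indec V : indecomposable V -> ~ higman V -> tr_unit V.
Proof.
case: V => [[|n] V] [/= pos_n indecV] nhV phi; first by [].
set t := gtrace G phi; pose eta : 'M[F]_n.+1 := 1%:M + t.
have ht : is_hom t by apply: tr_hom.
have heta : @is_hom F gT G (Representation V) (Representation V) eta.
  by apply: homD => //; apply: hom_id.
have cent_eta : forall x, x \in G -> GRing.comm eta (V x).
  by move=> x Gx; rewrite /GRing.comm -mulmxE heta.
have modker q : mxmodule V (kermxpoly eta q).
  apply/mxmoduleP=> x Gx; apply/sub_kermxP; rewrite -mulmxA.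
  have -> : V x *m horner_mx eta q = horner_mx eta q *m V x.
    elim/poly_ind: q => [|q c IHq]; first by rewrite rmorph0 mulmx0 mul0mx.
    rewrite rmorphD rmorphM /= horner_mx_X horner_mx_C mulmxDr mulmxDl.
    by rewrite scalar_mxC mulmxE mulrA -mulmxE IHq -!mulmxA heta.
  by rewrite mulmxA mulmx_ker mul0mx.
(* Split V along the factorization of the characteristic polynomial of eta
   into a power of X and a factor that does not vanish at 0. *)
case: (multiplicity_XsubC (char_poly eta) 0) => m.
rewrite monic_neq0 ?char_poly_monic //= => -[q q0 echar].
have cop : coprimep q (('X - 0%:P) ^+ m).
  by apply: coprimep_expr; rewrite coprimep_XsubC.
have full : (kermxpoly eta q + kermxpoly eta (('X - 0%:P) ^+ m) :=: 1%:M)%MS.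
  apply: eqmx_trans (eqmx_sym (kermxpolyM _ cop)) _.
  rewrite -echar /kermxpoly Cayley_Hamilton. apply/eqmxP.
  by rewrite submx1; apply/sub_kermxP; rewrite mulmx0.
have [r1|r2] := indecV _ _ (rsim_submods (W := Representation V)
  (modker q) (modker (('X - 0%:P) ^+ m)) full (mxdirect_kermxpoly _ cop)).
  have etam : eta ^+ m = 0.
    have : (1%:M <= kermxpoly eta (('X - 0%:P) ^+ m))%MS.
      rewrite -full addsmx_sub submx_refl andbT.
      by move/eqP: r1; rewrite mxrank_eq0 => /eqP->; apply: sub0mx.
    move/sub_kermxP; rewrite mul1mx rmorphXn rmorphB /= horner_mx_X horner_mx_C.
    by rewrite raddf0 subr0.
  have ut : t \in unitmx.
    have := subrX1 eta m; rewrite etam sub0r {1}/eta addrAC subrr add0r => e.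
    apply/row_unitP => v vt; apply: oppr_inj; rewrite oppr0 -[v]mulmx1 -mulmxN.
    by rewrite [- _]e -mulmxE mulmxA vt mul0mx.
  case: nhV; exists (phi *m invmx t).
  by rewrite -(hom_trr phi (subxx G) (hom_inv ht ut)) mulmxV.
case: m echar cop full r2 => [|m] echar _ _ r2.
  have : ~~ eigenvalue eta 0 by rewrite eigenvalue_root_char echar expr0 mulr1.
  rewrite /eigenvalue negbK /eigenspace raddf0 subr0 => /eqP k0.
  by rewrite -row_free_unit -kermx_eq0 k0.
move/eqP: r2; rewrite mxrank_eq0 /kermxpoly rmorphXn rmorphB /= horner_mx_X.
rewrite horner_mx_C raddf0 subr0 kermx_eq0 row_free_unit.
move=> u; have : eta ^+ m.+1 \is a GRing.unit by [].
by rewrite unitrX_pos.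
Qed.

(** Since the composite [X -> M -> X] is invertible, X is a direct summand of M.
    On the complement the composite [M -> X -> M] vanishes, and it differs from
    the identity by a trace, so the identity of the complement is a trace. *)
Lemma stab_split X M : stable_iso X M -> tr_unit X ->
  exists2 Q, higman Q & mx_rsim M (dadd_grepr X Q).
Proof.
move=> [f [g [a [b [hf hg fg gf]]]]] uX.
have ut := uX a; set u := 1%:M + _ in ut fg.
have hu : @is_hom F gT G X X u.
  by apply: homD; [apply: hom_id | apply: tr_hom].
have hr := homM hg (hom_inv hu ut).
have fr : f *m (g *m invmx u) = 1%:M by rewrite mulmxA fg mulmxV.
have [Q [j [pi [hj hpi jpi jr rs]]]] := retract_split hf hr fr.
exists Q => //; exists (- (j *m b *m pi)).
have jg : j *m g = 0 by rewrite -[j *m g](mulmxKV ut) -[j *m g *m _]mulmxA jr mul0mx.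
rewrite trN -hom_trr // -hom_trl //.
have -> : gtrace G b = g *m f - 1%:M by rewrite gf addrAC subrr add0r.
by rewrite mulmxBr mulmxA jg mul0mx mulmx1 sub0r mulNmx jpi opprK.
Qed.

End Stable.

(** * Dimensions of spaces of homomorphisms *)

Section HomDim.

Variables (F : fieldType) (gT : finGroupType) (G : {group gT}).
Implicit Types (W X Y Z P Q V M : representation F G).

(** The intertwining conditions are linear, so this is an intersection of
    kernels. *)
Definition hom_space W X : {vspace 'M[F]_(rdegree W, rdegree X)} :=
  (\bigcap_(x in G) lker (linfun (mulmx (W x) \- mulmxr (X x))))%VS.

Lemma mem_homs W X f : reflect (is_hom f) (f \in hom_space W X).
Proof.
rewrite memvE; apply: (iffP subv_bigcapP) => h x Gx; have := h x Gx.
  by rewrite -memvE memv_ker lfunE /= subr_eq0 => /eqP.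
by move=> e; rewrite -memvE memv_ker lfunE /= subr_eq0; apply/eqP.
Qed.

Definition hdim W X := \dim (hom_space W X).

(** Dimensions are compared through maps that need to be injective only on
    homomorphisms. *)
Lemma hdim_le_linear W X W' X'
    (L : {linear 'M[F]_(rdegree W, rdegree X) -> 'M[F]_(rdegree W', rdegree X')}) :
  (forall f, is_hom f -> is_hom (L f)) ->
  (forall f, is_hom f -> L f = 0 -> f = 0) -> (hdim W X <= hdim W' X')%N.
Proof.
move=> homL injL; rewrite /hdim -(@limg_dim_eq _ _ _ (linfun L) (hom_space W X)).
  apply/dimvS/subvP=> _ /memv_imgP[f /mem_homs hf ->].
  by rewrite lfunE; apply/mem_homs/homL.
apply/eqP; rewrite -subv0; apply/subvP=> f /memv_capP[/mem_homs hf].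
by rewrite memv_ker lfunE memv0 => /eqP/(injL _ hf)->.
Qed.

Lemma hdim_rsimr W X Y : mx_rsim X Y -> hdim W X = hdim W Y.
Proof.
move=> /rsimP[f [g [hf hg fg gf]]]; apply/eqP; rewrite eqn_leq; apply/andP; split.
  apply: (@hdim_le_linear _ _ _ _ (mulmxr f)) => h hh /=; first exact: homM.
  by move=> e; rewrite -[h]mulmx1 -fg mulmxA e mul0mx.
apply: (@hdim_le_linear _ _ _ _ (mulmxr g)) => h hh /=; first exact: homM.
by move=> e; rewrite -[h]mulmx1 -gf mulmxA e mul0mx.
Qed.

Lemma hdim_rsiml W X Y : mx_rsim X Y -> hdim X W = hdim Y W.
Proof.
move=> /rsimP[f [g [hf hg fg gf]]]; apply/eqP; rewrite eqn_leq; apply/andP; split.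
  apply: (@hdim_le_linear _ _ _ _ (mulmx g)) => h hh /=; first exact: homM.
  by move=> e; rewrite -[h]mul1mx -fg -mulmxA e mulmx0.
apply: (@hdim_le_linear _ _ _ _ (mulmx f)) => h hh /=; first exact: homM.
by move=> e; rewrite -[h]mul1mx -gf -mulmxA e mulmx0.
Qed.

Lemma hdim0r W X : rdegree X = 0%N -> hdim W X = 0%N.
Proof.
move=> X0; apply/eqP; rewrite /hdim dimv_eq0 -subv0; apply/subvP=> f _.
by rewrite memv0; apply/eqP; case: X f X0 => n X f /= n0; subst n; apply/matrixP=> i [].
Qed.

Lemma hdim0l W X : rdegree W = 0%N -> hdim W X = 0%N.
Proof.
move=> X0; apply/eqP; rewrite /hdim dimv_eq0 -subv0; apply/subvP=> f _.
by rewrite memv0; apply/eqP; case: W f X0 => n W f /= n0; subst n; apply/matrixP=> -[].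
Qed.

Lemma hdim_daddl W X Y : hdim (dadd_grepr X Y) W = (hdim X W + hdim Y W)%N.
Proof.
pose L := linfun (mulmx (row_mx 1%:M 0 : 'M_(rdegree X, rdegree X + rdegree Y)))
  : 'Hom('M[F]_(rdegree (dadd_grepr X Y), rdegree W), 'M[F]_(rdegree X, rdegree W)).
have LE f : L f = row_mx 1%:M 0 *m f by rewrite lfunE.
rewrite {1}/hdim -(limg_ker_dim L) addnC; congr (_ + _)%N.
  congr (\dim _); apply/eqP; rewrite eqEsubv; apply/andP; split; apply/subvP=> f.
    case/memv_imgP=> g /mem_homs hg ->; rewrite LE; apply/mem_homs.
    by apply: (homM (X := dadd_grepr X Y)) hg; apply: hom_row_mx; [apply: hom_id | apply: hom0].
  move=> /mem_homs hf; apply/memv_imgP; exists (col_mx f 0).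
    by apply/mem_homs/hom_col_mx => //; apply: hom0.
  by rewrite LE mul_row_col mul1mx mul0mx addr0.
pose R := linfun (mulmx (col_mx 0 1%:M : 'M_(rdegree X + rdegree Y, rdegree Y)))
  : 'Hom('M[F]_(rdegree Y, rdegree W), 'M[F]_(rdegree (dadd_grepr X Y), rdegree W)).
have RE f : R f = col_mx 0 1%:M *m f by rewrite lfunE.
rewrite /hdim -(@limg_dim_eq _ _ _ R (hom_space Y W)); last first.
  apply/eqP; rewrite -subv0; apply/subvP=> f /memv_capP[_].
  rewrite memv_ker RE memv0 mul_col_mx mul0mx mul1mx => /eqP/(congr1 dsubmx).
  by rewrite col_mxKd linear0 => ->.
congr (\dim _); apply/eqP; rewrite eqEsubv; apply/andP; split; apply/subvP=> f.
  case/memv_capP=> /mem_homs hf; rewrite memv_ker LE => /eqP f0.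
  apply/memv_imgP; exists (row_mx 0 1%:M *m f).
    apply/mem_homs; apply: (homM (X := dadd_grepr X Y)) hf.
    by apply: hom_row_mx; [apply: hom0 | apply: hom_id].
  rewrite RE -{1}[f]mul1mx scalar_mx_block block_mxEh mulmxA mul_col_row !mul1mx !mul0mx.
  move: f0; rewrite -[f]vsubmxK mul_row_col mul1mx mul0mx addr0 => ->.
  by rewrite mul_row_col mulmx0 add0r mul_block_col !mulmx0 !mul0mx !add0r mul_col_mx mul1mx mul0mx.
case/memv_imgP=> g /mem_homs hg ->; rewrite RE; apply/memv_capP; split.
  by apply/mem_homs; apply: (homM (W := dadd_grepr X Y)) hg;
    apply: hom_col_mx; [apply: hom0 | apply: hom_id].
by rewrite memv_ker LE mulmxA mul_row_col mul1mx mul0mx addr0 mul0mx.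
Qed.

(** Exactness of [Hom(P, -)] for projective P. *)
Lemma hdim_ses P K X Y (i : 'M_(rdegree K, rdegree X))
    (e : 'M_(rdegree X, rdegree Y)) :
  projective P -> is_hom i -> is_hom e -> row_free i -> row_full e -> i *m e = 0 ->
  rdegree X = (rdegree K + rdegree Y)%N -> hdim P X = (hdim P K + hdim P Y)%N.
Proof.
move=> projP hi he free_i full_e ie0 degX.
pose L := linfun (mulmxr e)
  : 'Hom('M[F]_(rdegree P, rdegree X), 'M[F]_(rdegree P, rdegree Y)).
have LE f : L f = f *m e by rewrite lfunE.
pose I := linfun (mulmxr i)
  : 'Hom('M[F]_(rdegree P, rdegree K), 'M[F]_(rdegree P, rdegree X)).
have IE f : I f = f *m i by rewrite lfunE.
have eq_ker : (i :=: kermx e)%MS.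
  apply/eqmxP; rewrite -(mxrank_leqif_eq _); last exact/sub_kermxP.
  rewrite mxrank_ker (eqP free_i); move: full_e; rewrite /row_full => /eqP->.
  by rewrite degX addnK.
rewrite {1}/hdim -(limg_ker_dim L); congr (_ + _)%N; last first.
  congr (\dim _); apply/eqP; rewrite eqEsubv; apply/andP; split; apply/subvP=> f.
    by case/memv_imgP=> g /mem_homs hg ->; rewrite LE; apply/mem_homs/homM.
  move=> /mem_homs hf; have [k [hk ke]] := projP _ _ _ _ he full_e hf.
  by apply/memv_imgP; exists k; [apply/mem_homs | rewrite LE].
rewrite /hdim -(@limg_dim_eq _ _ _ I (hom_space P K)); last first.
  apply/eqP; rewrite -subv0; apply/subvP=> f /memv_capP[_].
  rewrite memv_ker IE memv0 => /eqP f0.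
  by apply/eqP/(row_free_inj free_i); rewrite mul0mx.
congr (\dim _); apply/eqP; rewrite eqEsubv; apply/andP; split; apply/subvP=> f.
  case/memv_capP=> /mem_homs hf; rewrite memv_ker LE => /eqP/sub_kermxP.
  rewrite -eq_ker => /submxP[g eg]; apply/memv_imgP; exists g; rewrite ?IE //.
  apply/mem_homs=> x Gx; apply: (row_free_inj free_i).
  have := hf x Gx; rewrite eg mulmxA => ->; by rewrite -!mulmxA hi.
case/memv_imgP=> g /mem_homs hg ->; rewrite IE; apply/memv_capP; split.
  by apply/mem_homs/homM.
by rewrite memv_ker LE -mulmxA ie0 mulmx0.
Qed.

Lemma hdim_daddr P X Y : projective P ->
  hdim P (dadd_grepr X Y) = (hdim P X + hdim P Y)%N.
Proof.
move=> projP.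
apply: (@hdim_ses P X (dadd_grepr X Y) Y (row_mx 1%:M 0) (col_mx 0 1%:M)) => //.
- by apply: hom_row_mx; [apply: hom_id | apply: hom0].
- by apply: hom_col_mx; [apply: hom0 | apply: hom_id].
- by apply/row_freeP; exists (col_mx 1%:M 0); rewrite mul_row_col mul1mx mul0mx addr0.
- by apply/row_fullP; exists (row_mx 0 1%:M); rewrite mul_row_col mul1mx mul0mx add0r.
- by rewrite mul_row_col mul1mx mul0mx addr0.
Qed.

Lemma hdim_bigr P (I : Type) (r : seq I) (A : I -> representation F G) :
  projective P ->
  hdim P (\big[dadd_grepr/grepr0]_(i <- r) A i) = (\sum_(i <- r) hdim P (A i))%N.
Proof.
move=> projP; apply: (big_morph (hdim P)) => [X Y|]; first exact: hdim_daddr.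
exact: hdim0r.
Qed.

Lemma hdim_bigl W (I : Type) (r : seq I) (A : I -> representation F G) :
  hdim (\big[dadd_grepr/grepr0]_(i <- r) A i) W = (\sum_(i <- r) hdim (A i) W)%N.
Proof.
apply: (big_morph (fun X => hdim X W)) => [X Y|]; first exact: hdim_daddl.
exact: hdim0l.
Qed.

Lemma hdim_mulnr P X k : projective P -> hdim P (muln_grepr X k) = (k * hdim P X)%N.
Proof. by move=> projP; rewrite hdim_bigr // sum_nat_const card_ord. Qed.

Lemma hdim_mulnl W X k : hdim (muln_grepr X k) W = (k * hdim X W)%N.
Proof. by rewrite hdim_bigl sum_nat_const card_ord. Qed.

Lemma hdim_gt0 W X : (0 < hdim W X)%N ->
  exists2 f : 'M_(rdegree W, rdegree X), is_hom f & f != 0.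
Proof.
rewrite lt0n dimv_eq0 => nz; exists (vpick (hom_space W X)); last by rewrite vpick0.
exact/mem_homs/memv_pick.
Qed.

End HomDim.

(** * Simple modules, projective covers and composition multiplicities *)

Section Simple.

Variables (F : closedFieldType) (gT : finGroupType) (G : {group gT}).
Implicit Types (W X Y Z P Q V M S : representation F G).

Lemma kermx_hom W X (f : 'M_(rdegree W, rdegree X)) :
  is_hom f -> mxmodule W (kermx f).
Proof.
move=> hf; apply/mxmoduleP=> x Gx; apply/sub_kermxP.
by rewrite -mulmxA hf // mulmxA mulmx_ker mul0mx.
Qed.

Lemma mulmx_hom W X (f : 'M_(rdegree W, rdegree X)) m (N : 'M_(m, rdegree W)) :
  is_hom f -> mxmodule W N -> mxmodule X (N *m f).
Proof.
move=> hf /mxmoduleP modN; apply/mxmoduleP=> x Gx.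
by rewrite -mulmxA -hf // mulmxA submxMr ?modN.
Qed.

Lemma irr_mod_full S m (N : 'M_(m, rdegree S)) :
  mx_irreducible S -> mxmodule S N -> N != 0 -> row_full N.
Proof.
move=> /mx_irrP[_ irrS] modN nzN; have := irrS <<N>>%MS.
rewrite (eqmx_module _ (genmxE N)) => /(_ modN).
rewrite -mxrank_eq0 genmxE mxrank_eq0 => /(_ nzN).
by rewrite /row_full genmxE.
Qed.

Lemma irr_hom_full W S (f : 'M_(rdegree W, rdegree S)) :
  mx_irreducible S -> is_hom f -> f != 0 -> row_full f.
Proof.
move=> irrS hf nzf; rewrite -[f]mul1mx; apply: irr_mod_full => //.
  by apply: mulmx_hom => //; apply: mxmodule1.
by rewrite mul1mx.
Qed.

Lemma irr_hom_free S X (f : 'M_(rdegree S, rdegree X)) :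
  mx_irreducible S -> is_hom f -> f != 0 -> row_free f.
Proof.
move=> irrS hf; apply: contraR; rewrite -kermx_eq0 => nz.
have := irr_mod_full irrS (kermx_hom hf) nz.
by rewrite -sub1mx => /sub_kermxP; rewrite mul1mx => ->.
Qed.

Lemma irr_hom_rsim S S' (f : 'M_(rdegree S, rdegree S')) :
  mx_irreducible S -> mx_irreducible S' -> is_hom f -> f != 0 -> mx_rsim S S'.
Proof.
move=> irrS irrS' hf nzf; have free_f := irr_hom_free irrS hf nzf.
have full_f := irr_hom_full irrS' hf nzf.
by exists f => //; rewrite -(eqP free_f) (eqP full_f).
Qed.

(** Schur's lemma: subtracting an eigenvalue leaves a map with a kernel. *)
Lemma irr_End_scalar S (f : 'M_(rdegree S)) :
  mx_irreducible S -> @is_hom F gT G S S f -> exists a, f = a%:M.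
Proof.
move=> irrS hf; have /mx_irrP[pos_S _] := irrS.
have [a] : exists a, root (char_poly f) a.
  by apply/closed_rootP; rewrite size_char_poly -(prednK pos_S).
rewrite -eigenvalue_root_char => eig_a; exists a.
apply/eqP; rewrite -subr_eq0; apply/negPn/negP => nz.
have ha : @is_hom F gT G S S (f - a%:M).
  by apply: homB => // x _; rewrite scalar_mxC.
have := irr_hom_free irrS ha nz; rewrite -kermx_eq0.
by apply/negP.
Qed.

Section Cover.

Variables (P S : representation F G).
Hypotheses (coverP : is_projective_cover P S) (irrS : mx_irreducible S).

(** A projective cover of a simple module has a unique maximal submodule: the
    kernels of [f] and [e] are both maximal, and if they differed then the kernel
    of [f] would be a proper submodule that spans P together with the kernel of
    [e]. *)
Lemma cover_factor S' (f : 'M_(rdegree P, rdegree S'))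
    (e : 'M_(rdegree P, rdegree S)) :
    (forall N : 'M_(rdegree P), mxmodule P N ->
          row_full (N + kermx e)%MS -> row_full N) ->
  mx_irreducible S' -> is_hom e -> row_full e -> is_hom f -> f != 0 ->
  exists2 u : 'M_(rdegree S', rdegree S), is_hom u & f *m u = e.
Proof.
move=> ess irrS' he full_e hf nzf.
have [f' f'f] := row_fullP (irr_hom_full irrS' hf nzf).
have kfe : kermx f *m e = 0.
  apply/eqP/negPn/negP => nz; case/negP: nzf.
  have full_ke := irr_mod_full irrS (mulmx_hom he (kermx_hom hf)) nz.
  suffices /ess : row_full (kermx f + kermx e)%MS.
    move/(_ (kermx_hom hf)); rewrite -sub1mx => /sub_kermxP.
    by rewrite mul1mx => ->.
  have /submxP[c ec] := submx_full e full_ke.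
  rewrite -sub1mx -[1%:M](subrK (c *m kermx f)) addrC addmx_sub_adds ?submxMl //.
  by apply/sub_kermxP; rewrite mulmxBl mul1mx -mulmxA -ec subrr.
have fu : f *m (f' *m e) = e.
  apply/eqP; rewrite eq_sym -subr_eq0 mulmxA -{1}[e]mul1mx -mulmxBl; apply/eqP/sub_kermxP.
  apply: submx_trans (_ : _ <= kermx f)%MS _; last exact/sub_kermxP.
  by apply/sub_kermxP; rewrite mulmxBl mul1mx -mulmxA f'f mulmx1 subrr.
exists (f' *m e) => // x Gx.
apply: (row_full_inj (irr_hom_full irrS' hf nzf)).
by rewrite [LHS]mulmxA -hf // -[LHS]mulmxA fu [RHS]mulmxA fu he.
Qed.

Lemma cover_neq S' : mx_irreducible S' -> ~ mx_rsim S' S -> hdim P S' = 0%N.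
Proof.
move=> irrS' nS; apply/eqP; rewrite -leqn0 leqNgt; apply/negP => /hdim_gt0[f hf nzf].
have [_ [e [he full_e ess]]] := coverP.
have [u hu fu] := cover_factor ess irrS' he full_e hf nzf.
apply: nS; apply: irr_hom_rsim hu _ => //.
apply/eqP=> u0; have /mx_irrP[pos_S _] := irrS.
by move: full_e; rewrite -fu u0 mulmx0 /row_full mxrank0 eq_sym eqn0Ngt pos_S.
Qed.

(** By [cover_factor] every homomorphism to S is a multiple of the given one. *)
Lemma cover_self : hdim P S = 1%N.
Proof.
have [_ [e [he full_e ess]]] := coverP.
have /mx_irrP[pos_S _] := irrS.
have nze : e != 0.
  by apply/eqP=> e0; move: full_e; rewrite e0 /row_full mxrank0 eq_sym eqn0Ngt pos_S.
suffices -> : hdim P S = \dim <[e]>%VS by rewrite dim_vline nze.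
congr (\dim _); apply/eqP; rewrite eqEsubv; apply/andP; split; last first.
  by rewrite -memvE; apply/mem_homs.
apply/subvP=> f /mem_homs hf.
have [->|nzf] := eqVneq f 0; first exact: mem0v.
have [u hu fu] := cover_factor ess irrS he full_e hf nzf.
have [a ea] := irr_End_scalar irrS hu.
have nza : a != 0.
  by apply: contraNneq nze => a0; rewrite -fu ea a0 raddf0 mulmx0.
apply/vlineP; exists a^-1; rewrite -fu ea mul_mx_scalar scalerA mulVf ?scale1r //.
Qed.

Lemma cover_rsim S' : mx_irreducible S' -> mx_rsim S' S -> hdim P S' = 1%N.
Proof. by move=> _ /hdim_rsimr->; apply: cover_self. Qed.

End Cover.

Lemma in_factmodS n (U : 'M[F]_n) m1 m2 (A : 'M_(m1, n)) (B : 'M_(m2, n)) :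
  (A <= B)%MS -> (in_factmod U A <= in_factmod U B)%MS.
Proof. exact: submxMr. Qed.

Lemma in_factmodM n (U : 'M[F]_n) m1 m2 (A : 'M_(m1, m2)) (B : 'M_(m2, n)) :
  in_factmod U (A *m B) = A *m in_factmod U B.
Proof. by rewrite /in_factmod /= mulmxA. Qed.

Lemma in_submodM n (U : 'M[F]_n) m1 m2 (A : 'M_(m1, m2)) (B : 'M_(m2, n)) :
  in_submod U (A *m B) = A *m in_submod U B.
Proof. by rewrite /in_submod /= !mulmxA. Qed.

Section CompMult.

Variables (P M : representation F G).
Hypothesis projP : projective P.

(** For a submodule N of M this is the space of homomorphisms from P to N, kept
    inside the homomorphisms to M so that a filtration of M filters them. *)
Definition homs_sub (N : 'M[F]_(rdegree M)) : {vspace 'M[F]_(rdegree P, rdegree M)} :=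
  (hom_space P M :&: lker (linfun (mulmxr (cokermx N))))%VS.

Lemma mem_homs_sub N f : reflect (is_hom f /\ (f <= N)%MS) (f \in homs_sub N).
Proof.
apply: (iffP memv_capP) => -[/mem_homs hf sN]; split=> //; move: sN;
  by rewrite memv_ker lfunE /= submxE.
Qed.

(** The homomorphisms from P to a section of M are those to the larger submodule
    modulo those to the smaller one, as P is projective. *)
Lemma homs_sub_section (A B : 'M_(rdegree M)) (modA : mxmodule M A)
    (modB : mxmodule M B) : (A <= B)%MS ->
  \dim (homs_sub B) = (\dim (homs_sub A)
    + hdim P (Representation (section_repr modA modB)))%N.
Proof.
move=> sAB; set N := Representation _; set C := <<in_factmod A B>>%MS.
pose L := linfun (mulmxr (in_submod C (in_factmod A 1%:M)))
  : 'Hom('M[F]_(rdegree P, rdegree M), 'M[F]_(rdegree P, rdegree N)).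
have LE f : L f = in_submod C (in_factmod A f).
  by rewrite lfunE /= in_submodE mulmxA -in_submodE -in_factmodE.
rewrite -(limg_ker_dim L (homs_sub B)); congr (_ + _)%N; congr (\dim _);
  apply/eqP; rewrite eqEsubv; apply/andP; split; apply/subvP=> f.
- case/memv_capP=> /mem_homs_sub[hf sfB]; rewrite memv_ker LE => /eqP f0.
  apply/mem_homs_sub; split=> //; rewrite -in_factmod_eq0.
  rewrite -[in_factmod A f](@in_submodK _ _ C) ?f0 ?linear0 //.
  by rewrite genmxE in_factmodS.
- case/mem_homs_sub=> hf sfA; apply/memv_capP; split.
    by apply/mem_homs_sub; split=> //; apply: submx_trans sfA sAB.
  by rewrite memv_ker LE; move: sfA; rewrite -in_factmod_eq0 => /eqP->; rewrite linear0.
- case/memv_imgP=> g /mem_homs_sub[hg sgB] ->; rewrite LE; apply/mem_homs=> x Gx /=.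
  rewrite -in_submodJ; last by rewrite genmxE in_factmodS.
  rewrite -in_factmodJ // -hg // in_factmodM.
  exact/esym/in_submodM.
move=> /mem_homs hf.
pose X := Representation (submod_repr modB).
pose e : 'M_(rdegree X, rdegree N) := in_submod C (in_factmod A (val_submod 1%:M)).
have sval m (g : 'M_(m, rdegree X)) : (in_factmod A (val_submod g) <= C)%MS.
  by rewrite genmxE in_factmodS ?val_submodP.
have he : is_hom e.
  move=> x Gx /=; rewrite -in_submodJ // -in_factmodJ // -val_submodJ // mul1mx.
  rewrite [in RHS]val_submodE in_factmodM; exact/esym/in_submodM.
have full_e : row_full e.
  rewrite -sub1mx -val_submodS in_submodK // val_submod1 genmxE.
  by rewrite in_factmodS // val_submod1.
have [k [hk ke]] := projP he full_e hf.
apply/memv_imgP; exists (val_submod k); last first.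
  rewrite LE -ke /e [val_submod k]val_submodE in_factmodM; exact/esym/in_submodM.
apply/mem_homs_sub; split; last exact: val_submodP.
move=> x Gx; rewrite -val_submodJ // -[submod_repr modB x]/(X x) -hk //.
by rewrite /val_submod /= mulmxA.
Qed.

Lemma hdim_series (Ns : seq 'M_(rdegree M)) (compN : mx_composition_series M Ns) :
  (last 0 Ns :=: 1%:M)%MS ->
  hdim P M = (\sum_(i < size Ns) hdim P (Representation (series_repr i compN)))%N.
Proof.
move=> lastN.
have telescope j : (j <= size Ns)%N ->
  \dim (homs_sub (0 :: Ns)`_j) =
    (\sum_(i < j) hdim P (Representation (series_repr i compN)))%N.
  elim: j => [_|j IHj ltj].
    rewrite big_ord0; apply/eqP; rewrite dimv_eq0 -subv0; apply/subvP=> f.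
    by case/mem_homs_sub=> _; rewrite submx0 memv0.
  rewrite big_ord_recr /= -IHj; last exact: ltnW.
  rewrite -homs_sub_section //; have [[/andP[]]] := proj2 compN j ltj.
  by [].
rewrite -(telescope (size Ns)) // -[(0 :: Ns)`_(size Ns)]/(nth 0 (0 :: Ns) (size (0 :: Ns)).-1).
rewrite nth_last /=; congr (\dim _); apply/eqP; rewrite eqEsubv; apply/andP.
split; apply/subvP=> f; last by case/mem_homs_sub=> hf _; apply/mem_homs.
by move=> /mem_homs hf; apply/mem_homs_sub; split; rewrite ?lastN ?submx1.
Qed.

(** Sum [homs_sub_section] over a composition series: the factors isomorphic
    to S contribute 1 and the other ones 0. *)
Lemma comp_mult_hdim S k : is_projective_cover P S -> mx_irreducible S ->
  comp_mult M S k -> k = hdim P M.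
Proof.
move=> coverP irrS [Ns [compN [lastN [I [memI <-]]]]].
rewrite (hdim_series compN lastN) -sum1_card [RHS](bigID (mem I)) /= [X in (_ + X)%N]big1.
  rewrite addn0; apply: eq_bigr => i /memI rs; apply/esym/(cover_rsim coverP) => //.
  exact: mx_series_repr_irr.
move=> i /negP nI; apply: (cover_neq coverP) => //; first exact: mx_series_repr_irr.
by move=> rs; apply: nI; apply/memI.
Qed.

End CompMult.

End Simple.

(** * Direct sums of modules and projective summands *)

Section Generic.

Variables (F : closedFieldType) (gT : finGroupType) (G : {group gT}).
Implicit Types (W X Y Z P Q V M S : representation F G).

Lemma rdegree_big (I : Type) (r : seq I) (A : I -> representation F G) :
  rdegree (\big[dadd_grepr/grepr0]_(i <- r) A i) = (\sum_(i <- r) rdegree (A i))%N.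
Proof. by apply: (big_morph (@rdegree F gT G)). Qed.

Lemma rsim_degree0 W X : rdegree W = 0%N -> rdegree X = 0%N -> mx_rsim W X.
Proof.
move=> W0 X0; apply: (@rsim_of_section _ _ _ _ _ 0 0); rewrite ?W0 ?X0 //.
  exact: hom0.
by apply/matrixP=> -[].
Qed.

(** One more copy of Y can be put into the summand indexed by [s]. *)
Lemma rsim_big_pick (I : eqType) (r : seq I) (A A' : I -> representation F G) Y s :
  uniq r -> s \in r -> mx_rsim (dadd_grepr Y (A s)) (A' s) ->
  (forall i, i != s -> A' i = A i) ->
  mx_rsim (dadd_grepr Y (\big[dadd_grepr/grepr0]_(i <- r) A i))
          (\big[dadd_grepr/grepr0]_(i <- r) A' i).
Proof.
move=> + + rsA eqA; elim: r => // i r IHr /= /andP[nir Ur]; rewrite inE !big_cons.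
have [si _|ne_is /= sr] := eqVneq s i; first subst i.
  apply: mx_rsim_trans (rsim_daddA _ _ _) _; apply: rsim_dadd rsA _.
  have -> : \big[dadd_grepr/grepr0]_(j <- r) A' j = \big[dadd_grepr/grepr0]_(j <- r) A j.
    by apply: eq_big_seq => k kr; rewrite eqA //; apply: contraNneq nir => e; rewrite -e.
  exact: mx_rsim_refl.
rewrite eqA 1?eq_sym //; apply: mx_rsim_trans (rsim_daddA _ _ _) _.
apply: mx_rsim_trans (rsim_dadd (rsim_daddC _ _) (mx_rsim_refl _)) _.
apply: mx_rsim_trans (mx_rsim_sym (rsim_daddA _ _ _)) _.
by apply: rsim_dadd (mx_rsim_refl _) _; apply: IHr.
Qed.

(** Essential epimorphisms detect surjectivity. *)
Lemma cover_onto P S Q (e : 'M_(rdegree P, rdegree S)) (k : 'M_(rdegree Q, rdegree P)) :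
  (forall N : 'M_(rdegree P), mxmodule P N -> row_full (N + kermx e)%MS -> row_full N) ->
  is_hom k -> row_full (k *m e) -> row_full k.
Proof.
move=> ess hk full_ke; suffices : row_full <<k>>%MS by rewrite /row_full genmxE.
apply: ess.
  rewrite (eqmx_module _ (genmxE k)) -[k]mul1mx.
  by apply: mulmx_hom => //; apply: mxmodule1.
have /submxP[c ec] := submx_full e full_ke.
rewrite -sub1mx -[1%:M](subrK (c *m k)) addrC addmx_sub_adds ?genmxE ?submxMl //.
by apply/sub_kermxP; rewrite mulmxBl mul1mx -mulmxA -ec subrr.
Qed.

Lemma cover_simple_proj P S : is_projective_cover P S -> projective S -> mx_rsim P S.
Proof.
move=> [_ [e [he full_e ess]]] projS.
have [s [hs se]] := projS _ _ _ _ he full_e (hom_id S).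
have full_s : row_full s by apply: cover_onto ess hs _; rewrite se -sub1mx.
have free_s : row_free s by apply/row_freeP; exists e.
apply: mx_rsim_sym; exists s => //.
by rewrite -(eqP free_s) (eqP full_s).
Qed.

(** Lift the map to S through the cover of S: the lift is onto since the cover is
    essential, and it splits since the cover is projective. *)
Lemma cover_split P S Q (f : 'M_(rdegree Q, rdegree S)) :
  is_projective_cover P S -> projective Q -> is_hom f -> row_full f ->
  exists2 Q', higman Q' & mx_rsim Q (dadd_grepr P Q').
Proof.
move=> [projP [e [he full_e ess]]] projQ hf full_f.
have [k [hk ke]] := projQ _ _ _ _ he full_e hf.
have full_k : row_full k by apply: cover_onto ess hk _; rewrite ke.
have [i [hi ik]] := projP _ _ _ _ hk full_k (hom_id P).
have [Q' [j [pi [hj hpi jpi _ rs]]]] := retract_split hi hk ik.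
exists Q' => //; exact: higman_retract hj hpi jpi (proj_higman projQ).
Qed.

End Generic.

(** * Tensoring with the natural module of SL_2(p) *)

Section SL2Modules.

Variables (F : closedFieldType) (p : nat) (charF : p \in [pchar F]).
Local Notation GL2 := {'GL_2['F_p]}.
Local Notation rep := (representation F (SL2 p)).
Implicit Types (x y : GL2) (W X Y Q P : rep).

(** The entries of a matrix over the prime field, as scalars of F. *)
Definition entry x (i j : 'I_2) : F := Fp_emb F (GLval x i j).

Lemma lift01 : lift (0 : 'I_2) (0 : 'I_1) = 1 :> 'I_2.
Proof. exact: val_inj. Qed.

Lemma entM x y i j : entry (x * y)%g i j = entry x i 0 * entry y 0 j + entry x i 1 * entry y 1 j.
Proof.
rewrite /entry -(Fp_embM charF) -(Fp_embM charF) -(Fp_embD charF); congr (Fp_emb _ _).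
rewrite -[GLval (x * y)]/(GLval x *m GLval y) mxE big_ord_recl big_ord1 /=.
by rewrite lift01.
Qed.

Lemma ent1 i j : entry 1%g i j = (i == j)%:R.
Proof.
rewrite /entry GL_1E mxE; case: (i == j); last exact: Fp_emb0.
exact: Fp_emb1.
Qed.

Lemma det_2x2 (R : comNzRingType) (A : 'M[R]_2) :
  \det A = A 0 0 * A 1 1 - A 0 1 * A 1 0.
Proof.
rewrite (expand_det_row _ 0) big_ord_recl big_ord1 /cofactor !det_mx11 !mxE /=.
rewrite lift01 expr0 expr1 mul1r mulN1r mulrN; congr (_ * A _ _ - _ * A _ _);
  exact: val_inj.
Qed.

Lemma ent_det x : x \in SL2 p -> entry x 0 0 * entry x 1 1 - entry x 0 1 * entry x 1 0 = 1.
Proof.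
rewrite inE => /eqP dx; apply/eqP; rewrite subr_eq; apply/eqP.
rewrite /entry -!(Fp_embM charF) -(@Fp_emb1 F p) -(Fp_embD charF) -dx; congr (Fp_emb _ _).
by rewrite det_2x2 subrK.
Qed.

(** Entries lie in the prime field, which the Frobenius map fixes. *)
Lemma ent_pX x i j : entry x i j ^+ p = entry x i j.
Proof.
have := pFrobenius_aut_nat charF (GLval x i j); rewrite pFrobenius_autE.
by [].
Qed.

(** The tensor product of Q with the natural module V_2, written in the basis
    (q_i (x) x), (q_i (x) y). *)
Definition T2_mx Q x : 'M[F]_(rdegree Q + rdegree Q) :=
  block_mx (entry x 0 0 *: Q x) (entry x 0 1 *: Q x)
           (entry x 1 0 *: Q x) (entry x 1 1 *: Q x).

Lemma T2_mx_repr Q : mx_repr (SL2 p) (T2_mx Q).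
Proof.
split=> [|x y Gx Gy]; rewrite /T2_mx.
  by rewrite repr_mx1 !ent1 /= !scale1r !scale0r -scalar_mx_block.
rewrite mulmx_block -!scalemxAl -!scalemxAr !scalerA -!scalerDl -repr_mxM //.
by rewrite !entM.
Qed.

Definition tensV2 Q : rep := Representation (MxRepresentation (T2_mx_repr Q)).

(** The trace of [phi (x) 1] is the trace of [phi], tensored with 1. *)
Lemma T2_higman Q : higman Q -> higman (tensV2 Q).
Proof.
case=> phi trphi; exists (block_mx phi 0 0 phi : 'M_(rdegree (tensV2 Q))).
rewrite scalar_mx_block -[1%:M]trphi -tr_block; apply: eq_bigr => x Gx /=.
rewrite /T2_mx !mulmx_block !mulmx0 !mul0mx !addr0 !add0r.
rewrite -!scalemxAl -!scalemxAr !scalerA -!scalerDl -!entM mulVg !ent1 /=.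
by rewrite !scale1r !scale0r !mul0mx.
Qed.

(** The matrix form of the adjunction that comes from the invariant symplectic
    form on V_2: the two components are exchanged, one of them with a sign. *)
Definition T2_adj m n (f : 'M[F]_(m + m, n)) : 'M_(m, n + n) :=
  row_mx (dsubmx f) (- usubmx f).

Definition T2_adj' m n (f : 'M[F]_(m, n + n)) : 'M_(m + m, n) :=
  col_mx (- rsubmx f) (lsubmx f).

Lemma T2_adj_linear m n : linear (@T2_adj m n).
Proof.
move=> a f g; rewrite /T2_adj !linearP /= scale_row_mx add_row_mx.
by rewrite ?opprD ?scalerN.
Qed.

Lemma T2_adj'_linear m n : linear (@T2_adj' m n).
Proof.
move=> a f g; rewrite /T2_adj' !linearP /= scale_col_mx add_col_mx.
by rewrite ?opprD ?scalerN.
Qed.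

HB.instance Definition _ m n := GRing.isLinear.Build F _ _ _ (@T2_adj m n) (@T2_adj_linear m n).
HB.instance Definition _ m n := GRing.isLinear.Build F _ _ _ (@T2_adj' m n) (@T2_adj'_linear m n).

(** V_2 is self-dual, as its determinant form is invariant. *)
Lemma T2_adjunction Q X : hdim (tensV2 Q) X = hdim Q (tensV2 X).
Proof.
apply/eqP; rewrite eqn_leq; apply/andP; split.
  apply: (@hdim_le_linear _ _ _ (tensV2 Q) X Q (tensV2 X) (@T2_adj _ _)) => f; last first.
    move=> _ /eqP; rewrite row_mx_eq0 oppr_eq0 => /andP[/eqP f1 /eqP f0].
    by rewrite -[f]vsubmxK f0 f1 col_mx0.
  rewrite -[f](@vsubmxK _ (rdegree Q) (rdegree Q)).
  set f0 := usubmx f; set f1 := dsubmx f => hf x Gx; have := hf x Gx.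
  rewrite /= /T2_adj /T2_mx col_mxKu col_mxKd mul_block_col mul_col_mx.
  case/eq_col_mx; rewrite -!scalemxAl => e0 e1.
  rewrite mul_mx_row mul_row_block -!scalemxAr !mulNmx mulmxN -e0 -e1.
  have d := ent_det Gx.
  rewrite !scalerDr !scalerN !scalerDr !scalerA; congr row_mx.
    rewrite opprD addrACA -scalerBl -scalerBl.
    rewrite [_ * entry x 0 0]mulrC subrr scale0r add0r.
    by rewrite [entry x 1 0 * _]mulrC d scale1r.
  rewrite opprD addrACA -!scalerBl [_ * entry x 0 1]mulrC subrr scale0r addr0.
  rewrite [entry x 1 1 * _]mulrC -opprB d scaleN1r //.
apply: (@hdim_le_linear _ _ _ Q (tensV2 X) (tensV2 Q) X (@T2_adj' _ _)) => f; last first.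
  move=> _ /eqP; rewrite col_mx_eq0 oppr_eq0 => /andP[/eqP f1 /eqP f0].
  by rewrite -[f]hsubmxK f0 f1 row_mx0.
rewrite -[f](@hsubmxK _ _ (rdegree X) (rdegree X)).
set u0 := lsubmx f; set u1 := rsubmx f => hf x Gx; have := hf x Gx.
rewrite /= /T2_adj' /T2_mx row_mxKl row_mxKr mul_row_block mul_mx_row.
case/eq_row_mx; rewrite -!scalemxAr => e0 e1.
rewrite mul_block_col mul_col_mx -!scalemxAl !mulNmx mulmxN e0 e1.
have d := ent_det Gx.
rewrite !scalerDr !scalerN !scalerDr !scalerA !opprD -!scaleNr; congr col_mx.
  rewrite addrACA -!scalerDl [entry x 0 1 * entry x 0 0]mulrC addNr scale0r add0r.
  rewrite (_ : - _ + _ = -1) ?scaleN1r // -d opprB addrC //.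
rewrite addrACA -!scalerDl [entry x 1 1 * entry x 1 0]mulrC addNr scale0r addr0.
rewrite (_ : - _ + _ = 1) ?scale1r // -d addrC.
by rewrite [entry x 1 1 * _]mulrC [entry x 1 0 * _]mulrC.
Qed.

End SL2Modules.

(** * The modules V_t as spaces of univariate polynomials *)

Section RowPoly.

Variable R : nzRingType.

Lemma rVpoly_inj d : injective (@rVpoly R d).
Proof. exact: can_inj rVpolyK. Qed.

Lemma rVpoly_sum d (v : 'rV[R]_d) : rVpoly v = \sum_i v 0 i *: 'X^i.
Proof.
by rewrite {1}[v]row_sum_delta linear_sum; apply: eq_bigr => i _; rewrite linearZ /= rVpoly_delta.
Qed.

Lemma rVpoly_mul m d (v : 'rV[R]_m) (A : 'M_(m, d)) :
  rVpoly (v *m A) = \sum_i v 0 i *: rVpoly (row i A).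
Proof. by rewrite mulmx_sum_row linear_sum; apply: eq_bigr => i _; rewrite linearZ. Qed.

(** Together with [muly], multiplication by the variables from degree t - 1 to
    degree t, on coefficient vectors. *)
Definition mulx t : 'M[R]_(t, t.+1) := \matrix_i delta_mx 0 (lift 0 i).
Definition muly t : 'M[R]_(t, t.+1) := \matrix_i delta_mx 0 (widen_ord (leqnSn t) i).

Lemma rVpoly_mulx t (v : 'rV[R]_t) : rVpoly (v *m mulx t) = rVpoly v * 'X.
Proof.
rewrite rVpoly_mul rVpoly_sum mulr_suml; apply: eq_bigr => i _.
by rewrite rowK rVpoly_delta -scalerAl -exprSr.
Qed.

Lemma rVpoly_muly t (v : 'rV[R]_t) : rVpoly (v *m muly t) = rVpoly v.
Proof.
rewrite rVpoly_mul rVpoly_sum; apply: eq_bigr => i _.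
by rewrite rowK rVpoly_delta.
Qed.

End RowPoly.

Section Sequences.

Variables (F : closedFieldType) (p : nat) (charF : p \in [pchar F]).
Local Notation GL2 := {'GL_2['F_p]}.
Local Notation rep := (representation F (SL2 p)).
Local Notation Vm := (V_mod charF).
Implicit Types (x y : GL2) (W X Y Q P : rep).

(** The image of x under the substitution given by a matrix, with y set to 1.
    Setting y to 1 loses nothing on homogeneous polynomials of a known degree. *)
Definition img_x x : {poly F} := entry F x 0 0 *: 'X + (entry F x 0 1)%:P.
Definition img_y x : {poly F} := entry F x 1 0 *: 'X + (entry F x 1 1)%:P.

Lemma V_mx_row t x (i : 'I_t) :
  rVpoly (row i (V_mx F t x)) = img_x x ^+ i * img_y x ^+ (t.-1 - i).
Proof.
(* Evaluation at x = X and y = 1. *)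
pose h (k : 'I_2) : {poly F} := if k == 0 then 'X else 1.
have := congr1 (mpoly.mmap polyC h) (@V_mxE F p t i x).
rewrite mpoly.comp_mpolyX big_ord_recl big_ord1 lift01 V_mnm0 V_mnm1.
rewrite !tnth_mktuple rmorphM !rmorphXn !rmorphD /= !mpoly.mmapZ !mpoly.mmapX !mpoly.mmap1U.
rewrite {1 2 3 4}/h /= !mulr1 !mul_polyC -/(img_x x) -/(img_y x) => ->.
rewrite raddf_sum rVpoly_sum; apply: eq_bigr => j _ /=.
rewrite mpoly.mmapZ mpoly.mmapX mul_polyC mxE; congr (_ *: _).
rewrite /mpoly.mmap1 big_ord_recl big_ord1 lift01 V_mnm0 V_mnm1 /h /=.
by rewrite expr1n mulr1.
Qed.

Lemma V_mx_coef t x (i j : 'I_t) :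
  V_mx F t x i j = (img_x x ^+ i * img_y x ^+ (t.-1 - i))`_j.
Proof. by rewrite -V_mx_row coef_rVpoly_ord [RHS]mxE. Qed.

(** Multiplication V_2 (x) V_t -> V_(t+1) is equivariant; this is the half that
    concerns x, and [muly_act] the one that concerns y. *)
Lemma mulx_act t x : mulx F t *m V_mx F t.+1 x =
  entry F x 0 0 *: (V_mx F t x *m mulx F t) + entry F x 0 1 *: (V_mx F t x *m muly F t).
Proof.
apply/row_matrixP=> i; apply: rVpoly_inj.
rewrite linearD /= !linearZ /= linearD /= !linearZ /= !row_mul rVpoly_mulx rVpoly_muly.
rewrite rowK -rowE !V_mx_row /= /bump /= add1n exprS -mulrA.
case: t i => [[]//|t] i /=; rewrite subSS.
by rewrite {1}/img_x mulrDl -scalerAl mul_polyC [_ * 'X]mulrC.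
Qed.

Lemma muly_act t x : muly F t *m V_mx F t.+1 x =
  entry F x 1 0 *: (V_mx F t x *m mulx F t) + entry F x 1 1 *: (V_mx F t x *m muly F t).
Proof.
apply/row_matrixP=> i; apply: rVpoly_inj.
rewrite linearD /= !linearZ /= linearD /= !linearZ /= !row_mul rVpoly_mulx rVpoly_muly.
rewrite rowK -rowE !V_mx_row /=.
case: t i => [[]//|t] i /=; have le_it : (i <= t)%N by rewrite -ltnS.
rewrite (subSn le_it) exprS.
rewrite mulrCA {1}/img_y mulrDl -scalerAl mul_polyC; congr (_ *: _ + _).
by rewrite mulrC.
Qed.

Lemma mulx_muly t : muly F t *m mulx F t.+1 = mulx F t *m muly F t.+1.
Proof.
apply/row_matrixP=> i; apply: rVpoly_inj.
by rewrite !row_mul rVpoly_mulx rVpoly_muly !rowK !rVpoly_delta /= -exprSr.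
Qed.

Lemma mulxy_full t : row_full (col_mx (mulx F t.+1) (muly F t.+1)).
Proof.
rewrite -sub1mx; apply/row_subP=> j; rewrite row1.
have [k|] := unliftP 0 j => [->|->].
  apply: submx_trans (_ : _ <= mulx F t.+1)%MS _; last by rewrite -addsmxE addsmxSl.
  by rewrite -(rowK (fun i => delta_mx 0 (lift 0 i) : 'rV[F]_(t.+2))) row_sub.
apply: submx_trans (_ : _ <= muly F t.+1)%MS _; last by rewrite -addsmxE addsmxSr.
have -> : 0 = widen_ord (leqnSn t.+1) 0 by apply: val_inj.
by rewrite -(rowK (fun i => delta_mx 0 (widen_ord (leqnSn t.+1) i) : 'rV[F]_(t.+2))) row_sub.
Qed.

Lemma muly_free t : row_free (muly F t).
Proof.
apply: inj_row_free => v v0; apply: rVpoly_inj.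
by rewrite -rVpoly_muly v0 !linear0.
Qed.

(** The exact sequence V_t -> V_(t+1) (x) V_2 -> V_(t+2), whose second map is
    multiplication and whose first map sends f to y f (x) x - x f (x) y. *)
Lemma hdim_T2_V Q t : projective Q ->
  hdim Q (tensV2 charF (Vm t.+1)) = (hdim Q (Vm t) + hdim Q (Vm t.+2))%N.
Proof.
move=> projQ.
apply: (@hdim_ses _ _ _ Q (Vm t) (tensV2 charF (Vm t.+1)) (Vm t.+2)
  (row_mx (muly F t) (- mulx F t)) (col_mx (mulx F t.+1) (muly F t.+1))) => //.
- move=> x Gx /=; have d := ent_det charF Gx.
  rewrite /T2_mx mul_mx_row mul_row_block !mulNmx mulmxN -!scalemxAr.
  rewrite mulx_act muly_act !scalerDr !scalerA !opprD -!scaleNr; congr row_mx.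
    rewrite addrACA -!scalerDl [entry F x 1 0 * _]mulrC subrr scale0r add0r.
    by rewrite [entry F x 1 0 * _]mulrC d scale1r.
  rewrite addrACA -!scalerDl [entry F x 1 1 * entry F x 0 1]mulrC subrr scale0r addr0.
  by rewrite -opprB [entry F x 1 1 * _]mulrC d scaleN1r.
- move=> x Gx /=; rewrite /T2_mx mul_block_col mul_col_mx mulx_act muly_act.
  by rewrite !scalemxAl.
- apply: inj_row_free => v /eqP; rewrite mul_mx_row row_mx_eq0 => /andP[/eqP v0 _].
  by apply: (row_free_inj (muly_free t)); rewrite v0 mul0mx.
- exact: mulxy_full.
- by rewrite mul_row_col mulNmx mulx_muly subrr.
- exact: addSnnS.
Qed.

(** The map sending x to x^p and y to y^p. *)
Definition frob_mx : 'M[F]_(2, p.+1) :=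
  \matrix_i (if i == 0 then delta_mx 0 ord0 else delta_mx 0 ord_max).

(** After setting y to 1 this is the derivative.  It lowers the degree by 2 since
    X^p has derivative 0.  In two variables it sends f to q, where y q and - x q
    are the partial derivatives of f, by Euler's relation in degree p. *)
Definition deriv_mx : 'M[F]_(p.+1, p.-1) := \matrix_i poly_rV ('X^i)^`().

Lemma rVpoly_frob (i : 'I_2) : rVpoly (row i frob_mx) = 'X^i ^+ p.
Proof.
rewrite rowK; case: (ord2P i) => ->; rewrite /= rVpoly_delta /=.
  by rewrite expr0 expr1n.
by rewrite -exprM mul1n.
Qed.

Lemma pchar_gt1 : (1 < p)%N.
Proof. exact: prime_gt1 (pcharf_prime charF). Qed.

Lemma derivXnE i : ('X^i : {poly F})^`() = i%:R *: 'X^(i.-1).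
Proof. by rewrite derivXn scaler_nat. Qed.

Lemma size_deriv_ltp i : (i <= p)%N -> (size ('X^i : {poly F})^`() <= p.-1)%N.
Proof.
rewrite derivXnE leq_eqVlt => /orP[/eqP->|lt_ip].
  by rewrite (pcharf0 charF) scale0r size_poly0.
case: i lt_ip => [|i] lt_ip; first by rewrite scale0r size_poly0.
by apply: leq_trans (size_scale_leq _ _) _; rewrite size_polyXn -ltnS (prednK (ltnW pchar_gt1)).
Qed.

Lemma rVpoly_deriv (v : 'rV[F]_p.+1) : rVpoly (v *m deriv_mx) = (rVpoly v)^`().
Proof.
rewrite rVpoly_mul rVpoly_sum linear_sum; apply: eq_bigr => i _ /=.
by rewrite linearZ /= rowK poly_rV_K // size_deriv_ltp // -ltnS.
Qed.

Lemma pchar_polyF : p \in [pchar {poly F}].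
Proof. exact: (rmorph_pchar (@polyC F) charF). Qed.

Lemma linear_poly_pX (a b : F) : a ^+ p = a -> b ^+ p = b ->
  (a *: 'X + b%:P) ^+ p = a *: 'X^p + b%:P.
Proof.
move=> ap bp; rewrite -(pFrobenius_autE pchar_polyF) rmorphD /= !pFrobenius_autE.
by rewrite exprZn -rmorphXn /= ap bp.
Qed.

(** The derivative of [img_x^i img_y^(p-i)] is [i img_x^(i-1) img_y^(p-i-1)],
    because p - i = - i in F and the determinant of x is 1. *)
Lemma deriv_equivariant x (i : 'I_p.+1) : x \in SL2 p ->
  rVpoly (row i (V_mx F p.+1 x) *m deriv_mx) =
  rVpoly (row i deriv_mx *m V_mx F p.-1 x).
Proof.
move=> Gx; rewrite rVpoly_deriv V_mx_row /= rowK.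
have dL : (img_x x)^`() = (entry F x 0 0)%:P.
  by rewrite derivD derivZ derivX derivC addr0 alg_polyC.
have dM : (img_y x)^`() = (entry F x 1 0)%:P.
  by rewrite derivD derivZ derivX derivC addr0 alg_polyC.
have det1 : (entry F x 0 0)%:P * img_y x - (entry F x 1 0)%:P * img_x x = 1.
  rewrite !mulrDr -!mul_polyC !mulrA -!polyCM [entry F x 1 0 * entry F x 0 0]mulrC.
  rewrite opprD addrACA subrr add0r.
  by rewrite -polyCB [entry F x 1 0 * _]mulrC ent_det.
have pP : p%:R = 0 :> {poly F} := pcharf0 pchar_polyF.
have p_pos := ltnW pchar_gt1.
case: i => [i lt_i] /=; have [i0|i_gt0] := posnP i.
  rewrite i0 expr0 mul1r subn0 deriv_exp -mulr_natr pP mulr0.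
  by rewrite derivXnE scale0r linear0 mul0mx linear0.
have [ip|ne_ip] := eqVneq i p.
  rewrite ip subnn expr0 mulr1 deriv_exp -mulr_natr pP mulr0.
  by rewrite derivXnE (pcharf0 charF) scale0r linear0 mul0mx linear0.
case: i i_gt0 ne_ip lt_i => // k _ ne_kp lt_kp.
have lt_k1p : (k.+1 < p)%N by rewrite ltn_neqAle ne_kp -ltnS.
have lt_k : (k < p.-1)%N by rewrite -ltnS (prednK p_pos).
have -> : poly_rV ('X^(k.+1))^`() = k.+1%:R *: delta_mx 0 (Ordinal lt_k) :> 'rV[F]_(p.-1).
  rewrite derivXnE linearZ /=; congr (_ *: _).
  by rewrite -(rVpoly_delta F (Ordinal lt_k)) rVpolyK.
rewrite -scalemxAl -rowE linearZ /= V_mx_row /=.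
have [m em] : exists m, p = (k.+1 + m.+1)%N.
  by exists (p - k.+2)%N; rewrite addnS -addSn subnKC.
have -> : (p.-1.-1 - k = m)%N by rewrite em addnS addSn /= addKn.
have -> : (p - k.+1 = m.+1)%N by rewrite em addKn.
(* The sum of the two exponents is p, which is 0 in F. *)
have mk : m.+1%:R = - k.+1%:R :> {poly F}.
  by apply/eqP; rewrite -addr_eq0 -natrD addnC -em pP.
rewrite derivM !deriv_exp /= dL dM -(mulr_natr _ k.+1) -(mulr_natr _ m.+1) mk -[RHS]mul_polyC.
rewrite [(k.+1%:R)%:P]rmorph_nat -[RHS]mulr1 -[X in _ = _ * X]det1 !exprS.
move: (img_x x) (img_y x) (entry F x 0 0)%:P (entry F x 1 0)%:P => A B a c.
move: (A ^+ k) (B ^+ m) (k.+1%:R) => Ak Bm n.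
by ring.
Qed.

(** The exact sequence V_2 -> V_(p+1) -> V_(p-1).  Its first map is equivariant
    since the entries of the matrices are fixed by the Frobenius map. *)
Lemma hdim_Vp1 Q : projective Q ->
  hdim Q (Vm p.+1) = (hdim Q (Vm 2) + hdim Q (Vm p.-1))%N.
Proof.
move=> projQ; have p_gt0 := ltnW pchar_gt1.
apply: (@hdim_ses _ _ _ Q (Vm 2) (Vm p.+1) (Vm p.-1) frob_mx deriv_mx) => //.
- move=> x Gx /=; apply/row_matrixP=> i; apply: rVpoly_inj; rewrite !row_mul.
  rewrite [LHS]rVpoly_mul big_ord_recl big_ord1 lift01 !rVpoly_frob.
  have rowE' j : row i (V_mx F 2 x) 0 j = V_mx F 2 x i j by rewrite [LHS]mxE.
  rewrite rowK !rowE' !V_mx_coef.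
  have cL c d : (c *: 'X + d%:P : {poly F})`_(0%R : 'I_2) = d
      /\ (c *: 'X + d%:P : {poly F})`_(1%R : 'I_2) = c.
    by rewrite !coefD !coefZ !coefX !coefC /= mulr0 mulr1 add0r addr0.
  have sq1 (q : {poly F}) : q ^+ 0 = 1 by rewrite expr0.
  case: (ord2P i) => -> /=; rewrite -rowE V_mx_row /= ?subn0 ?subnn ?sq1 ?mulr1 ?mul1r ?expr1.
    have [-> ->] := cL (entry F x 1 0) (entry F x 1 1).
    rewrite linear_poly_pX ?ent_pX // addrC; congr (_ + _).
    by rewrite expr1n alg_polyC.
  have [-> ->] := cL (entry F x 0 0) (entry F x 0 1).
  rewrite linear_poly_pX ?ent_pX // addrC; congr (_ + _).
  by rewrite expr1n alg_polyC.
- move=> x Gx /=; apply/row_matrixP=> i; apply: rVpoly_inj; rewrite !row_mul.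
  exact: deriv_equivariant.
- apply: inj_row_free => v v0; apply: rVpoly_inj; rewrite linear0.
  have := congr1 (@rVpoly F p.+1) v0; rewrite linear0 rVpoly_mul.
  rewrite rVpoly_sum !big_ord_recl !big_ord0 !lift01 !rVpoly_frob.
  rewrite !addr0 !expr1 expr0 expr1n => /polyP v0'.
  have := v0' p; have := v0' 0%N; rewrite !coefD !coefZ !coefXn !coef0 !coef1 !eqxx.
  rewrite eq_sym eqn0Ngt p_gt0 !mulr0 !mulr1 addr0 add0r => -> ->.
  by rewrite !scale0r addr0.
- rewrite -sub1mx; apply/row_subP=> j; rewrite row1.
  have lt_j : (j.+1 < p.+1)%N by rewrite ltnS (leq_trans (ltn_ord j)) ?leq_pred.
  have nz : (j.+1)%:R != 0 :> F.
    rewrite -(dvdn_pcharf charF) gtnNdvd //.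
    by have := ltn_ord j; rewrite -ltnS (prednK p_gt0).
  rewrite -(scale1r (delta_mx _ _)) -(mulVf nz) -scalerA scalemx_sub //.
  apply: submx_trans (row_sub (Ordinal lt_j) _); rewrite rowK /=.
  by rewrite derivXnE linearZ /= -(rVpoly_delta F j) rVpolyK.
- apply/row_matrixP=> i; apply: rVpoly_inj.
  rewrite row_mul rVpoly_deriv rVpoly_frob row0 linear0 -exprM derivXnE.
  by rewrite natrM (pcharf0 charF) mulr0 scale0r.
- by rewrite /= addSn add1n (prednK p_gt0).
Qed.

End Sequences.

(** * Modules of dimension p over a cyclic group of order p *)

Section Cyclic.

Variables (F : fieldType) (gT : finGroupType) (u : gT).
Hypothesis charF : #[u] \in [pchar F].

(** Put N = u - 1.  The rank of a power of N drops by at most one at each step, so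
    N^(p-1) is nonzero on some basis vector v, whereas N^p = u^p - 1 = 0.  The
    vectors v N^j with j < p are then linearly independent, and they lie in the
    submodule generated by v.  So v generates, and W is the regular module. *)
Lemma cyc_higman (W : representation F <[u]>) :
  rdegree W = #[u] -> (#[u].-1 <= \rank (W u - 1%:M)%R)%N -> higman W.
Proof.
case: W => [[|n] W] /= degW rkN.
  by have := pcharf_prime charF; rewrite -degW.
pose N : 'M[F]_n.+1 := W u - 1.
have rkNk k : (k <= n.+1)%N -> (n.+1 - k <= \rank (N ^+ k)%R)%N.
  elim: k => [|k IHk] le_k; first by rewrite expr0 mxrank1 subn0.
  rewrite subnS exprSr; have := mxrank_mul_ker (N ^+ k) N => eNk.
  have kerN : (\rank ((N ^+ k)%R :&: kermx N)%MS <= 1)%N.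
    apply: leq_trans (mxrankS (capmxSr _ _)) _; rewrite mxrank_ker leq_subLR.
    by rewrite addn1 ltnS; move: rkN; rewrite -degW.
  have := IHk (ltnW le_k); rewrite -eNk => h.
  rewrite -subn1 leq_subLR (leq_trans h) // addnC leq_add2r //.
have pM : #[u] \in [pchar 'M[F]_n.+1] by exact: (rmorph_pchar (@scalar_mx F n.+1)).
have Nn : N ^+ #[u] = 0.
  rewrite -(pFrobenius_autE pM) /N pFrobenius_autB_comm ?pFrobenius_autE.
    by rewrite -repr_mxX ?cycle_id // expg_order repr_mx1 expr1n subrr.
  exact: commr1.
rewrite -degW in Nn.
have nz : N ^+ n != 0.
  by rewrite -mxrank_eq0 -lt0n; apply: leq_trans (rkNk n _); rewrite ?subSnn.
have [i nzv] : exists i, row i (N ^+ n) != 0.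
  apply/existsP; apply: contraNT nz; rewrite negb_exists => /forallP all0.
  by apply/eqP/row_matrixP=> i; rewrite row0; apply/eqP; rewrite -[_ == _]negbK.
(* The chain v, v N, v N^2, ... has length exactly p. *)
pose v : 'rV[F]_n.+1 := delta_mx 0 i.
have vN : v *m N ^+ n != 0 by rewrite -rowE.
have [e [he sve]] := regular_hom_onto (W := Representation W) v.
pose L := \matrix_(j < n.+1) (v *m N ^+ j).
have sNe : (e *m N <= e)%MS.
  have := he u (cycle_id u) => /= heu.
  by rewrite mulmxBr mulmx1 -heu addmx_sub ?submxMl // -scaleN1r scalemx_sub.
have sLe : (L <= e)%MS.
  apply/row_subP=> -[j lt_j]; rewrite rowK /=; elim: j {lt_j} => [|j IHj].
    by rewrite expr0 mulmx1.
  by rewrite exprSr -mulmxE mulmxA (submx_trans (submxMr _ IHj)).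
have freeL : row_free L.
  apply: inj_row_free => c c0; apply/rowP=> j; rewrite mxE.
  case: j => j; elim/ltn_ind: j => j IHj lt_j.
  (* Multiplying by this power of N kills the terms after the j-th one. *)
  have := congr1 (mulmxr (N ^+ (n - j))) c0; rewrite /= mul0mx (mulmx_sum_row c) mulmx_suml.
  rewrite (bigD1 (Ordinal lt_j)) //= big1 => [|k ne_k].
    rewrite addr0 -scalemxAl rowK /= -mulmxA mulmxE -exprD subnKC // => /eqP.
    by rewrite scaler_eq0 (negPf vN) orbF => /eqP.
  rewrite -scalemxAl rowK -mulmxA mulmxE -exprD.
  have [lt_kj|] := ltnP k j.
    by case: k ne_k lt_kj => k lt_k ne_k lt_kj; rewrite IHj // scale0r.
  rewrite leq_eqVlt => /orP[/eqP ejk|lt_jk].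
    by case/eqP: ne_k; apply: val_inj.
  have -> : (k + (n - j) = n.+1 + (k - j.+1))%N.
    by rewrite -{1}(subnKC lt_jk) addnAC addSn subnKC.
  by rewrite exprD Nn mul0r mulmx0 scaler0.
have full_e : row_full e.
  rewrite -sub1mx; apply: submx_trans sLe; rewrite sub1mx.
  by rewrite row_full_unit -row_free_unit.
have rs : mx_rsim (regular_repr F <[u]>) W.
  exists e => //.
  by apply/eqP/(etrans (eqP full_e))/degW.
exact: (@higman_rsim _ _ _ (Representation W)
  (Representation (regular_repr F <[u]>)) (mx_rsim_sym rs) (higman_regular _ _)).
Qed.

End Cyclic.

(** * Subgroups and double cosets in SL_2(p) *)

Section SL2Group.

Variable p : nat.
Hypothesis p_prime : prime p.
Local Notation GL2 := {'GL_2['F_p]}.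
Implicit Types x y : GL2.

Lemma GL2P x y : GLval x 0 0 = GLval y 0 0 -> GLval x 0 1 = GLval y 0 1 ->
  GLval x 1 0 = GLval y 1 0 -> GLval x 1 1 = GLval y 1 1 -> x = y.
Proof.
move=> e00 e01 e10 e11; apply: val_inj; apply/matrixP=> i j.
by case: (ord2P i) => ->; case: (ord2P j) => ->.
Qed.

Lemma GL2M x y i j :
  GLval (x * y)%g i j = GLval x i 0 * GLval y 0 j + GLval x i 1 * GLval y 1 j.
Proof. by rewrite GL_MxE mxE big_ord_recl big_ord1 /= lift01. Qed.

Lemma SL2_det x : x \in SL2 p ->
  GLval x 0 0 * GLval x 1 1 - GLval x 0 1 * GLval x 1 0 = 1.
Proof. by rewrite inE => /eqP dx; rewrite -(det_2x2 (GLval x)). Qed.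

Definition mx22 (a b c d : 'F_p) : 'M['F_p]_2 :=
  \matrix_(i, j) if i == 0 then (if j == 0 then a else b)
                 else (if j == 0 then c else d).

(** Meant for [a d - b c = 1]; the default value 1 makes the function total. *)
Definition mkGL a b c d : GL2 := insubd (1%g : GL2) (mx22 a b c d).

Section MkGL.

Variables a b c d : 'F_p.
Hypothesis det1 : a * d - b * c = 1.

Lemma mkGLE : GLval (mkGL a b c d) = mx22 a b c d.
Proof.
apply: (@insubdK _ _ _ (1%g : GL2)).
by rewrite unfold_in unitmxE det_2x2 !mxE /= det1 unitr1.
Qed.

Lemma mkGL00 : GLval (mkGL a b c d) 0 0 = a. Proof. by rewrite mkGLE mxE. Qed.
Lemma mkGL01 : GLval (mkGL a b c d) 0 1 = b. Proof. by rewrite mkGLE mxE. Qed.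
Lemma mkGL10 : GLval (mkGL a b c d) 1 0 = c. Proof. by rewrite mkGLE mxE. Qed.
Lemma mkGL11 : GLval (mkGL a b c d) 1 1 = d. Proof. by rewrite mkGLE mxE. Qed.

Lemma mkGL_SL2 : mkGL a b c d \in SL2 p.
Proof. by rewrite inE det_2x2 mkGL00 mkGL01 mkGL10 mkGL11 det1. Qed.

End MkGL.

Lemma SL2V x : x \in SL2 p ->
  [/\ GLval x^-1%g 0 0 = GLval x 1 1, GLval x^-1%g 0 1 = - GLval x 0 1,
      GLval x^-1%g 1 0 = - GLval x 1 0 & GLval x^-1%g 1 1 = GLval x 0 0].
Proof.
move=> /SL2_det dx.
have dy : GLval x 1 1 * GLval x 0 0 - (- GLval x 0 1) * (- GLval x 1 0) = 1.
  by rewrite mulrNN mulrC.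
suffices -> : x^-1%g = mkGL (GLval x 1 1) (- GLval x 0 1) (- GLval x 1 0) (GLval x 0 0).
  by rewrite mkGL00 // mkGL01 // mkGL10 // mkGL11.
apply: (mulgI x); rewrite mulgV; apply: GL2P; rewrite GL_1E GL2M !mxE /=
  ?mkGL00 ?mkGL01 ?mkGL10 ?mkGL11 // -?dx; by ring.
Qed.

Definition unip := mkGL 1 1 0 1.
Definition weyl := mkGL 0 1 (-1) 0.

Lemma det_ug : 1 * 1 - 1 * 0 = 1 :> 'F_p. Proof. by rewrite mulr1 mulr0 subr0. Qed.
Lemma det_wg : 0 * 0 - 1 * -1 = 1 :> 'F_p.
Proof. by rewrite mulr0 mulrN1 opprK add0r. Qed.

Lemma wg_SL2 : weyl \in SL2 p. Proof. exact: mkGL_SL2 det_wg. Qed.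
Lemma ug_SL2 : unip \in SL2 p. Proof. exact: mkGL_SL2 det_ug. Qed.

Lemma ugX k : [/\ GLval (unip ^+ k)%g 0 0 = 1, GLval (unip ^+ k)%g 0 1 = k%:R,
  GLval (unip ^+ k)%g 1 0 = 0 & GLval (unip ^+ k)%g 1 1 = 1].
Proof.
elim: k => [|k [e00 e01 e10 e11]]; first by rewrite expg0 GL_1E !mxE.
rewrite expgSr !GL2M e00 e01 e10 e11 /unip.
rewrite (mkGL00 det_ug) (mkGL01 det_ug) (mkGL10 det_ug) (mkGL11 det_ug).
by rewrite ?mulr0 ?mulr1 ?mul0r ?addr0 ?add0r mulrS.
Qed.

Lemma order_ug : #[unip] = p.
Proof.
have up : (unip ^+ p = 1)%g.
  have [e00 e01 e10 e11] := ugX p; apply: GL2P; rewrite ?e00 ?e01 ?e10 ?e11 GL_1E mxE //.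
  by rewrite /= pchar_Fp_0.
apply: nt_prime_order => //; apply/eqP=> u1.
have [_ e01 _ _] := ugX 1; move: e01; rewrite expg1 u1 GL_1E mxE /= => /esym/eqP.
by rewrite oner_eq0.
Qed.

Lemma memU x : x \in SL2 p -> GLval x 0 0 = 1 -> GLval x 1 0 = 0 -> x \in <[unip]>.
Proof.
move=> Gx x00 x10; have := SL2_det Gx; rewrite x00 x10 mul1r mulr0 subr0 => x11.
set k := GLval x 0 1; have [e00 e01 e10 e11] := ugX k.
suffices -> : x = (unip ^+ k)%g by apply: mem_cycle.
by apply: GL2P; rewrite ?e00 ?e01 ?e10 ?e11 // natr_Zp.
Qed.

Lemma memUP x : x \in <[unip]> ->
  [/\ x \in SL2 p, GLval x 0 0 = 1, GLval x 1 0 = 0 & GLval x 1 1 = 1].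
Proof.
case/cycleP=> k ->; have [e00 e01 e10 e11] := ugX k; split=> //.
by apply: groupX; apply: ug_SL2.
Qed.

Lemma memB x : (x \in borel p) = (x \in SL2 p) && (GLval x 1 0 == 0).
Proof. by rewrite inE. Qed.

Lemma U_sub_B : <[unip]> \subset borel p.
Proof. by apply/subsetP=> x /memUP[Gx _ x10 _]; rewrite memB Gx x10 eqxx. Qed.

(** A Sylow p-subgroup of GL_2(p) has order p. *)
Lemma index_U_p' : ~~ (p %| #|SL2 p : <[unip]>|)%N.
Proof.
have sUG : <[unip]> \subset SL2 p by apply: subset_trans U_sub_B (borel_sub p).
have sG : SL2 p \subset 'GL_2(p) by apply: subsetT.
apply/negP => pI; have : (p ^ 2 %| #|'GL_2(p)|)%N.
  rewrite -(Lagrange sG) -(Lagrange sUG) -orderE order_ug dvdn_mulr //.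
  by rewrite expnS expn1 dvdn_mul.
by rewrite pfactor_dvdn ?cardG_gt0 // logn_card_GL_p.
Qed.

(** Together with [bruhat_inj]: the cosets of B other than B itself are permuted
    regularly by U. *)
Lemma bruhat y : y \in SL2 p -> y \notin borel p ->
  exists2 u, u \in <[unip]> & y \in (borel p :* (weyl * u))%g.
Proof.
move=> Gy; rewrite memB Gy /= => y10.
(* Subtracting k times the first column clears the lower right entry. *)
set k := GLval y 1 1 / GLval y 1 0; exists (unip ^+ k)%g; first exact: mem_cycle.
rewrite mem_rcoset invMg mulgA memB.
have [e00 e01 e10 e11] := ugX k.
have Gu : (unip ^+ k)%g \in SL2 p by rewrite groupX // ug_SL2.
have [v00 v01 v10 v11] := SL2V Gu; have [w00 w01 w10 w11] := SL2V wg_SL2.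
rewrite !groupM ?groupV ?wg_SL2 // andTb !GL2M ?v00 ?v01 ?v10 ?v11 ?w00 ?w01 ?w10 ?w11.
rewrite ?e00 ?e01 ?e10 ?e11 /weyl ?(mkGL00 det_wg) ?(mkGL01 det_wg).
rewrite ?(mkGL10 det_wg) ?(mkGL11 det_wg).
rewrite mulr0 add0r opprK !mulr1 natr_Zp.
by rewrite mulrN mulrCA divff // mulr1 addNr.
Qed.

Lemma bruhat_inj u v : u \in <[unip]> -> v \in <[unip]> ->
  (weyl * u)%g \in (borel p :* (weyl * v))%g -> u = v.
Proof.
move=> Uu Uv; rewrite mem_rcoset invMg !mulgA => Bw.
have Uz : (u * v^-1)%g \in <[unip]> by rewrite groupM ?groupV.
move: Bw; rewrite -(mulgA weyl); move: (u * v^-1)%g Uz (eq_mulgV1 u v) => z.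
move=> /memUP[Gz z00 z10 z11] euv; rewrite memB => /andP[_].
have [w00 w01 w10 w11] := SL2V wg_SL2.
rewrite !GL2M w00 w10 z00 z10 z11 /weyl !(mkGL10 det_wg) !(mkGL11 det_wg).
rewrite !mulr0 !mul0r !addr0 !add0r opprK mulr1 mulN1r oppr_eq0 => /eqP z01.
by apply/eqP; rewrite euv; apply/eqP/GL2P; rewrite ?z00 ?z01 ?z10 ?z11 GL_1E mxE.
Qed.

End SL2Group.

(** * Stable isomorphism over B and over SL_2(p) *)

Section Green.

Variables (F : closedFieldType) (p : nat) (charF : p \in [pchar F]).
Local Notation GL2 := {'GL_2['F_p]}.
Local Notation rep := (representation F (SL2 p)).
Implicit Types (x y : GL2) (W X Y Q P M : rep).
Local Notation res := (res_grepr (borel_sub p)).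
Local Notation Vm := (V_mod charF).

Let p_prime : prime p := pcharf_prime charF.

Lemma index_nz (H K : {group GL2}) : <[unip p]> \subset H -> H \subset K ->
  K \subset SL2 p -> #|K : H|%:R != 0 :> F.
Proof.
move=> sUH sHK sKG; rewrite -(dvdn_pcharf charF).
apply: contra (index_U_p' p_prime) => pI.
rewrite -(Lagrange_index (subset_trans sHK sKG) sUH).
by rewrite -(Lagrange_index sKG sHK) dvdn_mulr // dvdn_mull.
Qed.

Lemma wg_notB : weyl p \notin borel p.
Proof. by rewrite memB negb_and (mkGL10 (det_wg p)) oppr_eq0 oner_eq0 orbT. Qed.

Lemma wgU_notB u : u \in <[unip p]> -> (weyl p * u)%g \notin borel p.
Proof.
by move=> Uu; rewrite groupMr ?wg_notB // (subsetP (U_sub_B p)).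
Qed.

Lemma rcosets_borel : rcosets (borel p) (SL2 p) =
  (borel p : {set GL2}) |: [set (borel p :* (weyl p * u))%g | u in <[unip p]> ].
Proof.
apply/setP=> C; rewrite in_setU1; apply/rcosetsP/orP => [[x Gx ->]|[/eqP->|]].
- have [Bx|nBx] := boolP (x \in borel p); [left | right].
    by rewrite rcoset_id.
  have [u Uu /rcoset_eqP xu] := bruhat Gx nBx.
  by apply/imsetP; exists u; rewrite ?xu.
- by exists 1%g; rewrite ?rcoset1.
case/imsetP=> u Uu ->; exists (weyl p * u)%g => //.
by rewrite groupM ?wg_SL2 //; case: (memUP Uu).
Qed.

(** This is Mackey's formula.  The nontrivial cosets contribute a trace over U
    because U permutes them regularly. *)
Lemma rtr_bruhat W X (f : 'M_(rdegree W, rdegree X)) : hom_on (borel p) f ->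
  rtrace (borel p) f = f + gtrace <[unip p]> (W (weyl p)^-1%g *m f *m X (weyl p)).
Proof.
move=> hf; rewrite /rtrace rcosets_borel big_setU1 /=; last first.
  apply/imsetP=> -[u Uu eB]; case/negP: (wgU_notB Uu).
  by have := rcoset_refl (borel p) (weyl p * u)%g; rewrite -eB.
congr (_ + _).
  have := rtr_coset (borel_sub p) hf (group1 _); rewrite mulg1.
  by rewrite invg1 !repr_mx1 mul1mx mulmx1.
rewrite big_imset /= => [|u v Uu Uv e]; last first.
  have e' : (borel p :* (weyl p * u))%g = (borel p :* (weyl p * v))%g := e.
  by apply: (bruhat_inj Uu Uv); rewrite -e' rcoset_refl.
apply: eq_bigr => u Uu; have [Gu _ _ _] := memUP Uu.
rewrite (rtr_coset (borel_sub p) hf) ?groupM ?wg_SL2 //.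
by rewrite invMg !repr_mxM ?groupV ?wg_SL2 // !mulmxA.
Qed.

(** Being fixed by B, the map equals its own relative trace from U to B up to the
    index of U in B, which is prime to p. *)
Lemma tr_U_borel (W X : representation F (borel p)) (f : 'M_(rdegree W, rdegree X)) :
  is_hom (gtrace <[unip p]> f) ->
  gtrace <[unip p]> f = gtrace (borel p) (#|borel p : <[unip p]>|%:R^-1 *: f).
Proof.
move=> hf; have sUB := U_sub_B p.
rewrite trZ -(rtr_tr sUB) rtr_const // scalerA mulVf ?scale1r //.
by apply: index_nz => //; apply: borel_sub.
Qed.

(** On stable categories, inducing a map from B to G and restricting it again
    changes nothing. *)
Lemma rtr_borelE W X (f : 'M_(rdegree W, rdegree X)) : hom_on (borel p) f ->
  exists phi, rtrace (borel p) f = f + gtrace (borel p) phi.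
Proof.
move=> hf; exists (#|borel p : <[unip p]>|%:R^-1 *: (W (weyl p)^-1%g *m f *m X (weyl p))).
rewrite {1}rtr_bruhat //; congr (_ + _); apply: (@tr_U_borel (res W) (res X)).
have -> : @gtrace _ _ (borel p) <[unip p]> (res W) (res X) (W (weyl p)^-1%g *m f *m X (weyl p))
  = rtrace (borel p) f - f.
  by rewrite rtr_bruhat // addrAC subrr add0r.
move=> x Bx; have Gx := subsetP (borel_sub p) x Bx; rewrite /= mulmxBr mulmxBl hf //.
by rewrite (rtr_hom (borel_sub p) hf).
Qed.

(** Relative traces of stable inverses are stable inverses, up to the index of B
    in G. *)
Lemma rtr_mul_borel W X (f : 'M_(rdegree W, rdegree X)) (g : 'M_(rdegree X, rdegree W)) a :
  hom_on (borel p) f -> hom_on (borel p) g ->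
  f *m g = 1%:M + gtrace (borel p) a ->
  exists b, rtrace (borel p) f *m rtrace (borel p) g = #|SL2 p : borel p|%:R%:M + gtrace (SL2 p) b.
Proof.
move=> hf hg fg; have sBG := borel_sub p.
have [psi epsi] := rtr_borelE hg.
rewrite rtr_trr //; last exact: rtr_hom.
exists (a + f *m psi); rewrite epsi mulmxDr fg -addrA.
have -> : f *m gtrace (borel p) psi = gtrace (borel p) (f *m psi).
  exact: (@hom_trl _ _ (borel p) (borel p) (res W) (res X) (res W)).
by rewrite -trD rtrD rtr_tr // rtr_const ?scalemx1 //; apply: hom_id.
Qed.

Lemma stab_borel M X : stable_iso (res M) (res X) -> stable_iso M X.
Proof.
move=> [f [g [a [b [hf hg fg gf]]]]].
have [a' ea] := @rtr_mul_borel M X f g a hf hg fg.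
have [b' eb] := @rtr_mul_borel X M g f b hg hf gf.
set c := #|SL2 p : borel p|%:R in ea eb.
have nzc : c != 0 by apply: index_nz => //; [apply: U_sub_B | apply: borel_sub].
exists (c^-1 *: rtrace (borel p) (f : 'M_(rdegree M, rdegree X))).
exists (rtrace (borel p) (g : 'M_(rdegree X, rdegree M))).
exists (c^-1 *: a'), (c^-1 *: b'); split.
- exact/homZ/rtr_hom/hf/borel_sub.
- exact/rtr_hom/hg/borel_sub.
- by rewrite -scalemxAl ea scalerDr scale_scalar_mx mulVf // trZ.
- by rewrite -scalemxAr eb scalerDr scale_scalar_mx mulVf // trZ.
Qed.

End Green.

(** * Simplicity of V_t and projectivity of V_p *)

Section Difference.

Variables (F : fieldType) (p : nat) (charF : p \in [pchar F]).

Lemma coef_XaddCn k j : (('X + 1 : {poly F}) ^+ k)`_j = 'C(k, j)%:R.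
Proof.
elim: k j => [|k IHk] [|j]; rewrite ?expr0 ?coef1 // exprSr mulrDr mulr1 coefD coefMX.
  by rewrite add0r IHk !bin0.
by rewrite !IHk binS natrD addrC.
Qed.

Definition diffp (q : {poly F}) := q \Po ('X + 1) - q.

Lemma comp_coef (q : {poly F}) j :
  (q \Po ('X + 1))`_j = \sum_(i < size q) q`_i * 'C(i, j)%:R.
Proof.
rewrite comp_polyE coef_sum; apply: eq_bigr => i _.
by rewrite coefZ coef_XaddCn.
Qed.

(** The coefficient of X^k in the difference of X^(k+1) is k + 1, which is
    nonzero in F. *)
Lemma size_diffp (q : {poly F}) k : (k.+1 < p)%N -> size q = k.+2 -> size (diffp q) = k.+1.
Proof.
move=> lt_kp sz; have q_lead : q`_k.+1 != 0.
  by have := lead_coef_eq0 q; rewrite lead_coefE sz /= -size_poly_eq0 sz => ->.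
apply/eqP; rewrite eqn_leq; apply/andP; split.
  apply/leq_sizeP => j le_j; rewrite coefB comp_coef sz big_ord_recr /=.
  rewrite big1 => [|i _]; last first.
    by rewrite bin_small ?mulr0 //; apply: leq_trans le_j; rewrite ltn_ord.
  move: le_j; rewrite leq_eqVlt => /orP[/eqP<-|lt_j].
    by rewrite binn mulr1 add0r subrr.
  by rewrite bin_small // mulr0 add0r [q`_j]nth_default ?subrr // sz.
rewrite ltnNge; apply/negP => /leq_sizeP/(_ k (leqnn k)).
rewrite coefB comp_coef sz !big_ord_recr /= big1 => [|i _]; last first.
  by rewrite bin_small ?mulr0.
rewrite binn mulr1 add0r binSn addrAC subrr add0r => /eqP.
by rewrite mulf_eq0 (negPf q_lead) -(dvdn_pcharf charF) /= gtnNdvd.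
Qed.

End Difference.

Section SimpleModules.

Variables (F : closedFieldType) (p : nat) (charF : p \in [pchar F]).
Local Notation GL2 := {'GL_2['F_p]}.
Local Notation rep := (representation F (SL2 p)).
Implicit Types (x y : GL2) (W X Y Q P M : rep).
Local Notation Vm := (V_mod charF).

Let p_prime : prime p := pcharf_prime charF.

Lemma V_mx_mul t (v : 'rV_t) x :
  rVpoly (v *m V_mx F t x) = \sum_i v 0 i *: (img_x F x ^+ i * img_y F x ^+ (t.-1 - i)).
Proof. by rewrite rVpoly_mul; apply: eq_bigr => i _; rewrite V_mx_row. Qed.

Lemma La_ug : img_x F (unip p) = 'X + 1.
Proof.
by rewrite /img_x /entry (mkGL00 (det_ug p)) (mkGL01 (det_ug p)) !Fp_emb1 scale1r.
Qed.

Lemma Lb_ug : img_y F (unip p) = 1.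
Proof.
by rewrite /img_y /entry (mkGL10 (det_ug p)) (mkGL11 (det_ug p)) Fp_emb1 Fp_emb0 scale0r add0r.
Qed.

Lemma Lb_wg : img_y F (weyl p) = - 'X.
Proof.
rewrite /img_y /entry (mkGL10 (det_wg p)) (mkGL11 (det_wg p)) Fp_emb0 addr0.
rewrite -scaleN1r; congr (_ *: _).
apply/eqP; rewrite -addr_eq0 -(Fp_emb1 F p) -(Fp_embD charF) addNr.
by rewrite Fp_emb0.
Qed.

Lemma V_mx_ug t (v : 'rV_t) : rVpoly (v *m V_mx F t (unip p)) = rVpoly v \Po ('X + 1).
Proof.
rewrite V_mx_mul La_ug Lb_ug rVpoly_sum linear_sum; apply: eq_bigr => i _ /=.
by rewrite expr1n mulr1 comp_polyZ rmorphXn /= comp_polyX.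
Qed.

Lemma V_ug_diff t (v : 'rV_t) : rVpoly (v *m (V_mx F t (unip p) - 1%:M)) = diffp (rVpoly v).
Proof. by rewrite mulmxBr mulmx1 linearB /= V_mx_ug. Qed.

(** The map [unip - 1] acts as the difference operator, which lowers the degree
    by exactly one; so a submodule with an element of degree k contains
    polynomials of all degrees up to k, hence everything of degree at most k. *)
Lemma V_submod_low t (U : 'M_t) (q r : {poly F}) k : (t <= p)%N -> (k < t)%N ->
  mxmodule (Vm t) U -> size q = k.+1 -> (poly_rV q <= U)%MS ->
  (size r <= k.+1)%N -> (poly_rV r <= U)%MS.
Proof.
move=> le_tp lt_kt modU; elim: k lt_kt q r => [|k IHk] lt_kt q r szq Uq szr.
  have [c nzc eq] := size_poly1P _ (introT eqP szq).
  have er := size1_polyC szr; have -> : poly_rV r = (r`_0 / c) *: poly_rV q :> 'rV[F]_t.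
    by rewrite -linearZ /= eq -mul_polyC -polyCM divfK // -er.
  by rewrite scalemx_sub.
have lt_kp : (k.+1 < p)%N := leq_trans lt_kt le_tp.
have Udq : (poly_rV (diffp q) <= U)%MS.
  have -> : poly_rV (diffp q) = poly_rV q *m V_mx F t (unip p) - poly_rV q.
    apply: rVpoly_inj; rewrite poly_rV_K; last by rewrite (size_diffp charF lt_kp szq) ltnW.
    by rewrite linearB /= V_mx_ug !poly_rV_K // szq.
  rewrite addmx_sub // ?eqmx_opp //.
  by apply: submx_trans (submxMr _ Uq) (mxmoduleP modU _ (ug_SL2 p)).
have IH := IHk (ltnW lt_kt) _ _ (size_diffp charF lt_kp szq) Udq.
have q_lead : q`_k.+1 != 0.
  by have := lead_coef_eq0 q; rewrite lead_coefE szq /= -size_poly_eq0 szq => ->.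
rewrite -[r](subrK ((r`_k.+1 / q`_k.+1) *: q)) linearD /= addmx_sub //.
  apply: IH; apply/leq_sizeP => j; rewrite leq_eqVlt => /orP[/eqP<-|lt_j].
    by rewrite coefB coefZ divfK ?subrr.
  rewrite coefB coefZ [q`_j]nth_default ?szq // [r`_j]nth_default ?(leq_trans szr) //.
    by rewrite mulr0 subrr.
by rewrite linearZ /= scalemx_sub.
Qed.

(** By [V_submod_low] a nonzero submodule contains 1, the vector y^(t-1).  The
    Weyl element takes it to X^(t-1) up to sign, and [V_submod_low] applied to
    that vector gives the whole space. *)
Lemma V_irr t : (1 <= t <= p)%N -> mx_irreducible (Vm t).
Proof.
case: t => // t /= le_tp; apply/mx_irrP; split=> // U modU nzU.
have [v Uv nzv] : exists2 v : 'rV_t.+1, (v <= U)%MS & v != 0.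
  by have /rowV0Pn[v] := nzU; exists v.
have := size_poly t.+1 (fun k => if insub k is Some i then v 0 i else 0).
rewrite -/(rVpoly v); set q := rVpoly v; case sz: (size q) => [|k] le_k.
  by case/eqP: nzv; apply: rVpoly_inj; rewrite linear0; apply/eqP; rewrite -size_poly_eq0 sz.
have Uq : (poly_rV q <= U)%MS by rewrite rVpolyK.
have U1 : (poly_rV 1 <= U)%MS.
  by apply: V_submod_low le_tp le_k modU sz Uq _; rewrite size_poly1.
have Uw : (poly_rV ('X^t) <= U)%MS.
  have -> : poly_rV ('X^t) = (-1) ^+ t *: (poly_rV 1 *m V_mx F t.+1 (weyl p)) :> 'rV[F]_t.+1.
    apply: rVpoly_inj; rewrite poly_rV_K ?size_polyXn // linearZ /=.
    have -> : poly_rV 1 = delta_mx 0 0 :> 'rV[F]_t.+1.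
      by rewrite -(rVpolyK (delta_mx 0 0)) rVpoly_delta expr0.
    rewrite -rowE V_mx_row expr0 mul1r subn0 Lb_wg -scaleN1r exprZn scalerA.
    by rewrite -exprMn mulrNN mulr1 expr1n scale1r.
  rewrite scalemx_sub //.
  by apply: submx_trans (submxMr _ U1) (mxmoduleP modU _ (wg_SL2 p)).
rewrite -sub1mx; apply/row_subP=> i; rewrite -[row i _]rVpolyK.
apply: V_submod_low le_tp (ltnSn t) modU (size_polyXn _ t) Uw _.
exact: size_poly.
Qed.

(** In degrees below p only the constants are invariant under X -> X + 1. *)
Lemma V_rank_ug : (p.-1 <= \rank (V_mx F p (unip p) - 1%:M)%R)%N.
Proof.
have p_gt0 := prime_gt0 p_prime.
set N := _ - _; have := mxrank_ker N; rewrite -subn1 leq_subLR.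
suffices : (\rank (kermx N) <= 1)%N.
  move=> rk; rewrite -[p in (p <= _)%N](subnKC (rank_leq_row N)) addnC -mxrank_ker.
  by rewrite leq_add2r.
have sKe : (kermx N <= (delta_mx 0 (Ordinal p_gt0) : 'rV[F]_p))%MS.
  apply/rV_subP=> v /sub_kermxP v0.
  have := V_ug_diff v; rewrite v0 linear0 => /esym dv.
  have szv : (size (rVpoly v) <= 1)%N.
    have := size_poly p (fun k => if insub k is Some i then v 0 i else 0).
    rewrite -/(rVpoly v); case sz: (size (rVpoly v)) => [|[|k]] // lt_k.
    by have := size_diffp charF lt_k sz; rewrite dv size_poly0.
  have -> : v = (rVpoly v)`_0 *: delta_mx 0 (Ordinal p_gt0).
    apply: rVpoly_inj; rewrite linearZ /= rVpoly_delta expr0.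
    by rewrite {1}(size1_polyC szv) alg_polyC.
  exact: scalemx_sub.
apply: leq_trans (mxrankS sKe) _; exact: rank_leq_row.
Qed.

(** Combine [cyc_higman] on U with the index of U being prime to p. *)
Lemma higman_from_U (G : {group GL2}) (W : representation F G)
    (sUG : <[unip p]> \subset G) : G \subset SL2 p -> rdegree W = p ->
  (p.-1 <= \rank (W (unip p) - 1%:M)%R)%N -> higman W.
Proof.
move=> sG degW rk.
have charu : #[unip p] \in [pchar F] by rewrite order_ug.
have [] := @cyc_higman F _ (unip p) charu (res_grepr sUG W).
- by rewrite order_ug.
- by rewrite order_ug.
move=> phi trphi; apply: (@higman_index F _ G <[unip p]>%G sUG W phi) => //.
exact: (index_nz charF (subxx _) sUG sG).
Qed.

Lemma Vp_higman : higman (Vm p).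
Proof.
apply: (higman_from_U (subset_trans (U_sub_B p) (borel_sub p))) => //.
exact: V_rank_ug.
Qed.

End SimpleModules.

(** * Uniserial modules of dimension p over B *)

Section Torus.

Variable p : nat.
Hypothesis p_prime : prime p.
Local Notation GL2 := {'GL_2['F_p]}.
Implicit Types x y : GL2.

Definition torus_set : {set GL2} := 
  [set x in SL2 p | (GLval x 1 0 == 0) && (GLval x 0 1 == 0)].

Lemma memT x : reflect [/\ x \in SL2 p, GLval x 1 0 = 0 & GLval x 0 1 = 0] (x \in torus_set).
Proof.
apply: (iffP setIdP) => [[Gx /andP[/eqP x10 /eqP x01]]|[Gx x10 x01]] //.
by rewrite x10 x01 eqxx.
Qed.

Lemma torus_group_set : group_set torus_set.
Proof.
apply/group_setP; split=> [|x y].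
  by apply/memT; rewrite group1 GL_1E !mxE.
move=> /memT[Gx x10 x01] /memT[Gy y10 y01]; apply/memT.
by rewrite groupM // !GL2M x10 x01 y10 y01 !mulr0 !mul0r !addr0.
Qed.

Definition torus : {group GL2} := Group torus_group_set.

Lemma torus_sub : torus \subset borel p.
Proof. by apply/subsetP=> x /memT[Gx x10 _]; rewrite memB Gx x10 eqxx. Qed.

Lemma torus_abelian : abelian torus.
Proof.
apply/centsP=> x /memT[_ x10 x01] y /memT[_ y10 y01]; apply: GL2P;
by rewrite !GL2M ?x10 ?x01 ?y10 ?y01 ?mulr0 ?mul0r ?addr0 ?add0r // mulrC.
Qed.

Lemma torusX x k : x \in torus -> GLval (x ^+ k)%g 0 0 = GLval x 0 0 ^+ k.
Proof.
move=> Tx; elim: k => [|k IHk]; first by rewrite expg0 GL_1E mxE.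
have /memT[_ x10 x01] := Tx.
by rewrite expgSr GL2M IHk x10 mulr0 addr0 exprSr.
Qed.

Lemma FpX (a : 'F_p) : a ^+ p = a.
Proof.
by have := pFrobenius_aut_nat (pchar_Fp p_prime) a; rewrite pFrobenius_autE natr_Zp.
Qed.

Lemma torus_p' : p^'.-group torus.
Proof.
rewrite /pgroup p'natE ?cardG_gt0 //; apply/negP => /(Cauchy p_prime)[x Tx ox].
have := expg_order x; rewrite ox => xp.
have x00 : GLval x 0 0 = 1 by rewrite -[LHS]FpX -torusX // xp GL_1E mxE.
have /memT[Gx x10 x01] := Tx.
have x11 : GLval x 1 1 = 1.
  by have := SL2_det Gx; rewrite x00 x01 mul1r mul0r subr0.
have x1 : x = 1%g by apply: GL2P; rewrite ?x00 ?x01 ?x10 ?x11 GL_1E mxE.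
by move: ox p_prime; rewrite x1 order1 => <-.
Qed.

Lemma U_normal : <[unip p]> <| borel p.
Proof.
rewrite /normal U_sub_B /=; apply/normsP=> x Bx.
have /andP[Gx /eqP x10] : (x \in SL2 p) && (GLval x 1 0 == 0) by rewrite -memB.
apply/eqP; rewrite eqEcard cardJg leqnn andbT; apply/subsetP=> _ /imsetP[y Uy ->].
have [Gy y00 y10 y11] := memUP Uy; have [v00 v01 v10 v11] := SL2V Gx.
have := SL2_det Gx; rewrite x10 mulr0 subr0 => dx.
apply: memU; first by rewrite groupJ.
  rewrite conjgE !GL2M v00 v01 x10 y00 y10.
  by rewrite mul1r !mulr0 mul0r !addr0 mulr0 addr0 mulrC.
by rewrite conjgE !GL2M v10 v11 x10 y10 oppr0 !mulr0 !mul0r !addr0 ?mulr0 ?add0r ?addr0.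
Qed.

Lemma borel_UT x : x \in borel p -> exists u t, [/\ u \in <[unip p]>, t \in torus & x = (u * t)%g].
Proof.
rewrite memB => /andP[Gx /eqP x10]; have := SL2_det Gx; rewrite x10 mulr0 subr0 => dx.
have dt : GLval x 0 0 * GLval x 1 1 - 0 * 0 = 1 by rewrite dx mulr0 subr0.
pose t := mkGL (GLval x 0 0) 0 0 (GLval x 1 1).
have Gt : t \in SL2 p by exact: mkGL_SL2 dt.
have [v00 v01 v10 v11] := SL2V Gt.
exists (x * t^-1)%g, t; split; last by rewrite mulgKV.
  apply: memU; first by rewrite groupM ?groupV.
    by rewrite GL2M v00 v10 (mkGL11 dt) (mkGL10 dt) oppr0 mulr0 addr0.
  by rewrite GL2M v00 v10 x10 (mkGL10 dt) oppr0 mulr0 mul0r addr0.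
by apply/memT; rewrite Gt (mkGL10 dt) (mkGL01 dt).
Qed.

End Torus.

Section Uniserial.

Variables (F : closedFieldType) (p : nat) (charF : p \in [pchar F]).
Implicit Types W : representation F (borel p).

Let p_prime : prime p := pcharf_prime charF.

(** On the U-fixed vectors, B acts through the diagonal torus, which is abelian of
    order prime to p; so by Maschke's theorem a fixed space of dimension at least
    2 would be a direct sum of two nonzero submodules, and these would not be
    comparable. *)
Lemma uniserial_rfix W : uniserial W -> (\rank (rfix_mx W <[unip p]>) <= 1)%N.
Proof.
move=> uniW; set K := rfix_mx _ _.
have modK : mxmodule W K by apply: normal_rfix_mx_module (U_normal p).
pose WT := subg_repr W (torus_sub p).
have modTK : mxmodule WT K by apply: mxmodule_subg.
have [->|nzK] := eqVneq K 0; first by rewrite mxrank0.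
(* Any torus submodule of the U-fixed vectors is a B-submodule. *)
have liftmod (L : 'M_(rdegree W)) : (L <= K)%MS -> mxmodule WT L -> mxmodule W L.
  move=> sLK modL; apply/mxmoduleP=> x /borel_UT[u [t [Uu Tt ->]]].
  have Bu := subsetP (U_sub_B p) u Uu; have Bt := subsetP (torus_sub p) t Tt.
  rewrite repr_mxM // mulmxA; move/rfix_mxP: sLK => -> //.
  exact: (mxmoduleP modL).
have redK : mx_completely_reducible WT K.
  apply: mx_reducibleS modTK (submx1 _) _; apply: mx_Maschke_pchar.
  apply: sub_in_pnat (torus_p' p_prime) => q _; rewrite !inE; apply: contra => q_F.
  have : q \in [pchar F] := q_F.
  by rewrite (pcharf_eq charF).
apply: (mxsimple_exists modTK nzK) => -[L simL sLK].
have [modL nzL _] := simL.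
have [L' modL' defK dxL] := redK L modL sLK.
have dLL : (L :&: L' = 0)%MS by apply/mxdirect_addsP.
have sL'K : (L' <= K)%MS by rewrite -defK addsmxSr.
have [sub|sub] := orP (uniW L L' (liftmod _ sLK modL) (liftmod _ sL'K modL')).
  by case/eqP: nzL; apply/eqP; rewrite -submx0 -dLL sub_capmx submx_refl.
have L'0 : L' = 0.
  by apply/eqP; rewrite -submx0 -dLL sub_capmx submx_refl andbT.
rewrite -defK L'0 addsmx0.
by rewrite (mxsimple_abelian_linear _ (torus_abelian p) simL) //; apply: group_closure_closed_field.
Qed.

(** By [uniserial_rfix] the kernel of [unip - 1] has dimension at most 1. *)
Lemma uniserial_higman W : uniserial W -> rdegree W = p -> higman W.
Proof.
move=> uniW degW; apply: (higman_from_U charF (U_sub_B p)) => //.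
  exact: borel_sub.
set N := _ - _.
have kerN : (\rank (kermx N) <= 1)%N.
  apply: leq_trans (uniserial_rfix uniW); apply: mxrankS; apply/rfix_mxP=> x /cycleP[k ->].
  have kN : kermx N *m W (unip p) = kermx N.
    by apply/eqP; rewrite -subr_eq0 -[X in _ - X]mulmx1 -mulmxBr mulmx_ker.
  have Bu : unip p \in borel p by rewrite (subsetP (U_sub_B p)) // cycle_id.
  elim: k => [|k IHk]; first by rewrite expg0 repr_mx1 mulmx1.
  by rewrite expgSr repr_mxM ?groupX // mulmxA IHk kN.
rewrite -subn1 leq_subLR; apply: leq_trans (eq_leq (esym degW)) _.
by rewrite addnC -leq_subLR -mxrank_ker.
Qed.

End Uniserial.

(** * Projective modules without a quotient V_t *)

Section Decomposition.

Variables (F : closedFieldType) (p : nat) (charF : p \in [pchar F]).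
Local Notation GL2 := {'GL_2['F_p]}.
Local Notation rep := (representation F (SL2 p)).
Implicit Types (x y : GL2) (W X Y Q M : rep).
Local Notation Vm := (V_mod charF).
Local Notation tensV2 := (tensV2 charF).

Let p_prime : prime p := pcharf_prime charF.

(** The case s = 0 concerns the zero module V_0.  It is included so that the
    exact sequences apply uniformly. *)
Definition no_V_quotient Q := higman Q /\ forall s, (s <= p)%N -> hdim Q (Vm s) = 0%N.

Lemma killed_T2 Q : no_V_quotient Q -> no_V_quotient (tensV2 Q).
Proof.
move=> [hQ kQ]; have projQ := higman_proj hQ; have p_gt1 := prime_gt1 p_prime.
split=> [|[|s] le_s]; [exact: T2_higman | exact: hdim0r | ].
rewrite T2_adjunction (hdim_T2_V charF) // kQ ?add0n; last exact: ltnW.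
move: le_s; rewrite leq_eqVlt => /orP[/eqP sp|lt_s]; last exact: kQ.
by rewrite sp hdim_Vp1 // !kQ // leq_pred.
Qed.

Lemma V1_mx x : V_mx F 1 x = 1%:M.
Proof.
apply/row_matrixP=> i; apply: rVpoly_inj; rewrite V_mx_row row1 rVpoly_delta.
by rewrite ord1 /= !expr0 mulr1.
Qed.

(** The trivial module V_1 is not a quotient of Q, so traces of linear forms
    vanish. *)
Lemma killed_sum Q : no_V_quotient Q -> \sum_(x in SL2 p) Q x = 0.
Proof.
move=> [hQ kQ]; have k1 : hdim Q (Vm 1) = 0%N by rewrite kQ // prime_gt0.
have tr0' (phi : 'M_(rdegree Q, rdegree (Vm 1))) : gtrace (SL2 p) phi = 0.
  have : gtrace (SL2 p) phi \in hom_space Q (Vm 1) by apply/mem_homs/tr_hom.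
  by move/eqP: k1; rewrite /hdim dimv_eq0 => /eqP->; rewrite memv0 => /eqP.
have -> : \sum_(x in SL2 p) Q x = \sum_(x in SL2 p) Q x^-1%g.
  by rewrite [LHS](reindex_inj invg_inj); apply: eq_bigl => x; rewrite groupV.
apply/trmx_inj/row_matrixP=> j; rewrite !linear0 -tr_col; apply/trmx_inj.
rewrite trmxK linear0 colE -[RHS](tr0' (delta_mx j 0)) mulmx_suml.
by apply: eq_bigr => x _; rewrite /= V1_mx mulmx1.
Qed.

Definition ent_prod (s : seq ('I_2 * 'I_2 * F)) x : F :=
  \prod_(k <- s) (entry F x k.1.1 k.1.2 - k.2).

(** A factor [entry i j] is absorbed into Q by passing to Q (x) V_2, one of whose
    blocks is [entry i j] times Q. *)
Lemma killed_poly s Q : no_V_quotient Q -> \sum_(x in SL2 p) ent_prod s x *: Q x = 0.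
Proof.
elim: s Q => [|[[i j] c] s IHs] Q kQ.
  rewrite -[RHS](killed_sum kQ); apply: eq_bigr => x _.
  by rewrite /ent_prod big_nil scale1r.
(* Take the (i, j) block of the induction hypothesis for Q (x) V_2. *)
have T : \sum_(x in SL2 p) (ent_prod s x * entry F x i j) *: Q x = 0.
  have := IHs _ (killed_T2 kQ) => /= e.
  pose blk (A : 'M[F]_(rdegree Q + rdegree Q)) : 'M[F]_(rdegree Q) :=
    if i == 0 then (if j == 0 then ulsubmx A else ursubmx A)
    else (if j == 0 then dlsubmx A else drsubmx A).
  have blkD A B : blk (A + B) = blk A + blk B.
    by rewrite /blk /ulsubmx /ursubmx /dlsubmx /drsubmx;
      case: (i == 0); case: (j == 0); rewrite !linearD.
  have blk0 : blk 0 = 0.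
    by rewrite /blk /ulsubmx /ursubmx /dlsubmx /drsubmx;
      case: (i == 0); case: (j == 0); rewrite !linear0.
  have := congr1 blk e; rewrite blk0 (big_morph blk blkD blk0) => e0; rewrite -[RHS]e0.
  apply: eq_bigr => x _; rewrite -scalerA /T2_mx scale_block_mx /blk.
  by case: (ord2P i) => ->; case: (ord2P j) => ->;
    rewrite /= (block_mxKul, block_mxKur, block_mxKdl, block_mxKdr).
transitivity (\sum_(x in SL2 p) (ent_prod s x * entry F x i j) *: Q x
  - c *: \sum_(x in SL2 p) ent_prod s x *: Q x); last first.
  by rewrite T (IHs Q kQ) scaler0 subr0.
rewrite scaler_sumr -sumrB; apply: eq_bigr => x _.
rewrite /ent_prod big_cons /= scalerA -scalerBl mulrBl; congr ((_ - _) *: _).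
exact: mulrC.
Qed.

Lemma Fp_emb_inj : injective (@Fp_emb F p).
Proof.
move=> a b ab; have : Fp_emb F (a - b) = 0.
  apply/eqP; rewrite -(inj_eq (addIr (Fp_emb F b))) -(Fp_embD charF) subrK add0r.
  exact/eqP.
rewrite /Fp_emb => /eqP; rewrite -(dvdn_pcharf charF).
have lt : ((a - b)%R < p)%N.
  by apply: leq_trans (ltn_ord (a - b)) _; rewrite (Fp_cast p_prime).
rewrite /dvdn modn_small // => /eqP ab0; apply/eqP; rewrite -subr_eq0; apply/eqP.
exact: val_inj.
Qed.

(** Apply [killed_poly] to the product of all factors [entry i j - c] with [c]
    in the prime field and different from the entry of the identity matrix.  It
    vanishes away from the identity matrix, and not at it. *)
Lemma killed0 Q : no_V_quotient Q -> rdegree Q = 0%N.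
Proof.
move=> kQ.
pose s := [seq (k.1, Fp_emb F k.2) | k <- enum {: 'I_2 * 'I_2 * 'F_p}
  & k.2 != (k.1.1 == k.1.2)%:R].
have := killed_poly s kQ; rewrite (bigD1 1%g (group1 _)) big1 => [|x /andP[Gx x1]]; last first.
  suffices -> : ent_prod s x = 0 by rewrite scale0r.
  have [[i j] nij] : exists k : 'I_2 * 'I_2, GLval x k.1 k.2 != (k.1 == k.2)%:R.
    apply/existsP; apply: contraR x1; rewrite negb_exists => /forallP all1.
    have e i j : GLval x i j = (i == j)%:R.
      by have := all1 (i, j); rewrite negbK => /eqP.
    by apply/eqP/GL2P; rewrite e GL_1E mxE.
  apply/eqP; rewrite prodf_seq_eq0; apply/hasP.
  exists (i, j, Fp_emb F (GLval x i j)); last by rewrite /= subrr.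
  by apply/mapP; exists (i, j, GLval x i j) => //; rewrite mem_filter /= nij mem_enum.
rewrite /= addr0 (repr_mx1 Q) => /eqP; rewrite scaler_eq0 => /orP[|/eqP one0].
  rewrite prodf_seq_eq0 => /hasP[k /mapP[[[i j] a] Ka ->]] /=.
  move: Ka; rewrite mem_filter /= => /andP[ne _].
  rewrite ent1 subr_eq0 => /eqP e; case/eqP: ne; apply: Fp_emb_inj; rewrite /= -e.
  by case: (i == j).
apply/eqP; rewrite -leqn0 leqNgt; apply/negP => pos.
have /matrixP/(_ (Ordinal pos) (Ordinal pos)) := one0.
by rewrite !mxE eqxx => /eqP; rewrite oner_eq0.
Qed.

End Decomposition.

(** * Projective modules of SL_2(p) and the Cartan matrix *)

Section Projectives.

Variables (F : closedFieldType) (p : nat) (charF : p \in [pchar F]).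
Local Notation rep := (representation F (SL2 p)).
Implicit Types (W X Y Q M : rep).
Local Notation Vm := (V_mod charF).
Local Notation tensV2 := (tensV2 charF).

Variable P : nat -> rep.
Hypothesis coverP : forall t, (1 <= t <= p)%N -> is_projective_cover (P t) (Vm t).

Let p_prime : prime p := pcharf_prime charF.

Definition Psum (m : nat -> nat) : rep :=
  \big[dadd_grepr/grepr0]_(1 <= i < p.+1) muln_grepr (P i) (m i).

Lemma P_higman t : (1 <= t <= p)%N -> higman (P t).
Proof. by move/coverP=> [/proj_higman]. Qed.

Lemma hdim_P_V t s : (1 <= t <= p)%N -> (1 <= s <= p)%N ->
  hdim (P t) (Vm s) = (t == s).
Proof.
move=> ht hs; have [<-|ne_ts] := eqVneq t s.
  by apply: cover_self (coverP ht) (V_irr charF ht).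
rewrite (cover_neq (coverP ht) (V_irr charF ht) (V_irr charF hs)) //.
by move=> /mxrank_rsim /= e; rewrite e eqxx in ne_ts.
Qed.

(** By [killed0] a nonzero projective module maps onto some V_s, so P_s splits
    off; induct on the degree. *)
Lemma proj_decomposition Q : higman Q -> exists m, mx_rsim Q (Psum m).
Proof.
have [k] := ubnP (rdegree Q); elim: k Q => // k IHk Q le_Qk hQ.
have projQ := higman_proj hQ.
have [Q0|pos_Q] := posnP (rdegree Q).
  exists (fun=> 0%N); apply: rsim_degree0 => //; rewrite rdegree_big big1 // => i _.
  by rewrite rdegree_big big_ord0.
have [s hs] : exists2 s : 'I_p.+1, (0 < s)%N & (0 < hdim Q (Vm s))%N.
  apply/exists_inP; apply: contraLR pos_Q => /exists_inP none.
  rewrite -eqn0Ngt; apply/eqP/(killed0 (charF := charF)); split=> // -[|s] le_s.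
    exact: hdim0r.
  apply/eqP; rewrite eqn0Ngt; apply/negP => pos_s; case: none.
  by exists (Ordinal (le_s : (s.+1 < p.+1)%N)).
case/hdim_gt0=> f hf nzf.
have hsp : (1 <= s <= p)%N by rewrite hs -ltnS ltn_ord.
have full_f := irr_hom_full (V_irr charF hsp) hf nzf.
have [Q' hQ' rsQ] := cover_split (coverP hsp) projQ hf full_f.
have pos_P : (0 < rdegree (P s))%N.
  rewrite lt0n; apply/eqP=> P0; have := hdim0l (Vm s) P0.
  by rewrite hdim_P_V // eqxx.
have [|m rsm] := IHk Q' _ hQ'.
  have dQ : rdegree Q = (rdegree (P s) + rdegree Q')%N := mxrank_rsim rsQ.
  by lia.
exists (fun i => m i + (i == s))%N; apply: mx_rsim_trans rsQ _.
apply: mx_rsim_trans (rsim_dadd (mx_rsim_refl _) rsm) _.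
apply: (@rsim_big_pick _ _ _ nat _ _ _ (P s) s) => [||| i /negPf ne_is].
- exact: iota_uniq.
- by rewrite mem_index_iota ltnS.
- by rewrite eqxx addn1 /muln_grepr big_ord_recl; apply: mx_rsim_refl.
by rewrite ne_is addn0.
Qed.

Lemma hdim_Psum m W : hdim (Psum m) W = (\sum_(1 <= i < p.+1) m i * hdim (P i) W)%N.
Proof. by rewrite hdim_bigl; apply: eq_bigr => i _; rewrite hdim_mulnl. Qed.

Lemma hdim_Psum_V m s : (1 <= s <= p)%N -> hdim (Psum m) (Vm s) = m s.
Proof.
move=> hs; rewrite hdim_Psum (bigD1_seq s) ?iota_uniq ?mem_index_iota ?ltnS //=.
rewrite hdim_P_V // eqxx muln1 big_nat_cond big1 ?addn0 // => i /andP[hi /negPf ne_is].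
by rewrite hdim_P_V // ne_is muln0.
Qed.

(** Evaluate on the decomposition of Q, whose multiplicities are given by
    [hdim_Psum_V]. *)
Lemma hdim_expand Q W : higman Q ->
  hdim Q W = (\sum_(1 <= i < p.+1) hdim Q (Vm i) * hdim (P i) W)%N.
Proof.
move=> /proj_decomposition[m rs]; rewrite (hdim_rsiml _ rs) hdim_Psum.
apply: eq_big_nat => i hi; congr (_ * _)%N.
by rewrite (hdim_rsiml _ rs) hdim_Psum_V // -ltnS.
Qed.

Lemma Pp_Vp : mx_rsim (P p) (Vm p).
Proof.
have hp : (1 <= p <= p)%N by rewrite prime_gt0 /=.
exact: cover_simple_proj (coverP hp) (higman_proj (Vp_higman charF)).
Qed.

(** V_p is projective, simple and injective, so that it splits off any module it
    maps to. *)
Lemma Steinberg_retract X : (0 < hdim (P p) X)%N ->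
  exists (i : 'M_(rdegree (Vm p), rdegree X)) (r : 'M_(rdegree X, rdegree (Vm p))),
    [/\ is_hom i, is_hom r & i *m r = 1%:M].
Proof.
have hp : (1 <= p <= p)%N by rewrite prime_gt0 /=.
rewrite (hdim_rsiml _ Pp_Vp) => /hdim_gt0[f hf nzf].
have free_f := irr_hom_free (V_irr charF hp) hf nzf.
have [r [hr fr]] := higman_inj (Vp_higman charF) hf free_f.
by exists f, r.
Qed.

(** Both sides count the copies of P_p = V_p in Q.  No other P_i receives a
    nonzero map from V_p, as V_p would be a summand, and so a quotient, of it. *)
Lemma hdim_Pp Q : higman Q -> hdim (P p) Q = hdim Q (Vm p).
Proof.
have hp : (1 <= p <= p)%N by rewrite prime_gt0 /=.
have projPp : projective (P p) by case: (coverP hp).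
move=> /proj_decomposition[m rs]; rewrite (hdim_rsiml _ rs) (hdim_rsimr _ rs) hdim_Psum_V //.
rewrite hdim_bigr // (eq_bigr (fun i => m i * hdim (P p) (P i))%N) => [|i _]; last first.
  by rewrite hdim_mulnr.
rewrite (bigD1_seq p) ?iota_uniq ?mem_index_iota ?ltnS //=.
rewrite big_nat_cond big1 => [|i /andP[hi /negPf ne_ip]].
  by rewrite (hdim_rsimr _ Pp_Vp) hdim_P_V // eqxx muln1 addn0.
apply/eqP; rewrite muln_eq0 orbC eqn0Ngt; apply/orP; left; apply/negP => /Steinberg_retract.
case=> f [r [hf hr fr]]; have := hdim_P_V hi hp; rewrite ne_ip => /eqP.
rewrite /hdim dimv_eq0 => /eqP h0.
have : r \in hom_space (P i) (Vm p) by apply/mem_homs.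
rewrite h0 memv0 => /eqP r0; move: fr; rewrite r0 mulmx0 => /esym/eqP.
by rewrite -mxrank_eq0 mxrank1 eqn0Ngt prime_gt0.
Qed.

Lemma hdim_T2_low Q s : higman Q ->
  hdim (tensV2 Q) (Vm s.+1) = (hdim Q (Vm s) + hdim Q (Vm s.+2))%N.
Proof. by move=> hQ; rewrite T2_adjunction hdim_T2_V //; apply: higman_proj. Qed.

Lemma hdim_T2_top Q : higman Q ->
  hdim (tensV2 Q) (Vm p) = (hdim Q (Vm p.-1) + (hdim Q (Vm 2) + hdim Q (Vm p.-1)))%N.
Proof.
move=> hQ; have projQ := higman_proj hQ.
have ep : p.-1.+1 = p by rewrite prednK ?prime_gt0.
by have := hdim_T2_low p.-1 hQ; rewrite ep => ->; rewrite hdim_Vp1.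
Qed.

(** As Hom(P_t, Q (x) V_2) = Hom(P_t (x) V_2, Q), this needs only the
    multiplicity of each P_s in P_t (x) V_2, which is dim Hom(P_t, V_s (x) V_2). *)
Lemma hdim_P_T2 Q t : higman Q -> (1 <= t <= p)%N ->
  hdim (P t) (tensV2 Q) =
  (\sum_(1 <= s < p) ((t == s.-1) + (t == s.+1)) * hdim (P s) Q
   + ((t == p.-1) + ((t == 2) + (t == p.-1))) * hdim (P p) Q)%N.
Proof.
move=> hQ ht; have p_gt0 := prime_gt0 p_prime; have p_gt1 := prime_gt1 p_prime.
have hP := P_higman ht; have hT := T2_higman charF hP.
rewrite -T2_adjunction (hdim_expand _ hT) big_nat_recr //=; congr (_ + _ * _)%N.
  apply: eq_big_nat => s /andP[s_gt0 lt_sp]; congr (_ * _)%N.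
  case: s s_gt0 lt_sp => // s _ lt_sp; rewrite hdim_T2_low // [X in (_ + X)%N](hdim_P_V ht) //.
  congr (_ + _)%N; case: s lt_sp => [|s] lt_sp; last by apply: hdim_P_V => //; lia.
  by rewrite hdim0r // eqn0Ngt; case/andP: ht => ->.
by rewrite hdim_T2_top // !(hdim_P_V ht) //; lia.
Qed.

Lemma sum_neighbours (f : nat -> nat) t : (1 <= t <= p)%N ->
  (\sum_(1 <= s < p) ((t == s.-1) + (t == s.+1)) * f s =
   (if (t.+1 < p)%N then f t.+1 else 0) + (if (1 < t)%N then f t.-1 else 0))%N.
Proof.
move=> ht; have p_gt0 := prime_gt0 p_prime.
under eq_bigr => s _ do rewrite mulnDl.
rewrite big_split /=; congr (_ + _)%N.
  case: ifP => lt_tp.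
    rewrite (bigD1_seq t.+1) ?iota_uniq ?mem_index_iota //= eqxx mul1n.
    rewrite big_nat_cond big1 ?addn0 // => s /andP[hs ne].
    by rewrite (_ : t == s.-1 = false) ?mul0n //; apply/eqP; lia.
  rewrite big_nat_cond big1 // => s /andP[hs _].
  by rewrite (_ : t == s.-1 = false) ?mul0n //; apply/eqP; lia.
case: ifP => lt_1t.
  rewrite (bigD1_seq t.-1) ?iota_uniq ?mem_index_iota //=; last by lia.
  rewrite prednK ?(ltnW lt_1t) // eqxx mul1n.
  rewrite big_nat_cond big1 ?addn0 // => s /andP[hs ne].
  by rewrite (_ : t == s.+1 = false) ?mul0n //; apply/eqP; lia.
rewrite big_nat_cond big1 // => s /andP[hs _].
by rewrite (_ : t == s.+1 = false) ?mul0n //; apply/eqP; lia.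
Qed.

Hypothesis p_odd : odd p.

(** Downward induction on t, for all Q at once.  Comparing the value of
    dim Hom(P_(t+1), Q (x) V_2) given by [hdim_P_T2] with the one given by the
    induction hypothesis for Q (x) V_2 determines dim Hom(P_t, Q).  The term with
    [t == 1] accounts for V_p, which lies in a block of its own and is not
    linked to V_1. *)
Lemma cartan Q t : higman Q -> (1 <= t < p)%N ->
  (hdim (P t) Q + (t == 1) * hdim Q (Vm p) =
   2 * hdim Q (Vm t) + hdim Q (Vm (p.-1 - t)) + hdim Q (Vm (p.+1 - t)))%N.
Proof.
move=> hQ ht; have p_gt1 := prime_gt1 p_prime.
have p_gt2 : (2 < p)%N by case: p p_gt1 p_odd => [|[|[|]]].
(* The recursion descends from t = p - 1 and has two base cases. *)
have [k ek] : exists k, t = (p.-1 - k)%N by exists (p.-1 - t)%N; lia.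
elim/ltn_ind: k t ek ht Q hQ => k IHk t ek ht Q hQ.
have hTQ := T2_higman charF hQ.
have rec s (hs : (1 <= s <= p)%N) := hdim_P_T2 hQ hs.
case: k ek IHk => [|[|k]] ek IHk.
- have tp : t = p.-1 by lia.
  have hp : (1 <= p <= p)%N by lia.
  have := rec p hp; rewrite (sum_neighbours _ hp) (hdim_Pp hTQ) (hdim_T2_top hQ).
  have -> : (p == p.-1) = false by apply/eqP; lia.
  have -> : (p == 2) = false by apply/eqP; lia.
  have -> : (p.+1 < p)%N = false by lia.
  have -> : (t == 1) = false by apply/eqP; lia.
  have -> : (p.-1 - t = 0)%N by lia.
  have -> : (p.+1 - t = 2)%N by lia.
  rewrite p_gt1 -tp.
  rewrite (@hdim0r _ _ _ Q (Vm 0)) //; lia.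
- have tp : p.-1 = t.+1 by lia.
  have ht1 : (1 <= t.+1 <= p)%N by lia.
  have := rec t.+1 ht1; rewrite (sum_neighbours _ ht1).
  have := IHk 0%N isT t.+1 _ _ (tensV2 Q) hTQ.
  have -> : (t.+1 = p.-1 - 0)%N by lia.
  move=> /(_ erefl); have -> : (p.-1 - 0 = t.+1)%N by lia.
  have ht1' : (0 < t.+1 < p)%N by lia.
  move=> /(_ ht1'); have -> : (p.-1 - t.+1 = 0)%N by lia.
  have -> : (p.+1 - t.+1 = 2)%N by lia.
  have -> : (p.-1 - t = 1)%N by lia.
  have -> : (p.+1 - t = 3)%N by lia.
  rewrite tp !(hdim_T2_low _ hQ) (@hdim0r _ _ _ (tensV2 Q) (Vm 0)) // (hdim_Pp hQ) eqxx.
  have -> : (t.+2 < p)%N = false by lia.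
  have -> : (1 < t.+1)%N by lia.
  have -> : (t.+1 == 1) = false by apply/eqP; lia.
  have -> : t.+2 = p by lia.
  by rewrite eqSS /=; lia.
have ht1 : (1 <= t.+1 <= p)%N by lia.
have := rec t.+1 ht1; rewrite (sum_neighbours _ ht1) (hdim_Pp hQ).
have hk : (t.+1 = p.-1 - k.+1)%N by lia.
have ht1' : (0 < t.+1 < p)%N by lia.
have := IHk k.+1 (ltnSn _) t.+1 hk ht1' (tensV2 Q) hTQ.
have hk2 : (t.+2 = p.-1 - k)%N by lia.
have ht2' : (0 < t.+2 < p)%N by lia.
have := IHk k (ltnW (ltnSn _)) t.+2 hk2 ht2' Q hQ.
have -> : (p.-1 - t.+1 = k.+1)%N by lia.
have -> : (p.+1 - t.+1 = k.+3)%N by lia.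
have -> : (p.-1 - t.+2 = k)%N by lia.
have -> : (p.+1 - t.+2 = k.+2)%N by lia.
have -> : (p.-1 - t = k.+2)%N by lia.
have -> : (p.+1 - t = k.+4)%N by lia.
rewrite !(hdim_T2_low _ hQ).
have -> : (t.+2 < p)%N by lia.
have -> : (1 < t.+1)%N by lia.
have -> : (t.+1 == 1) = false by apply/eqP; lia.
have -> : (t.+2 == 1) = false by apply/eqP; lia.
have -> : (t.+1 == p.-1) = false by apply/eqP; lia.
by rewrite eqSS /=; lia.
Qed.

End Projectives.

(** * The matrix Gamma inverts the Cartan matrix *)

Section GammaInverse.

Lemma Gamma_minn p i j :
  Gamma p i j = (-1) ^+ (i + j) * ((minn i j)%:R - 2 * i%:R * j%:R / p%:R).
Proof. by rewrite /Gamma; case: leqP. Qed.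

Lemma Gamma0 p i : Gamma p i 0 = 0.
Proof. by rewrite Gamma_minn minn0 mulr0 mul0r subr0 mulr0. Qed.

(** Up to sign, [Gamma] is min(i, j) minus a term that is linear in j, and
    min(i, j) is concave in j with a unit bend at j = i. *)
Lemma Gamma_rec p i j : (0 < j)%N ->
  Gamma p i j.-1 + 2 * Gamma p i j + Gamma p i j.+1 = (i == j)%:R.
Proof.
case: j => // j _; rewrite !Gamma_minn /= !addnS !exprS !mulrA mulrN1 !mulNr.
set s := (-1) ^+ (i + j); rewrite -[j.+2%:R]natr1 -[j.+1%:R]natr1.
have second : 2 * (minn i j.+1)%:R - (minn i j)%:R - (minn i j.+2)%:R
      = (if i == j.+1 then 1 else 0) :> rat.
  have [->|ne_ij] := eqVneq i j.+1.
    have -> : minn j.+1 j = j by lia.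
    have -> : minn j.+1 j.+1 = j.+1 by lia.
    have -> : minn j.+1 j.+2 = j.+1 by lia.
    by rewrite -[j.+1%:R]natr1; ring.
  have [lt_ij|le_ji] := boolP (i < j.+1)%N.
  - have -> : minn i j = i by lia.
    have -> : minn i j.+1 = i by lia.
    have -> : minn i j.+2 = i by lia.
    by ring.
  - have -> : minn i j = j by lia.
    have -> : minn i j.+1 = j.+1 by lia.
    have -> : minn i j.+2 = j.+2 by lia.
    by rewrite -[j.+2%:R]natr1 -[j.+1%:R]natr1; ring.
transitivity (- s * (2 * (minn i j.+1)%:R - (minn i j)%:R - (minn i j.+2)%:R)).
  by ring.
rewrite second; have [ij|_] := eqVneq i j.+1; last by rewrite mulr0.
by rewrite /s ij addSn exprS mulN1r opprK addnn -mul2n exprM sqrrN !expr1n mulr1.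
Qed.

Section Solve.

Variables (p h : nat) (x e : nat -> rat).
Hypotheses (ph : p = h.*2.+1) (x0 : x 0%N = 0) (xh : x h.+1 = x h).
Hypothesis ex : forall j, (1 <= j <= h)%N -> e j = 2 * x j + x j.-1 + x j.+1.

(** Summation by parts: by [Gamma_rec] only boundary terms remain. *)
Lemma Gamma_partial_sum i N : (1 <= i)%N -> (N <= h)%N ->
  \sum_(1 <= j < N.+1) Gamma p i j * e j =
  (i <= N)%N%:R * x i + Gamma p i N * x N.+1 - Gamma p i N.+1 * x N.
Proof.
move=> i_gt0; elim: N => [|N IHN] le_N.
  by rewrite big_nil leqNgt i_gt0 Gamma0 x0 !mul0r mulr0 addr0 subr0.
rewrite big_nat_recr //= (IHN (ltnW le_N)) ex ?le_N //=.
have := Gamma_rec p i (ltn0Sn N) => /= rec.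
have -> : Gamma p i N.+2 = (i == N.+1)%:R - Gamma p i N - 2 * Gamma p i N.+1.
  by rewrite -rec; ring.
rewrite [(i <= N.+1)%N]leq_eqVlt ltnS.
have [->|_] := eqVneq i N.+1; first by rewrite ltnn /=; ring.
by case: (i <= N)%N; rewrite /=; ring.
Qed.

(** The boundary terms cancel since [Gamma] takes the same value at h and h + 1:
    the unsigned kernel is i / p at h and - i / p at h + 1. *)
Lemma Gamma_solve i : (1 <= i <= h)%N ->
  \sum_(1 <= j < h.+1) Gamma p i j * e j = x i.
Proof.
case/andP=> i_gt0 le_ih; rewrite Gamma_partial_sum // le_ih xh mul1r.
suffices -> : Gamma p i h.+1 = Gamma p i h by rewrite addrK.
have p_nz : p%:R != 0 :> rat by rewrite Num.Theory.pnatr_eq0 ph.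
rewrite !Gamma_minn addnS exprS.
have -> : minn i h.+1 = i by lia.
have -> : minn i h = i by lia.
have pr : p%:R = 2 * h%:R + 1 :> rat by rewrite ph -natr1 -mul2n natrM.
rewrite mulN1r mulNr -mulrN; congr (_ * _); rewrite -[h.+1%:R]natr1.
by move: p_nz; rewrite pr => p_nz; field.
Qed.

End Solve.

(** Vertex j of the path that contains V_1 is V_j for odd j and V_(p-j) for even
    j; on the other path the two parities are exchanged.  Both paths end at
    j = (p-1)/2, where the neighbour j + 1 is the vertex j itself. *)
Lemma n_proj_solve p (alpha m : nat -> rat) : odd p -> (1 < p)%N -> m 0%N = 0 ->
  (forall t, (1 <= t < p)%N ->
     alpha t = 2 * m t + m (p.-1 - t)%N + m (p.+1 - t)%N - (t == 1%N)%:R * m p) ->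
  forall i, (1 <= i <= p - 1)%N -> n_proj p alpha i = m i.
Proof.
move=> p_odd p_gt1 m0 eq_alpha i hi; set h := p./2.
have ph : p = h.*2.+1 by have := odd_double_half p; rewrite p_odd.
pose xo j := if j == 0%N then 0 else if odd j then m j else m (p - j)%N.
pose xe j := if odd j then m (p - j)%N else m j.
pose eo j := if odd j then alpha j else alpha (p - j)%N.
pose ee j := if odd j then alpha (p - j)%N else alpha j.
have split_sum (k : nat) f g :
    \sum_(1 <= j < h.+1 | odd j) Gamma p k j * f j
      + \sum_(1 <= j < h.+1 | ~~ odd j) Gamma p k j * g j
    = \sum_(1 <= j < h.+1) Gamma p k j * (if odd j then f j else g j).
  rewrite [RHS](bigID (fun j => odd j)) /=; congr (_ + _); apply: eq_bigr => j.
    by move=> ->.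
  by move/negPf=> ->.
have h_gt0 : (0 < h)%N by lia.
have solve_o k : (1 <= k <= h)%N -> \sum_(1 <= j < h.+1) Gamma p k j * eo j = xo k.
  have e1 : xo h.+1 = xo h.
    rewrite /xo; have -> : (p - h.+1 = h)%N by lia.
    have -> : (p - h = h.+1)%N by lia.
    by rewrite /= (gtn_eqF h_gt0); case: (odd h).
  apply: (@Gamma_solve p h xo eo ph _ e1) => // j hj; rewrite /xo /eo.
  case: j hj => // j hj /=; case odd_j: (odd j) => /=.
    have ht : (1 <= p - j.+1 < p)%N by lia.
    rewrite eq_alpha //; have -> : (p - j.+1 == 1)%N = false by apply/eqP; lia.
    have -> : (p.-1 - (p - j.+1) = j)%N by lia.
    have -> : (p.+1 - (p - j.+1) = j.+2)%N by lia.
    by case: (j) odd_j => [|k1] //= _; rewrite mul0r subr0.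
  have ht : (1 <= j.+1 < p)%N by lia.
  rewrite eq_alpha //; have -> : (p.-1 - j.+1 = p - j.+2)%N by lia.
  have -> : (p.+1 - j.+1 = p - j)%N by lia.
  have [j0|nj] := eqVneq j 0%N.
    by rewrite j0 subn0 eqxx mul1r addr0 addrK.
  rewrite eqSS (negPf nj) mul0r subr0.
  by rewrite addrAC.
have solve_e k : (1 <= k <= h)%N -> \sum_(1 <= j < h.+1) Gamma p k j * ee j = xe k.
  have e1 : xe h.+1 = xe h.
    rewrite /xe; have -> : (p - h.+1 = h)%N by lia.
    have -> : (p - h = h.+1)%N by lia.
    by rewrite /=; case: (odd h).
  apply: (@Gamma_solve p h xe ee ph _ e1) => // j hj; rewrite /xe /ee.
  case: j hj => // j hj /=; case odd_j: (odd j) => /=.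
    have ht : (1 <= j.+1 < p)%N by lia.
    rewrite eq_alpha //; have -> : (p.-1 - j.+1 = p - j.+2)%N by lia.
    have -> : (p.+1 - j.+1 = p - j)%N by lia.
    case: (j) odd_j => [|k'] //= _; rewrite mul0r subr0.
    by rewrite addrAC.
  have ht : (1 <= p - j.+1 < p)%N by lia.
  rewrite eq_alpha //; have -> : (p - j.+1 == 1)%N = false by apply/eqP; lia.
  have -> : (p.-1 - (p - j.+1) = j)%N by lia.
  have -> : (p.+1 - (p - j.+1) = j.+2)%N by lia.
  by rewrite mul0r subr0.
rewrite /n_proj -/h; case odd_i: (odd i); case: leqP => le_i; rewrite split_sum.
- rewrite solve_o; last by lia.
  by rewrite /xo odd_i; case: i hi odd_i le_i.
- rewrite solve_o; last by lia.
  rewrite /xo oddB ?p_odd ?odd_i /=; last by lia.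
  have -> : (p - i == 0)%N = false by apply/eqP; lia.
  by rewrite subKn //; lia.
- rewrite solve_e; last by lia.
  by rewrite /xe odd_i.
- rewrite solve_e; last by lia.
  rewrite /xe oddB ?p_odd ?odd_i /=; last by lia.
  by rewrite subKn //; lia.
Qed.

End GammaInverse.

(** * Green correspondents and the decomposition of M *)

Section Restriction.

Variables (F : fieldType) (gT : finGroupType) (G H : {group gT}).
Hypothesis sHG : H \subset G.

Lemma res_dadd (W X : representation F G) :
  mx_rsim (res_grepr sHG (dadd_grepr W X)) (dadd_grepr (res_grepr sHG W) (res_grepr sHG X)).
Proof.
exists 1%:M => //; first by rewrite row_free_unit unitmx1.
by move=> x Hx; rewrite mulmx1 mul1mx.
Qed.

Lemma res_big (I : Type) (r : seq I) (A : I -> representation F G) :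
  mx_rsim (res_grepr sHG (\big[dadd_grepr/grepr0]_(i <- r) A i))
          (\big[dadd_grepr/grepr0]_(i <- r) res_grepr sHG (A i)).
Proof.
elim: r => [|i r IHr].
  by rewrite !big_nil; exists 1%:M; rewrite // row_free_unit unitmx1.
rewrite !big_cons; apply: mx_rsim_trans (res_dadd _ _) _.
exact: rsim_dadd (mx_rsim_refl _) IHr.
Qed.

Lemma stab_dadd_higman (W Q : representation F G) : higman Q -> stable_iso (dadd_grepr W Q) W.
Proof.
move=> hQ; apply: stab_trans (stab_dadd (rsim_stab (mx_rsim_refl _)) (higman_stab0 hQ)) _.
apply/rsim_stab; apply: mx_rsim_trans (rsim_daddC _ _) _; exact: rsim_dadd0.
Qed.

End Restriction.

Section Summands.

Variables (F : closedFieldType) (p : nat) (charF : p \in [pchar F]).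
Local Notation Vm := (V_mod charF).
Local Notation res := (res_grepr (borel_sub p)).

Variable U : nat -> nat -> representation F (borel p).
Hypothesis hU : forall a b, (a <= p - 2)%N -> (1 <= b <= p)%N -> is_U charF a b (U a b).
Variable V : nat -> nat -> representation F (SL2 p).
Hypothesis hV : forall a b, (a <= p - 2)%N -> (1 <= b <= p - 1)%N ->
  is_green_correspondent (U a b) (V a b).
Variable n : nat -> nat -> nat.

Let p_prime : prime p := pcharf_prime charF.

Definition green_sum : representation F (SL2 p) :=
  \big[dadd_grepr/grepr0]_(0 <= a < p.-1)
    \big[dadd_grepr/grepr0]_(1 <= b < p) muln_grepr (V a b) (n a b).

(** Over B, the summands with b = p are projective, and each V_{a,b} is U_{a,b}
    plus a projective module. *)
Lemma stab_res_green_sum :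
  stable_iso (\big[dadd_grepr/grepr0]_(0 <= a < p.-1)
          \big[dadd_grepr/grepr0]_(1 <= b < p.+1) muln_grepr (U a b) (n a b))
       (res green_sum).
Proof.
have p_gt1 := prime_gt1 p_prime.
apply: stab_trans _ (stab_sym (rsim_stab (res_big (borel_sub p) _ _))).
apply: stab_big => a; rewrite mem_index_iota => ha.
have ha2 : (a <= p - 2)%N by lia.
apply: stab_trans _ (stab_sym (rsim_stab (res_big (borel_sub p) _ _))).
have -> : index_iota 1 p.+1 = index_iota 1 p ++ [:: p].
  by rewrite /index_iota subSS subn0 -[p in iota 1 p](subnK (ltnW p_gt1)) iotaD subnKC // ltnW.
apply: stab_trans (rsim_stab (rsim_big_cat _ _ _)) _.
have hS : higman (\big[dadd_grepr/grepr0]_(b <- [:: p]) muln_grepr (U a b) (n a b)).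
  rewrite big_cons big_nil; apply: higman_dadd (higman0 _ _).
  apply: higman_big => _; have hp : (1 <= p <= p)%N by lia.
  by have [dU uniU _] := hU ha2 hp; apply: (uniserial_higman charF).
apply: stab_trans (stab_dadd_higman _ hS) _.
apply: stab_big => b; rewrite mem_index_iota => hb.
apply: stab_trans _ (stab_sym (rsim_stab (res_big (borel_sub p) _ _))).
apply: stab_big => _ _; apply: stab_sym.
have hb1 : (1 <= b <= p - 1)%N by lia.
have [_ _ [Q [projQ rsV]]] := hV ha2 hb1.
exact: stab_trans (rsim_stab rsV) (stab_dadd_higman _ (proj_higman projQ)).
Qed.

Lemma green_sum_tr_unit : tr_unit green_sum.
Proof.
have p_gt1 := prime_gt1 p_prime.
apply: tr_unit_big => a; rewrite mem_index_iota => ha.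
apply: tr_unit_big => b; rewrite mem_index_iota => hb.
apply: tr_unit_big => _ _.
have ha2 : (a <= p - 2)%N by lia.
have hb1 : (1 <= b <= p - 1)%N by lia.
have [nprojV indecV _] := hV ha2 hb1.
by apply: tr_unit_indec => // /higman_proj.
Qed.

Variable P : nat -> representation F (SL2 p).
Hypothesis coverP : forall t, (1 <= t <= p)%N -> is_projective_cover (P t) (Vm t).

(** V_p would be a direct summand of the indecomposable module V_{a,b}, which
    would then be projective. *)
Lemma green_no_Steinberg a b : (a <= p - 2)%N -> (1 <= b <= p - 1)%N ->
  hdim (P p) (V a b) = 0%N.
Proof.
move=> ha hb; have [nprojV [_ indecV] _] := hV ha hb.
apply/eqP; rewrite eqn0Ngt; apply/negP => /(Steinberg_retract coverP)[f [r [hf hr fr]]].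
have [Q [j [pi [_ _ _ _ rsV]]]] := retract_split hf hr fr.
have [/= p0|Q0] := indecV _ _ rsV; first by move: p_prime; rewrite p0.
apply: nprojV; apply/higman_proj/(higman_rsim rsV)/higman_dadd; first exact: Vp_higman.
exact: higman_rsim (rsim_degree0 Q0 (erefl : rdegree grepr0 = 0%N)) (higman0 _ _).
Qed.

Lemma hdim_green_sum t : (1 <= t <= p)%N ->
  hdim (P t) green_sum =
    (\sum_(0 <= a < p.-1) \sum_(1 <= b < p) n a b * hdim (P t) (V a b))%N.
Proof.
move=> /coverP[projP _]; rewrite hdim_bigr //; apply: eq_bigr => a _.
by rewrite hdim_bigr //; apply: eq_bigr => b _; rewrite hdim_mulnr.
Qed.

End Summands.

Theorem theorem5p3
  (p : nat) (p_prime : prime p) (p_odd : odd p)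
  (F : closedFieldType) (charF : p \in [pchar F])
  (U : nat -> nat -> representation F (borel p))
  (hU : forall a b, (a <= p - 2)%N -> (1 <= b <= p)%N -> is_U charF a b (U a b))
  (V : nat -> nat -> representation F (SL2 p))
  (hV : forall a b, (a <= p - 2)%N -> (1 <= b <= p - 1)%N ->
          is_green_correspondent (U a b) (V a b))
  (P : nat -> representation F (SL2 p))
  (hP : forall t, (1 <= t <= p)%N -> is_projective_cover (P t) (V_mod charF t))
  (M : representation F (SL2 p))
  (l : nat -> nat)
  (hl : forall t, (1 <= t <= p)%N -> comp_mult M (V_mod charF t) (l t))
  (n : nat -> nat -> nat)
  (hn : mx_rsim (res_grepr (borel_sub p) M)
          (\big[dadd_grepr/grepr0]_(0 <= a < p.-1)
             \big[dadd_grepr/grepr0]_(1 <= b < p.+1)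
               muln_grepr (U a b) (n a b)))
  (c : nat -> nat -> nat -> nat)
  (hc : forall a b t,
          (a <= p - 2)%N -> (1 <= b <= p - 1)%N -> (1 <= t <= p)%N ->
          comp_mult (V a b) (V_mod charF t) (c a b t)) :
  let alpha (t : nat) : rat :=
    if t == p then (l p)%:R
    else (l t)%:R - \sum_(0 <= a < p.-1) \sum_(1 <= b < p)
                      (n a b)%:R * (c a b t)%:R in
  exists m : nat -> nat,
    [/\ mx_rsim M
          (dadd_grepr
             (\big[dadd_grepr/grepr0]_(0 <= a < p.-1)
                \big[dadd_grepr/grepr0]_(1 <= b < p)
                  muln_grepr (V a b) (n a b))
             (\big[dadd_grepr/grepr0]_(1 <= i < p.+1)
                muln_grepr (P i) (m i))),
        (m p)%:R = alpha p
      & forall i, (1 <= i <= p - 1)%N -> (m i)%:R = n_proj p alpha i].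
Proof.
have p_gt1 := prime_gt1 p_prime.
move=> alpha; pose X := green_sum V n.
have stMX : stable_iso M X.
  apply/(stab_borel charF)/(stab_trans (rsim_stab hn)).
  exact: (stab_res_green_sum hU hV).
have [Q hQ rsM] := stab_split (stab_sym stMX) (green_sum_tr_unit charF hV (n := n)).
have [m rsQ] := proj_decomposition hP hQ.
exists m.
have mE t : (1 <= t <= p)%N -> hdim Q (V_mod charF t) = m t.
  by move=> ht; rewrite (hdim_rsiml _ rsQ) hdim_Psum_V.
have lE t : (1 <= t <= p)%N -> l t = (hdim (P t) X + hdim (P t) Q)%N.
  move=> ht; have [projP _] := hP t ht.
  rewrite (comp_mult_hdim projP (hP t ht) (V_irr charF ht) (hl t ht)).
  by rewrite (hdim_rsimr _ rsM) hdim_daddr.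
have hp : (1 <= p <= p)%N by rewrite (ltnW p_gt1) /=.
(* V_p is a composition factor of none of the V_{a,b}. *)
have alpha_p : alpha p = (hdim (P p) Q)%:R.
  rewrite /alpha eqxx lE // hdim_green_sum // big_nat_cond big1 ?add0n // => a ha.
  rewrite big_nat_cond big1 // => b hb.
  by rewrite (green_no_Steinberg hV hP) ?muln0 //; lia.
have alpha_t t : (1 <= t < p)%N -> alpha t = (hdim (P t) Q)%:R.
  move=> ht; have htp : (1 <= t <= p)%N by lia.
  rewrite /alpha; have -> : (t == p) = false by apply/eqP; lia.
  rewrite lE // natrD hdim_green_sum // natr_sum.
  rewrite [X in _ - X](_ : _ = \sum_(0 <= a < p.-1)
      (\sum_(1 <= b < p) n a b * hdim (P t) (V a b))%:R); first by rewrite addrC addKr.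
  apply: eq_big_nat => a ha; rewrite natr_sum; apply: eq_big_nat => b hb.
  rewrite natrM; congr (_ * _%:R).
  have ha2 : (a <= p - 2)%N by lia.
  have hb1 : (1 <= b <= p - 1)%N by lia.
  have [projP _] := hP t htp.
  exact (comp_mult_hdim projP (hP t htp) (V_irr charF htp) (hc a b t ha2 hb1 htp)).
split.
- exact: mx_rsim_trans rsM (rsim_dadd (mx_rsim_refl _) rsQ).
- by rewrite alpha_p (hdim_Pp hP hQ) mE.
move=> i hi; apply/esym.
pose mm j : rat := (hdim Q (V_mod charF j))%:R.
have -> : (m i)%:R = mm i by rewrite /mm mE //; lia.
apply: n_proj_solve => // [|t ht]; first by rewrite /mm hdim0r.
rewrite alpha_t //.
apply: (canRL (addrK _)); rewrite /mm -[2 in RHS]/(2%:R) -!natrM -!natrD.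
by rewrite (cartan hP p_odd hQ ht).
Qed.
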